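(* Let $\rho_0\in R(S^2,6)_{\rm ab}$ be the class of the representation with $x_\ell\mapsto\mathbf{i}$ for $\ell=1,\dots,5$ and $x_6\mapsto-\mathbf{i}$. The link of the singular point $\rho_0$ in $R(S^2,6)_B$ is diffeomorphic to $\mathbb{R}P^3$ and its link in $R(S^2,6)$ is diffeomorphic to $S^2\times S^3$. Moreover, the link $S^2\times S^3$ embeds in $\mathbb{C}P^3$, is invariant under complex conjugation of $\mathbb{C}P^3$, and the fixed point set of complex conjugation on it is the link $\mathbb{R}P^3$ of $\rho_0$ in $R(S^2,6)_B$.
   Context: $SU(2)$ is identified with the unit quaternions with imaginary units $\mathbf{i},\mathbf{j},\mathbf{k}$; $\operatorname{Re}$ is the real part of a quaternion. Complex numbers are regarded as quaternions $x+y\mathbf{i}$. Write $\pi_1(S^2\setminus\{a_i\}_{i=1}^6)=\langle x_1,\dots,x_6\mid x_1\cdots x_6=1\rangle$, with $x_i$ a loop around $a_i$. Then $$R(S^2,6)=\{\rho\in\operatorname{Hom}(\pi_1(S^2\setminus\{a_i\}),SU(2))\mid\operatorname{Re}\rho(x_i)=0\text{ for all }i\}/\text{conjugation},$$ $R(S^2,6)_{\rm ab}$ is the subset of classes with abelian image, and $R(S^2,6)_B$ is the subset of classes of representations conjugate to one with image in $B=\{e^{\theta\mathbf{k}}\}\cup\{e^{\theta\mathbf{k}}\mathbf{i}\}$ and sending every $x_\ell$ into $\{e^{\theta\mathbf{k}}\mathbf{i}\}$. Local model and links: let $$h:\mathbb{C}^4\to\mathbb{R},\quad h(z_1,z_2,z_3,z_4)=\operatorname{Re}(\mathbf{i}\,e^{-z_1\mathbf{j}}e^{z_2\mathbf{j}}e^{-z_3\mathbf{j}}e^{z_4\mathbf{j}}),$$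 which is invariant under the diagonal scalar action of $S^1$ on $\mathbb{C}^4$. A neighborhood of $0$ in $h^{-1}(0)/S^1$ is identified with a neighborhood of $\rho_0$ in $R(S^2,6)$ by sending $(z_1,\dots,z_4)$ to the class of the representation $x_1\mapsto\mathbf{i}$, $x_{\ell+1}\mapsto e^{z_\ell\mathbf{j}}\mathbf{i}$ for $\ell=1,\dots,4$, with $x_6$ determined by $x_1\cdots x_6=1$. The points of $\mathbb{R}^4\subset h^{-1}(0)$ represent the classes in $R(S^2,6)_B$ near $\rho_0$. For a sufficiently small sphere $S^7\subset\mathbb{C}^4$ centered at $0$, the link of $\rho_0$ in $R(S^2,6)$ is $(h^{-1}(0)\cap S^7)/S^1$, and its link in $R(S^2,6)_B$ is the image of $\mathbb{R}^4\cap S^7$ in this quotient; neighborhoods of $\rho_0$ in these spaces are cones on these links. Here $S^7/S^1=\mathbb{C}P^3$, and complex conjugation on $\mathbb{C}P^3$ is induced by coordinatewise complex conjugation on $\mathbb{C}^4$. *)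

(* Defs.v *)
From HB Require Import structures.
From mathcomp Require Import all_boot all_order all_algebra.
From mathcomp Require Import all_classical all_reals all_analysis.
From mathcomp Require Import complex.
From mathcomp Require Import ring lra zify.

Set Implicit Arguments.
Unset Strict Implicit.
Unset Printing Implicit Defensive.
Import Order.TTheory GRing.Theory Num.Theory.
Import numFieldNormedType.Exports.
Import ComplexField.

Local Open Scope classical_set_scope.
Local Open Scope ring_scope.

Section Smooth.
Variable R : realType.

(* f is of class C^k on the open set O. The ambient spaces used below are
   finite dimensional, where this is the usual notion. *)
Fixpoint class_C (k : nat) (V W : normedModType R) (O : set V) (f : V -> W)
    : Prop :=
  match k with
  | 0 => forall x, O x -> {for x, continuous f}
  | k'.+1 => (forall x, O x -> differentiable f x) /\
             (forall v : V, class_C k' O ('D_v f))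
  end.

Definition smooth_on (V W : normedModType R) (O : set V) (f : V -> W) : Prop :=
  forall k, class_C k O f.

(* A space presented as a quotient of a subset of a normed space: its points
   are the qs_proj x for x in qs_total. A subset of a Euclidean space is
   presented by qs_proj = id, the quotient by a group by the orbit map. *)
Record quot_space := QuotSpace {
  qs_amb : normedModType R;
  qs_pt : Type;
  qs_total : set qs_amb;
  qs_proj : qs_amb -> qs_pt }.

Definition qs_points (M : quot_space) : set (qs_pt M) :=
  @qs_proj M @` @qs_total M.

(* Smoothness of F from a subset A of (the points of) M to a subset B of N:
   near every x over A, F lifts to a map which is the restriction of a smooth
   map defined on an open neighbourhood of x in the ambient space. When
   qs_proj = id this is the usual smoothness for maps between arbitrary subsets
   of Euclidean spaces. In the quotient of a submanifold by a free action of a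
   compact Lie group it is smoothness for the quotient manifold structure,
   since the orbit map is a submersion and so has smooth local sections. *)
Definition smooth_map (M N : quot_space) (A : set (qs_pt M)) (B : set (qs_pt N))
    (F : qs_pt M -> qs_pt N) : Prop :=
  (forall p, A p -> B (F p)) /\
  forall x, qs_total x -> A (qs_proj x) ->
    exists (O : set (qs_amb M)) (f : qs_amb M -> qs_amb N),
      [/\ open O, O x, smooth_on O f
        & forall y, O y -> qs_total y -> A (qs_proj y) ->
            qs_total (f y) /\ qs_proj (f y) = F (qs_proj y)].

Definition diffeomorphism (M N : quot_space)
    (A : set (qs_pt M)) (B : set (qs_pt N)) (F : qs_pt M -> qs_pt N) : Prop :=
  smooth_map A B F /\
  exists G : qs_pt N -> qs_pt M,
    [/\ smooth_map B A G, forall p, A p -> G (F p) = p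
      & forall q, B q -> F (G q) = q].

Definition diffeomorphic (M N : quot_space)
    (A : set (qs_pt M)) (B : set (qs_pt N)) : Prop :=
  exists F, diffeomorphism A B F.

(* F @` A carries the structure induced from N: for A a manifold this says that
   F @` A is a smooth submanifold of N and F a diffeomorphism onto it. *)
Definition smooth_embedding (M N : quot_space) (A : set (qs_pt M))
    (F : qs_pt M -> qs_pt N) : Prop :=
  smooth_map A (@qs_points N) F /\ diffeomorphism A (F @` A) F.

(* The library norm on row vectors is the sup norm. *)
Definition dotsq n (x : 'rV[R]_n) : R := \sum_(i < n) x 0 i ^+ 2.

Definition sphere n : set 'rV[R]_n.+1 := [set x | dotsq x = 1].

Definition S2xS3_space : quot_space :=
  @QuotSpace ('rV[R]_3 * 'rV[R]_4)%type _
    (@sphere 2 `*` @sphere 3) id.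

Definition S2xS3 : set (qs_pt S2xS3_space) := @qs_points S2xS3_space.

Definition antipodal_pair (x : 'rV[R]_4) : set 'rV[R]_4 := [set x; - x].

Definition RP3_space : quot_space :=
  @QuotSpace 'rV[R]_4 _ (@sphere 3) antipodal_pair.

Definition RP3 : set (qs_pt RP3_space) := @qs_points RP3_space.

(* z = (x, y) stands for the vector x + i y. *)
Definition C4 : normedModType R := ('rV[R]_4 * 'rV[R]_4)%type.

Definition mkC4 (x y : 'rV[R]_4) : C4 := (x, y).

(* The coordinate z_(l+1), for l < 4. *)
Definition coordC4 (z : C4) (l : nat) : R[i] :=
  (z.1 0 (inord l) +i* z.2 0 (inord l))%C.

Definition conjC4 (z : C4) : C4 := mkC4 z.1 (- z.2).

Definition realC4 : set C4 := [set z | z.2 = 0].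

Definition scaleC4 (c : R[i]) (z : C4) : C4 :=
  mkC4 (complex.Re c *: z.1 - complex.Im c *: z.2)
       (complex.Re c *: z.2 + complex.Im c *: z.1).

Definition S7 (eps : R) : set C4 := [set z | dotsq z.1 + dotsq z.2 = eps ^+ 2].

Definition circle_orbit (z : C4) : set C4 :=
  [set scaleC4 c z | c in [set c : R[i] | `|c| = 1]].

(* CP^3 = S^7 / S^1, for the sphere of radius eps. *)
Definition CP3_space (eps : R) : quot_space :=
  @QuotSpace C4 _ (S7 eps) circle_orbit.

Definition CP3 (eps : R) : set (qs_pt (CP3_space eps)) :=
  @qs_points (CP3_space eps).

Definition conjCP3 (p : set C4) : set C4 := conjC4 @` p.

End Smooth.

Arguments S2xS3 : clear implicits.
Arguments S2xS3_space : clear implicits.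
Arguments RP3 : clear implicits.
Arguments RP3_space : clear implicits.

Record quat (R : realType) := Quat { qre : R; qim : R; qjm : R; qkm : R }.

Section Quaternions.
Variable R : realType.
Implicit Types (q : quat R) (z : C4 R).

Definition quat_tuple q := (qre q, qim q, qjm q, qkm q).
Definition tuple_quat (t : R * R * R * R) :=
  let: (a, b, c, d) := t in Quat a b c d.

Lemma quat_tupleK : cancel quat_tuple tuple_quat.
Proof. by case. Qed.

HB.instance Definition _ := Choice.copy (quat R) (can_type quat_tupleK).

Definition qadd p q :=
  Quat (qre p + qre q) (qim p + qim q) (qjm p + qjm q) (qkm p + qkm q).
Definition qopp q := Quat (- qre q) (- qim q) (- qjm q) (- qkm q).
Definition qmul p q :=
  let: Quat a b c d := p in let: Quat a' b' c' d' := q in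
  Quat (a * a' - b * b' - c * c' - d * d')
       (a * b' + b * a' + c * d' - d * c')
       (a * c' - b * d' + c * a' + d * b')
       (a * d' + b * c' - c * b' + d * a').

Fact qaddA : associative qadd.
Proof. by move=> [? ? ? ?] [? ? ? ?] [? ? ? ?]; congr Quat => /=; ring. Qed.
Fact qaddC : commutative qadd.
Proof. by move=> [? ? ? ?] [? ? ? ?]; congr Quat => /=; ring. Qed.
Fact qadd0 : left_id (Quat 0 0 0 0) qadd.
Proof. by move=> [? ? ? ?]; congr Quat => /=; ring. Qed.
Fact qaddN : left_inverse (Quat 0 0 0 0) qopp qadd.
Proof. by move=> [? ? ? ?]; congr Quat => /=; ring. Qed.

HB.instance Definition _ :=
  GRing.isZmodule.Build (quat R) qaddA qaddC qadd0 qaddN.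

Fact qmulA : associative qmul.
Proof. by move=> [? ? ? ?] [? ? ? ?] [? ? ? ?]; congr Quat => /=; ring. Qed.
Fact qmul1l : left_id (Quat 1 0 0 0) qmul.
Proof. by move=> [? ? ? ?]; congr Quat => /=; ring. Qed.
Fact qmul1r : right_id (Quat 1 0 0 0) qmul.
Proof. by move=> [? ? ? ?]; congr Quat => /=; ring. Qed.
Fact qmulDl : left_distributive qmul qadd.
Proof. by move=> [? ? ? ?] [? ? ? ?] [? ? ? ?]; congr Quat => /=; ring. Qed.
Fact qmulDr : right_distributive qmul qadd.
Proof. by move=> [? ? ? ?] [? ? ? ?] [? ? ? ?]; congr Quat => /=; ring. Qed.
Fact qone_neq0 : Quat 1 0 0 0 != 0 :> quat R.
Proof. by apply/eqP => -[]/eqP; rewrite oner_eq0. Qed.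

HB.instance Definition _ :=
  GRing.Zmodule_isNzRing.Build (quat R) qmulA qmul1l qmul1r qmulDl qmulDr
    qone_neq0.

Definition qi : quat R := Quat 0 1 0 0.
Definition qj : quat R := Quat 0 0 1 0.
Definition qk : quat R := Quat 0 0 0 1.
Definition quat_of_C (c : R[i]) : quat R :=
  Quat (complex.Re c) (complex.Im c) 0 0.

Definition qconj q := Quat (qre q) (- qim q) (- qjm q) (- qkm q).
Definition qnormsq q := qre q ^+ 2 + qim q ^+ 2 + qjm q ^+ 2 + qkm q ^+ 2.

(* e^q = sum_n q^n / n!, summed in each coordinate. *)
Definition qexp q : quat R :=
  let coord_sum (co : quat R -> R) :=
    limn (series (fun n => co (q ^+ n) / n`!%:R)) in
  Quat (coord_sum (@qre R)) (coord_sum (@qim R))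
       (coord_sum (@qjm R)) (coord_sum (@qkm R)).

(* Inverses in SU(2) are given by qconj. *)
Definition SU2 : set (quat R) := [set q | qnormsq q = 1].

(* A homomorphism to SU(2) from <x_1, ..., x_6 | x_1 ... x_6 = 1>, as the
   tuple of the images of the generators: rho l is the image of x_(l+1). *)
Definition rep := 'I_6 -> quat R.

Definition is_rep (rho : rep) : Prop :=
  (forall l, SU2 (rho l)) /\ \prod_(l < 6) rho l = 1.

Definition traceless_rep (rho : rep) : Prop :=
  is_rep rho /\ forall l, qre (rho l) = 0.

Definition conj_class (rho : rep) : set rep :=
  [set rho' | exists2 g, SU2 g & forall l, rho' l = g * rho l * qconj g].

Definition subgroup_SU2 (H : set (quat R)) : Prop :=
  [/\ H `<=` SU2, H 1, forall p q, H p -> H q -> H (p * q)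
    & forall q, H q -> H (qconj q)].

Definition rep_image (rho : rep) : set (quat R) :=
  [set q | forall H, subgroup_SU2 H -> (forall l, H (rho l)) -> H q].

Definition abelian_rep (rho : rep) : Prop :=
  forall p q, rep_image rho p -> rep_image rho q -> p * q = q * p.

(* B is the union of Bk and Bi. *)
Definition Bk : set (quat R) := [set qexp (Quat 0 0 0 theta) | theta in setT].
Definition Bi : set (quat R) :=
  [set qexp (Quat 0 0 0 theta) * qi | theta in setT].

Definition R26 : set (set rep) := conj_class @` [set rho | traceless_rep rho].
Definition R26ab : set (set rep) :=
  conj_class @` [set rho | traceless_rep rho /\ abelian_rep rho].
Definition R26B : set (set rep) :=
  conj_class @` [set rho | traceless_rep rho /\
    exists rho', [/\ conj_class rho rho', rep_image rho' `<=` Bk `|` Bi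
                   & forall l, Bi (rho' l)]].

Definition rho0_rep : rep := fun l => if (l < 5)%N then qi else - qi.
Definition rho0 : set rep := conj_class rho0_rep.

(* zj z l is the quaternion z_(l+1) j. *)
Definition zj z (l : nat) : quat R := quat_of_C (coordC4 z l) * qj.

Definition h z : R :=
  qre (qi * qexp (- zj z 0) * qexp (zj z 1) * qexp (- zj z 2) * qexp (zj z 3)).

Definition local_gen z (l : nat) : quat R :=
  if l is l'.+1 then qexp (zj z l') * qi else qi.

Definition local_rep z : rep := fun l =>
  if (l < 5)%N then local_gen z l else qconj (\prod_(m < 5) local_gen z m).

(* The link of rho0 in X, a subset of R26: the set of points of
   (h^-1(0) cap S^7) / S^1, with S^7 of radius eps, which the local model
   identifies with points of X. The spelled-out cases X = R26 and X = R26B are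
   link_R26E and link_R26BE. *)
Definition link (X : set (set rep)) (eps : R) : set (qs_pt (CP3_space eps)) :=
  @circle_orbit R @`
    [set z | [/\ S7 eps z, h z = 0 & X (conj_class (local_rep z))]].

End Quaternions.

Arguments qi {R}.
Arguments qj {R}.
Arguments qk {R}.
Arguments link {R} X eps _.
Arguments R26 {R} _.
Arguments R26ab {R} _.
Arguments R26B {R} _.
Arguments rho0 {R} _.

Section LocalModel.
Variable R : realType.
Implicit Types (p q g : quat R) (z w : C4 R) (rho : rep R) (X : set (set (rep R))).

Lemma qmulE p q : p * q =
  Quat (qre p * qre q - qim p * qim q - qjm p * qjm q - qkm p * qkm q)
       (qre p * qim q + qim p * qre q + qjm p * qkm q - qkm p * qjm q)
       (qre p * qjm q - qim p * qkm q + qjm p * qre q + qkm p * qim q)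
       (qre p * qkm q + qim p * qjm q - qjm p * qim q + qkm p * qre q).
Proof. by case: p q => [? ? ? ?] [? ? ? ?]. Qed.

Lemma qoneE : 1 = Quat 1 0 0 0 :> quat R. Proof. by []. Qed.

Lemma qoppE q : - q = Quat (- qre q) (- qim q) (- qjm q) (- qkm q).
Proof. by []. Qed.

Definition qE := (qmulE, qoneE, qoppE).

Lemma quat_eqP p q : qre p = qre q -> qim p = qim q -> qjm p = qjm q ->
  qkm p = qkm q -> p = q.
Proof. by case: p q => [? ? ? ?] [? ? ? ?] /= -> -> -> ->. Qed.

Lemma qconjM p q : qconj (p * q) = qconj q * qconj p.
Proof. by rewrite !qE /qconj /=; apply: quat_eqP => /=; ring. Qed.

Lemma qconjK : involutive (@qconj R).
Proof. by move=> [? ? ? ?]; rewrite /qconj /= !opprK. Qed.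

Lemma qnormsqM p q : qnormsq (p * q) = qnormsq p * qnormsq q.
Proof. by rewrite !qE /qnormsq /=; ring. Qed.

Lemma SU2_mulV q : SU2 q -> q * qconj q = 1.
Proof.
rewrite /SU2 /qnormsq /= => Hq; rewrite !qE /qconj.
by apply: quat_eqP => /=; [rewrite -Hq| | |]; ring.
Qed.

Lemma SU2_conj q : SU2 q -> SU2 (qconj q).
Proof. by rewrite /SU2 /qnormsq /= => <-; ring. Qed.

Lemma SU2_Vmul q : SU2 q -> qconj q * q = 1.
Proof. by move=> /SU2_conj/SU2_mulV; rewrite qconjK. Qed.

Lemma SU2M p q : SU2 p -> SU2 q -> SU2 (p * q).
Proof. by rewrite /SU2 /= => Hp Hq; rewrite qnormsqM Hp Hq mulr1. Qed.

Lemma SU2_1 : SU2 (1 : quat R).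
Proof. by rewrite /SU2 /qnormsq /= expr1n expr0n /= !addr0. Qed.

Lemma SU2_qi : SU2 (qi : quat R).
Proof. by rewrite /SU2 /qnormsq /= expr1n expr0n /= !addr0 add0r. Qed.

Let scaleq (a : R) q : quat R := Quat (a * qre q) (a * qim q) (a * qjm q) (a * qkm q).

Let pure_sqr q : qre q = 0 -> q * q = scaleq (- qnormsq q) 1.
Proof.
by case: q => [a b c d] /= ->; rewrite !qE /qnormsq; apply: quat_eqP => /=; ring.
Qed.

Let pure_even q m : qre q = 0 -> q ^+ m.*2 = scaleq ((- qnormsq q) ^+ m) 1.
Proof.
move=> q0; elim: m => [|m IH].
  by rewrite expr0 qoneE; apply: quat_eqP => /=; ring.
rewrite doubleS 2!exprS mulrA pure_sqr // IH exprS !qE.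
by apply: quat_eqP => /=; ring.
Qed.

Let pure_odd q m : qre q = 0 -> q ^+ m.*2.+1 = scaleq ((- qnormsq q) ^+ m) q.
Proof.
by move=> q0; rewrite exprS pure_even // !qE; apply: quat_eqP => /=; ring.
Qed.

Let coord_sum (co : quat R -> R) q (t := Num.sqrt (qnormsq q)) :
  qre q = 0 -> (forall a q, co (scaleq a q) = a * co q) -> co 1 = 0 ->
  limn (series (fun n => co (q ^+ n) / n`!%:R)) = sin t / t * co q.
Proof.
move=> q0 coZ co1.
have q_ge0 : 0 <= qnormsq q by rewrite /qnormsq !addr_ge0 // sqr_ge0.
have t2 : t ^+ 2 = qnormsq q by rewrite sqr_sqrtr.
rewrite (_ : (fun n => _) = (co q / t) *: (sin_coeff t : R^nat)); last first.
  apply/funext => n; rewrite /sin_coeff fctE /GRing.scale /=.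
  have [m ->] : exists m, n = (m.*2 + odd n)%N.
    by exists n./2; rewrite addnC odd_double_half.
  rewrite oddD odd_double oddb /=; case: (odd n) => /=.
    rewrite addn1 pure_odd // coZ -t2 [m.*2.+1.-1]/= doubleK mul1r [(- t ^+ 2) ^+ _]exprNn.
    rewrite -exprM mul2n exprS.
    have [t0|t_neq0] := eqVneq t 0.
      have : qnormsq q = 0 by rewrite -t2 t0 expr0n.
      rewrite /qnormsq => N0.
      have [b0 c0 d0] : [/\ qim q = 0, qjm q = 0 & qkm q = 0].
        by split; nra.
      have -> : q = scaleq 0 1 by apply: quat_eqP => /=; lra.
      by rewrite coZ; ring.
    by field; rewrite t_neq0 pnatr_eq0 -lt0n fact_gt0.
  by rewrite addn0 pure_even // coZ co1 mulr0 !mul0r mulr0.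
rewrite lim_seriesZ; last exact: is_cvg_series_sin_coeff.
rewrite [X in _ *: X](_ : _ = sin t); last by rewrite unlock.
by rewrite /GRing.scale /=; ring.
Qed.

Lemma qexp_pure q (t := Num.sqrt (qnormsq q)) (s := sin t / t) : qre q = 0 ->
  qexp q = Quat (cos t) (s * qim q) (s * qjm q) (s * qkm q).
Proof.
move=> q0; rewrite /qexp; congr Quat; [|exact: coord_sum..].
have q_ge0 : 0 <= qnormsq q by rewrite /qnormsq !addr_ge0 // sqr_ge0.
have t2 : t ^+ 2 = qnormsq q by rewrite sqr_sqrtr.
rewrite unlock; congr (limn (series _)); apply/funext => n; rewrite /cos_coeff /=.
have [m ->] : exists m, n = (m.*2 + odd n)%N.
  by exists n./2; rewrite addnC odd_double_half.
rewrite oddD odd_double oddb /=; case: (odd n) => /=.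
  by rewrite addn1 pure_odd //= q0 mulr0 !mul0r.
rewrite addn0 pure_even //= mulr1 mul1r half_double -t2 [(- (t ^+ 2)) ^+ _]exprNn.
by rewrite -exprM mul2n.
Qed.

Lemma SU2_qexp q : qre q = 0 -> SU2 (qexp q).
Proof.
move=> q0; rewrite qexp_pure // /SU2 /=; set t := Num.sqrt _.
have N_ge0 : 0 <= qnormsq q by rewrite /qnormsq !addr_ge0 // sqr_ge0.
have t2 : t ^+ 2 = qnormsq q by rewrite sqr_sqrtr.
have Nq : qim q ^+ 2 + qjm q ^+ 2 + qkm q ^+ 2 = t ^+ 2.
  by rewrite t2 /qnormsq q0 expr0n add0r.
rewrite /qnormsq /= !exprMn.
rewrite -[LHS](_ : cos t ^+ 2 + (sin t / t) ^+ 2 *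
  (qim q ^+ 2 + qjm q ^+ 2 + qkm q ^+ 2) = _); last by rewrite exprMn; ring.
rewrite Nq -exprMn.
have [->|t_neq0] := eqVneq t 0; last by rewrite divfK // cos2Dsin2.
by rewrite cos0 expr1n mulr0 expr0n /= addr0.
Qed.

Lemma qexp_k (a : R) : qexp (Quat 0 0 0 a) = Quat (cos a) 0 0 (sin a).
Proof.
rewrite qexp_pure //= /qnormsq /= expr0n /= !add0r sqrtr_sqr !mulr0.
have [->|a_neq0] := eqVneq a 0.
  by rewrite normr0 sin0 cos0 mulr0.
congr Quat; case: (ger0P a) => [_|_].
- by [].
- by rewrite cosN.
- by rewrite divfK.
by rewrite sinN; field.
Qed.

Let zjE z l :
  zj z l = Quat 0 0 (z.1 0 (inord l)) (z.2 0 (inord l)).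
Proof. by rewrite /zj /quat_of_C qmulE; apply: quat_eqP => /=; ring. Qed.

Let qexpN q : qre q = 0 -> qexp (- q) = qconj (qexp q).
Proof.
move=> q0; rewrite !qexp_pure /qconj ?qoppE /= ?q0 ?oppr0 //.
by rewrite /qnormsq /= !sqrrN ?q0 !mulrN.
Qed.

Let pure_zj z l : qre (zj z l) = 0. Proof. by rewrite zjE. Qed.

Let local_genS z l : let q := qexp (zj z l) in
  local_gen z l.+1 = Quat 0 (qre q) (qkm q) (- qjm q) /\ qim q = 0.
Proof.
move=> q; rewrite /q /local_gen qexp_pure ?pure_zj // !zjE /= mulr0; split=> //.
by rewrite qmulE; apply: quat_eqP => /=; ring.
Qed.

Lemma SU2_local_gen z l : SU2 (local_gen z l).
Proof.
case: l => [|l] /=; first exact: SU2_qi.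
by apply: SU2M; [apply/SU2_qexp/pure_zj | exact: SU2_qi].
Qed.

Lemma SU2_prod n (F : nat -> quat R) : (forall l, SU2 (F l)) ->
  SU2 (\prod_(l < n) F l).
Proof. by move=> HF; apply: big_ind => //; [exact: SU2_1 | exact: SU2M]. Qed.

Lemma local_rep_is_rep z : is_rep (local_rep z).
Proof.
have HP : SU2 (\prod_(m < 5) local_gen z m).
  by apply: SU2_prod => l; exact: SU2_local_gen.
split=> [l|].
  by rewrite /local_rep; case: ifP => _; [exact: SU2_local_gen | exact: SU2_conj].
rewrite big_ord_recr /= -[RHS](SU2_mulV HP) /local_rep /=; congr (_ * _).
by apply: eq_bigr => l _ /=; rewrite ltn_ord.
Qed.

Let prod5 (F : nat -> quat R) :
  \prod_(l < 5) F l = F 0%N * (F 1%N * (F 2%N * (F 3%N * F 4%N))).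
Proof. by rewrite !big_ord_recl big_ord0 mulr1. Qed.

Lemma local_rep_traceless z : traceless_rep (local_rep z) <-> h z = 0.
Proof.
have -> : h z = qre (local_rep z ord_max).
  rewrite /local_rep /= prod5 /h !qexpN ?pure_zj //.
  rewrite /local_gen.
  have e0 l := (local_genS z l).2.
  move: (e0 0%N) (e0 1%N) (e0 2%N) (e0 3%N); cbv zeta.
  case: (qexp (zj z 0)) => ? ? ? ?; case: (qexp (zj z 1)) => ? ? ? ?.
  case: (qexp (zj z 2)) => ? ? ? ?; case: (qexp (zj z 3)) => ? ? ? ?.
  by move=> /= -> -> -> ->; rewrite ?qE /=; ring.
split=> [[_ ->//]|h0]; split=> [|l]; first exact: local_rep_is_rep.
have [l5|l5] := boolP (l < 5)%N; last first.
  rewrite -h0; congr (qre (local_rep z _)); apply/val_inj => /=.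
  by move: l5 (ltn_ord l); rewrite -leqNgt ltnS => ? ?; apply/eqP; rewrite eqn_leq; apply/andP.
rewrite /local_rep l5; case: (val l) => [//|m].
by rewrite (local_genS z m).1.
Qed.

Lemma local_rep0 : local_rep (0 : C4 R) = @rho0_rep R.
Proof.
have gen l : local_gen (0 : C4 R) l = qi.
  case: l => // l; rewrite /local_gen qexp_pure ?pure_zj // !zjE /= !mxE !mulr0.
  by rewrite /qnormsq /= expr0n /= !addr0 sqrtr0 cos0 mul1r.
apply/funext => l; rewrite /local_rep /rho0_rep; case: ifP => _ //.
rewrite prod5 !gen !qE /qconj.
by apply: quat_eqP => /=; ring.
Qed.

Lemma conj_class_refl rho : conj_class rho rho.
Proof.
exists 1; first exact: SU2_1.
by move=> l; rewrite mul1r !qE /qconj; apply: quat_eqP => /=; ring.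
Qed.

Lemma conj_class_eq rho rho' : conj_class rho rho' ->
  conj_class rho' = conj_class rho.
Proof.
move=> [g Hg E]; apply/seteqP; split=> sg [k Hk Ek].
  exists (k * g); first exact: SU2M.
  by move=> l; rewrite Ek E qconjM !mulrA.
exists (k * qconj g); first by apply: SU2M => //; exact: SU2_conj.
move=> l; rewrite Ek E qconjM qconjK.
rewrite !mulrA -(mulrA k (qconj g)) SU2_Vmul // mulr1.
by rewrite -!mulrA (mulrA (qconj g)) SU2_Vmul // mul1r.
Qed.

Let normc1 (c : R[i]) :
  (`|c| = 1) <-> (complex.Re c ^+ 2 + complex.Im c ^+ 2 = 1).
Proof.
rewrite normc_def; split=> [[E]|->]; last by rewrite sqrtr1.
have ge0 : 0 <= complex.Re c ^+ 2 + complex.Im c ^+ 2 by rewrite addr_ge0 // sqr_ge0.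
by rewrite -(sqr_sqrtr ge0) E expr1n.
Qed.

Lemma scaleC4A (c d : R[i]) z : scaleC4 c (scaleC4 d z) = scaleC4 (c * d) z.
Proof.
case: c d z => a b [a' b'] [x y]; rewrite /scaleC4 /mkC4 /=.
by congr pair; apply/rowP => l; rewrite !mxE; ring.
Qed.

Lemma scaleC41 z : scaleC4 1 z = z.
Proof.
case: z => x y; rewrite /scaleC4 /mkC4 /=.
by congr pair; apply/rowP => l; rewrite !mxE; ring.
Qed.

Lemma circle_orbit_refl z : circle_orbit z z.
Proof. by exists 1; [rewrite /= normr1 | exact: scaleC41]. Qed.

Lemma circle_orbit_eq z w : circle_orbit z w -> circle_orbit w = circle_orbit z.
Proof.
move=> [c /= c1 <-]; apply/seteqP; split=> v [d /= d1 <-].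
  by exists (d * c); [rewrite /= normrM c1 d1 mulr1 | rewrite scaleC4A].
exists (d / c); first by rewrite /= normrM normfV c1 d1 divr1.
by rewrite scaleC4A divfK // -normr_eq0 c1 oner_eq0.
Qed.

Lemma S7_scale (eps : R) (c : R[i]) z : `|c| = 1 ->
  S7 eps z -> S7 eps (scaleC4 c z).
Proof.
move=> /normc1 c1; rewrite /S7 /= => <-.
rewrite /dotsq -!big_split /=; apply: eq_bigr => l _; rewrite !mxE.
rewrite -[RHS]mul1r -c1; ring.
Qed.

(* The coordinates z_l have modulus less than pi. *)
Definition small z := forall l : 'I_4, z.1 0 l ^+ 2 + z.2 0 l ^+ 2 < pi ^+ 2.

Lemma S7_small (eps : R) z : 0 < eps < pi -> S7 eps z -> small z.
Proof.
move=> /andP[e0 epi] Hz l; apply: (@le_lt_trans _ _ (eps ^+ 2)).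
  rewrite -Hz /dotsq -big_split /= (bigD1 l) //= lerDl.
  by apply: sumr_ge0 => m _; rewrite addr_ge0 // sqr_ge0.
by rewrite ltrXn2r // ?nnegrE; lra.
Qed.

(* The common factor sin |z_l| / |z_l|. *)
Let sc z (l : 'I_4) (t := Num.sqrt (z.1 0 l ^+ 2 + z.2 0 l ^+ 2)) := sin t / t.

Let local_genE z (l : 'I_4) :
  local_gen z l.+1 = Quat 0 (cos (Num.sqrt (z.1 0 l ^+ 2 + z.2 0 l ^+ 2)))
     (sc z l * z.2 0 l) (- (sc z l * z.1 0 l)).
Proof.
rewrite /local_gen qexp_pure /zj /coordC4 inord_val /quat_of_C.
  rewrite !qE /qnormsq /= /sc.
  rewrite (_ : _ ^+ 2 + _ + _ + _ = z.1 0 l ^+ 2 + z.2 0 l ^+ 2); last ring.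
  by apply: quat_eqP => /=; ring.
by rewrite !qE /=; ring.
Qed.

Let sc_neq0 z (l : 'I_4) : small z -> z.1 0 l ^+ 2 + z.2 0 l ^+ 2 != 0 ->
  0 < sc z l.
Proof.
move=> /(_ l) sm n0; rewrite /sc; set t := Num.sqrt _.
have ge0 : 0 <= z.1 0 l ^+ 2 + z.2 0 l ^+ 2 by rewrite addr_ge0 // sqr_ge0.
have t0 : 0 < t by rewrite sqrtr_gt0 lt_neqAle eq_sym n0.
rewrite divr_gt0 // sin_gt0_pi // t0 /= -(@ltr_pXn2r _ 2) ?nnegrE ?pi_ge0 ?ltW //.
by rewrite sqr_sqrtr.
Qed.

Let ord5 (l : 'I_6) : (l < 5)%N ->
  l = 0%N :> nat \/ exists m : 'I_4, l = m.+1 :> nat.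
Proof.
case: (val l) => [|m] Hm; [by left | right].
by exists (@Ordinal 4 m Hm).
Qed.

Let local_rep_conj z w g : SU2 g -> g * qi * qconj g = qi ->
  (forall m : 'I_4, local_gen w m.+1 = g * local_gen z m.+1 * qconj g) ->
  forall l, local_rep w l = g * local_rep z l * qconj g.
Proof.
move=> Hg gi gE.
have E (l : 'I_6) : (l < 5)%N -> local_gen w l = g * local_gen z l * qconj g.
  by move=> /ord5[->|[m ->]]; [rewrite /= gi | exact: gE].
move=> l; rewrite /local_rep; case: ifP => [|_]; first exact: E.
have -> : \prod_(m < 5) local_gen w m = g * (\prod_(m < 5) local_gen z m) * qconj g.
  have : (5 <= 5)%N by []; elim: {-2}5%N => [_|n IH n5].
    by rewrite !big_ord0 mulr1 SU2_mulV.
  rewrite !big_ord_recr /= IH; last exact: ltnW.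
  have n6 : (n < 6)%N by exact: leq_trans n5 _.
  rewrite (E (Ordinal n6)) //= !mulrA -(mulrA _ (qconj g) g) SU2_Vmul //.
  by rewrite mulr1.
by rewrite !qconjM qconjK mulrA.
Qed.

Lemma conj_class_scale (c : R[i]) z : `|c| = 1 ->
  conj_class (local_rep (scaleC4 c z)) = conj_class (local_rep z).
Proof.
move=> c1; apply: conj_class_eq.
have [[p r] /= gg] : exists d : R[i], d ^+ 2 = c by exists (sqrtc c); rewrite sqr_sqrtc.
have pr : p ^+ 2 + r ^+ 2 = 1.
  apply/(normc1 (p +i* r)%C).
  have : `|(p +i* r)%C| ^+ 2 = 1 by rewrite -normrX gg.
  by move=> /eqP; rewrite sqrp_eq1 // => /eqP.
exists (Quat p r 0 0).
  by rewrite /SU2 /qnormsq /= -pr; ring.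
apply: local_rep_conj.
- by rewrite /SU2 /qnormsq /= -pr; ring.
- rewrite !qE /qconj; apply: quat_eqP => /=; try ring.
  by rewrite -[RHS]pr; ring.
move=> m; rewrite !local_genE.
have [cR cI] : complex.Re c = p ^+ 2 - r ^+ 2 /\ complex.Im c = 2 * p * r.
  by rewrite -gg /=; split; ring.
have N : (scaleC4 c z).1 0 m ^+ 2 + (scaleC4 c z).2 0 m ^+ 2 =
    z.1 0 m ^+ 2 + z.2 0 m ^+ 2.
  by rewrite /= !mxE -[RHS]mul1r -(normc1 c).1 //; ring.
rewrite /sc N; set C := cos _; set s := sin _ / _.
rewrite /= !mxE cR cI !qE /qconj; apply: quat_eqP => /=; try ring.
by rewrite -[LHS]mulr1 -pr; ring.
Qed.

Lemma h_scale (c : R[i]) z : `|c| = 1 -> h z = 0 -> h (scaleC4 c z) = 0.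
Proof.
move=> c1 /local_rep_traceless [_ tr]; apply/local_rep_traceless.
split=> [|l]; first exact: local_rep_is_rep.
have : conj_class (local_rep z) (local_rep (scaleC4 c z)).
  by rewrite -(conj_class_scale z c1); exact: conj_class_refl.
case=> g Hg ->; move: Hg (tr l); rewrite /SU2 /qnormsq !qE /=.
by case: (local_rep z l) g => [? ? ? ?] [? ? ? ?] /= _ ->; ring.
Qed.

Lemma link_R26E (eps : R) : link (@R26 R) eps =
  @circle_orbit R @` [set z | S7 eps z /\ h z = 0].
Proof.
rewrite /link; congr (_ @` _); apply/seteqP; split=> z /= [] // Hz h0.
by split=> //; exists (local_rep z) => //; exact/local_rep_traceless.
Qed.

(* If a conjugate of local_rep z lies in Bi, then k corresponds to a unit
   vector b j + c k orthogonal to all the values of local_rep z. *)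
Let R26B_real z : small z -> R26B (conj_class (local_rep z)) ->
  exists c : R[i], `|c| = 1 /\ realC4 (scaleC4 c z).
Proof.
move=> sm [rho [_ [rho' [cc _ rhoB]]] E].
have {cc E} : conj_class (local_rep z) rho' by rewrite -E.
move=> [g Hg E].
have orth (l : 'I_6) : qkm (g * local_rep z l * qconj g) = 0.
  by rewrite -E; have [a _ <-] := rhoB l; rewrite qexp_k !qE /=; ring.
set n := qconj g * qk * g.
have Hn : SU2 n.
  by rewrite /n; apply: SU2M => //; apply: SU2M; [exact: SU2_conj |
     rewrite /SU2 /qnormsq /=; ring].
have nre : qre n = 0 by rewrite /n !qE /=; ring.
have orth' p : qre p = 0 -> qkm (g * p * qconj g) =
    qim p * qim n + qjm p * qjm n + qkm p * qkm n.
  by move=> p0; rewrite /n !qE /= p0; ring.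
have nim : qim n = 0.
  have := orth 0; rewrite /local_rep /= orth' //= => <-; ring.
exists (qjm n -i* qkm n)%C; split.
  apply/normc1 => /=; move: Hn; rewrite /SU2 /qnormsq /= nre nim => <-; ring.
rewrite /realC4 /=; apply/rowP => l; rewrite !mxE.
have l6 : (l.+1 < 6)%N by rewrite ltnS (leq_trans (ltn_ord l)).
have := orth (Ordinal l6); rewrite /local_rep /= ltnS ltn_ord.
rewrite -/(local_gen z l.+1) local_genE orth' //= nim.
have [/eqP|n0] := eqVneq (z.1 0 l ^+ 2 + z.2 0 l ^+ 2) 0.
  rewrite paddr_eq0 ?sqr_ge0 // !sqrf_eq0 => /andP[/eqP -> /eqP ->] _; ring.
have := sc_neq0 sm n0; set s := sc z l => s0 e0.
apply: (mulfI (lt0r_neq0 s0)); rewrite mulr0 -[RHS]e0; ring.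
Qed.

Let BiE (a : R) : qexp (Quat 0 0 0 a) * qi = Quat 0 (cos a) (sin a) 0.
Proof. by rewrite qexp_k qmulE; apply: quat_eqP => /=; ring. Qed.

Let Bki p q : Bk p -> Bi q -> Bi (p * q).
Proof.
move=> [a _ <-] [b _ <-]; exists (a + b) => //; rewrite !BiE !qexp_k !qE /=.
by rewrite cosD sinD; apply: quat_eqP => /=; ring.
Qed.

Let Bii p q : Bi p -> Bi q -> Bk (p * q).
Proof.
move=> [a _ <-] [b _ <-]; exists (a - b + pi) => //.
rewrite !BiE !qexp_k !qE /= cosDpi sinDpi cosB sinB.
by apply: quat_eqP => /=; ring.
Qed.

Let Bkk p q : Bk p -> Bk q -> Bk (p * q).
Proof.
move=> [a _ <-] [b _ <-]; exists (a + b) => //; rewrite !qexp_k !qE /=.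
by rewrite cosD sinD; apply: quat_eqP => /=; ring.
Qed.

Let Bik p q : Bi p -> Bk q -> Bi (p * q).
Proof.
move=> [a _ <-] [b _ <-]; exists (a - b) => //; rewrite !BiE !qexp_k !qE /=.
by rewrite cosB sinB; apply: quat_eqP => /=; ring.
Qed.

Let Bk_conj q : Bk q -> Bk (qconj q).
Proof.
move=> [a _ <-]; exists (- a) => //; rewrite !qexp_k /qconj /= cosN sinN.
by congr Quat; ring.
Qed.

Let Bi_conj q : Bi q -> Bi (qconj q).
Proof.
move=> [a _ <-]; exists (a + pi) => //; rewrite !BiE /qconj /= cosDpi sinDpi.
by congr Quat; ring.
Qed.

Let B_subgroup : subgroup_SU2 (@Bk R `|` @Bi R).
Proof.
split.
- move=> q [[a _ <-]|[a _ <-]]; first exact: SU2_qexp.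
  by apply: SU2M; [exact: SU2_qexp | exact: SU2_qi].
- by left; exists 0 => //; rewrite qexp_k cos0 sin0.
- move=> p q [Hp|Hp] [Hq|Hq].
  + by left; exact: Bkk.
  + by right; exact: Bki.
  + by right; exact: Bik.
  + by left; exact: Bii.
- by move=> q [Hq|Hq]; [left; exact: Bk_conj | right; exact: Bi_conj].
Qed.

Let real_R26B z : realC4 z -> h z = 0 /\ R26B (conj_class (local_rep z)).
Proof.
rewrite /realC4 /= => z2.
set u : R := Num.sqrt 2^-1.
have u2 : u ^+ 2 = 2^-1 by rewrite sqr_sqrtr // invr_ge0.
set g : quat R := Quat u u 0 0.
have Hg : SU2 g by rewrite /SU2 /qnormsq /= u2; field.
have gp p : qre p = 0 -> qjm p = 0 ->
    g * p * qconj g = Quat 0 (qim p) (- qkm p) 0.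
  move=> p0 p2; rewrite !qE /qconj /= p0 p2.
  apply: quat_eqP => /=; try ring.
    by transitivity (2 * u ^+ 2 * qim p); [ring | rewrite u2; field].
  by transitivity (- (2 * u ^+ 2 * qkm p)); [ring | rewrite u2; field].
have gen (l : 'I_6) : (l < 5)%N -> Bi (g * local_gen z l * qconj g).
  move=> /ord5[->|[m ->]].
    exists 0 => //; rewrite BiE gp //= cos0 sin0; apply: quat_eqP => //=; ring.
  exists (z.1 0 m) => //; rewrite BiE local_genE gp //=; last by rewrite z2 mxE mulr0.
  rewrite /sc z2 mxE expr0n /= addr0 sqrtr_sqr opprK; congr Quat.
    by case: (ger0P (z.1 0 m)); rewrite ?cosN.
  have [->|n0] := eqVneq (z.1 0 m) 0; first by rewrite sin0 mulr0.
  by case: (ger0P (z.1 0 m)) => _; [rewrite divfK | rewrite sinN; field].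
have rho'B l : Bi (g * local_rep z l * qconj g).
  rewrite /local_rep; case: ifP => [|_]; first exact: gen.
  rewrite -[g in X in Bi X]qconjK -qconjM -qconjM mulrA; apply: Bi_conj.
  suff /(_ 5%N isT) : forall n, (n <= 5)%N ->
    (if odd n then @Bi R else @Bk R) (g * (\prod_(m < n) local_gen z m) * qconj g).
    by rewrite qconjK.
  elim=> [_|n IH n5].
    by rewrite big_ord0 mulr1 SU2_mulV //; exists 0 => //; rewrite qexp_k cos0 sin0.
  have n6 : (n < 6)%N by exact: leq_trans n5 _.
  have -> : g * (\prod_(m < n.+1) local_gen z m) * qconj g =
      (g * (\prod_(m < n) local_gen z m) * qconj g) *
      (g * local_gen z n * qconj g).
    rewrite big_ord_recr /= !mulrA -(mulrA _ (qconj g) g) SU2_Vmul //.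
    by rewrite mulr1.
  have := IH (ltnW n5); have := gen (Ordinal n6) n5.
  by rewrite /=; case: (odd n) => /= Hn HP; [exact: Bii | exact: Bki].
have tr : traceless_rep (local_rep z).
  split; [exact: local_rep_is_rep | move=> l].
  have [a _] := rho'B l; rewrite BiE => /(congr1 (@qre R)); rewrite !qE /=.
  move=> E; transitivity (2 * u ^+ 2 * qre (local_rep z l)).
    by rewrite u2; field.
  by rewrite [RHS]E; ring.
split; first exact/local_rep_traceless.
exists (local_rep z) => //; split => //.
exists (fun l => g * local_rep z l * qconj g); split=> //.
  by exists g.
move=> q; apply; first exact: B_subgroup.
by move=> l; right.
Qed.

Lemma link_R26BE (eps : R) : 0 < eps < pi -> link (@R26B R) eps =
  @circle_orbit R @` [set z | S7 eps z /\ realC4 z].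
Proof.
move=> eps_pi; apply/seteqP; split=> p [z] /=; last first.
  move=> [Hz zR] <-; have [h0 HB] := real_R26B zR.
  by exists z.
move=> [Hz h0 HB] <-.
have [c [c1 cR]] := R26B_real (S7_small eps_pi Hz) HB.
exists (scaleC4 c z); first by split=> //; exact: S7_scale.
by apply: circle_orbit_eq; exists c.
Qed.

Lemma rho0_in_R26ab : R26ab (@rho0 R).
Proof.
exists (@rho0_rep R) => //; split.
  by rewrite -local_rep0; apply/local_rep_traceless/(proj1 (real_R26B _)).
suff im q : rep_image (@rho0_rep R) q -> qjm q = 0 /\ qkm q = 0.
  move=> p q /im[p2 p3] /im[q2 q3]; rewrite !qE p2 p3 q2 q3.
  by apply: quat_eqP => /=; ring.
move=> /(_ [set q | [/\ SU2 q, qjm q = 0 & qkm q = 0]]) -[||//].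
  split.
  - by move=> p [].
  - by split => //; exact: SU2_1.
  - move=> a b [Ha a2 a3] [Hb b2 b3]; split; first exact: SU2M.
      by rewrite !qE /= a2 a3 b2 b3; ring.
    by rewrite !qE /= a2 a3 b2 b3; ring.
  - by move=> a [Ha a2 a3]; split; rewrite /= ?a2 ?a3 ?oppr0 //; exact: SU2_conj.
move=> l; rewrite /rho0_rep; case: ifP => _; split; rewrite /= ?oppr0 //.
  exact: SU2_qi.
by rewrite /SU2 /qnormsq /=; ring.
Qed.

Let tz z (l : 'I_4) := Num.sqrt (z.1 0 l ^+ 2 + z.2 0 l ^+ 2).

Let tz_itv z l : small z -> tz z l \in `[0, pi].
Proof.
move=> sm; rewrite in_itv /= sqrtr_ge0 /=.
rewrite -(@ler_pXn2r _ 2) ?nnegrE ?pi_ge0 ?sqrtr_ge0 //.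
by rewrite sqr_sqrtr ?addr_ge0 ?sqr_ge0 // ltW.
Qed.

Lemma local_model_inj z w : small z -> small w ->
  conj_class (local_rep z) = conj_class (local_rep w) ->
  circle_orbit z = circle_orbit w.
Proof.
move=> smz smw E; apply/esym.
have : conj_class (local_rep z) (local_rep w) by rewrite E; exact: conj_class_refl.
case=> g Hg {}E.
have [g2 g3] : qjm g = 0 /\ qkm g = 0.
  have := E ord0; rewrite /local_rep /= => /(congr1 (fun q => q * g)).
  rewrite -!mulrA SU2_Vmul // mulr1 !qE /= => -[_ _ e2 e3]; split; lra.
move: Hg E; case: g g2 g3 => p r ? ? /= -> -> Hg E.
have pr : p ^+ 2 + r ^+ 2 = 1 by rewrite -[RHS]Hg /qnormsq /=; ring.
pose c : R[i] := ((p ^+ 2 - r ^+ 2) +i* (2 * p * r))%C.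
have c1 : `|c| = 1.
  by apply/normc1; transitivity ((p ^+ 2 + r ^+ 2) ^+ 2);
    [rewrite /c /=; ring | rewrite pr expr1n].
apply: circle_orbit_eq; exists c => //.
have coord m : w.1 0 m = (scaleC4 c z).1 0 m /\ w.2 0 m = (scaleC4 c z).2 0 m.
  have m6 : (m.+1 < 6)%N by rewrite ltnS (leq_trans (ltn_ord m)).
  have := E (Ordinal m6); rewrite /local_rep [val _]/= ltnS ltn_ord.
  rewrite !local_genE -!/(tz _ m) !qE /qconj /= => -[_ e1 e2 e3].
  have tE : tz w m = tz z m.
    apply: cos_inj; [exact: tz_itv..|].
    by rewrite e1 -[RHS]mul1r -pr; ring.
  have scE : sc w m = sc z m by rewrite /sc -!/(tz _ m) tE.
  have N : w.1 0 m ^+ 2 + w.2 0 m ^+ 2 = z.1 0 m ^+ 2 + z.2 0 m ^+ 2.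
    have := congr1 (fun t => t ^+ 2) tE.
    by rewrite /tz !sqr_sqrtr ?addr_ge0 ?sqr_ge0.
  rewrite /= !mxE.
  have [z0|n0] := eqVneq (z.1 0 m ^+ 2 + z.2 0 m ^+ 2) 0.
    move: (z0); rewrite -N => w0; move/eqP: z0; move/eqP: w0.
    rewrite !paddr_eq0 ?sqr_ge0 // !sqrf_eq0.
    by move=> /andP[/eqP -> /eqP ->] /andP[/eqP -> /eqP ->]; split; ring.
  have /lt0r_neq0 s0 := sc_neq0 smz n0.
  by split; apply: (mulfI s0); rewrite -{1}scE; [apply: oppr_inj; rewrite e3|
     rewrite e2]; rewrite /c /=; ring.
case: w coord {E smw} => wx wy coord; rewrite /scaleC4 /mkC4.
by congr pair; apply/rowP => m; have [] := coord m.
Qed.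

Let to_qi p : SU2 p -> qre p = 0 ->
  exists2 g, SU2 g & g * p * qconj g = qi.
Proof.
move=> Hp p0.
have [im1|im1] := eqVneq (qim p) (-1).
  exists qj; first by rewrite /SU2 /qnormsq /=; ring.
  have [p2 p3] : qjm p = 0 /\ qkm p = 0.
    move: Hp; rewrite /SU2 /qnormsq /= p0 im1 => Hp; split; nra.
  by rewrite !qE /qconj /= p0 im1 p2 p3; apply: quat_eqP => /=; ring.
have a_gt : 0 < 2 + 2 * qim p.
  suff : -1 < qim p by lra.
  rewrite lt_neqAle eq_sym im1 /=.
  by move: Hp; rewrite /SU2 /qnormsq /= p0 => Hp; nra.
set e : R := (Num.sqrt (2 + 2 * qim p))^-1.
have e2 : e ^+ 2 * (2 + 2 * qim p) = 1.
  by rewrite exprVn sqr_sqrtr ?ltW // mulVf // lt0r_neq0.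
clearbody e; move: Hp p0 {im1 a_gt} e2; rewrite /SU2 /qnormsq /=.
case: p => p0 a b c /= Hp p0E e2; move: Hp; rewrite {}p0E => Hp.
have bE : b ^+ 2 = 1 - a ^+ 2 - c ^+ 2 by rewrite -Hp; ring.
exists (Quat 0 (e * (1 + a)) (e * b) (e * c)).
  rewrite /SU2 /qnormsq /= -[RHS]e2 !exprMn bE; ring.
rewrite !qE /qconj /=; apply: quat_eqP => /=.
- by ring.
- transitivity (e ^+ 2 * (a * (1 + a) ^+ 2 + 2 * (1 + a) * c ^+ 2 - a * c ^+ 2
    + (2 + a) * b ^+ 2)); first by ring.
  by rewrite bE -[RHS]e2; ring.
- transitivity (e ^+ 2 * b * (b ^+ 2 + a ^+ 2 + c ^+ 2 - 1)); first by ring.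
  by rewrite bE; ring.
transitivity (e ^+ 2 * c * (b ^+ 2 + a ^+ 2 + c ^+ 2 - 1)); first by ring.
by rewrite bE; ring.
Qed.

(* Together with local_rep_traceless, local_rep0, conj_class_scale and
   local_model_inj, this makes (z_1, ..., z_4) |-> [local_rep z] a bijection from
   (small cap h^-1(0)) / S^1 to the neighbourhood of rho0 in R26 of the classes
   for which no x_l with l <= 5 is sent to the antipode of the image of x_1. *)
Lemma local_model_surj rho : traceless_rep rho ->
  (forall l : 'I_6, (l < 5)%N -> rho l <> - rho ord0) ->
  exists z, [/\ small z, h z = 0 & conj_class rho = conj_class (local_rep z)].
Proof.
move=> [[rhoS rhoP] tr] anti.
have [g Hg gi] := to_qi (rhoS ord0) (tr ord0).
set u := fun l => g * rho l * qconj g.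
have uS l : SU2 (u l) by apply: SU2M; [exact: SU2M | exact: SU2_conj].
have u0 l : qre (u l) = 0.
  by rewrite /u !qE /= tr; ring.
pose ix (m : 'I_4) : 'I_6 := inord m.+1.
have ixE (m : 'I_4) : ix m = m.+1 :> nat.
  by rewrite /ix inordK // !ltnS (leq_trans (ltnW (ltn_ord m))).
have um_gt m : -1 < qim (u (ix m)).
  have N := uS (ix m); rewrite /SU2 /qnormsq /= u0 in N.
  rewrite lt_neqAle; apply/andP; split; last by nra.
  apply/eqP => e; apply: (anti (ix m)); first by rewrite ixE ltnS.
  have [e2 e3] : qjm (u (ix m)) = 0 /\ qkm (u (ix m)) = 0.
    by rewrite -e in N; split; nra.
  have uE : u (ix m) = - qi by rewrite qoppE; apply: quat_eqP; rewrite /= ?u0 -?e ?e2 ?e3 ?oppr0.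
  have back p : qconj g * (g * p * qconj g) * g = p.
    rewrite !mulrA SU2_Vmul // mul1r -mulrA SU2_Vmul // mulr1 //.
  by rewrite -[LHS]back -[X in - X]back gi -/(u _) uE mulrN mulNr.
pose t m := acos (qim (u (ix m))).
have um_le m : qim (u (ix m)) <= 1.
  by have := uS (ix m); rewrite /SU2 /qnormsq /= u0 => N; nra.
have t0 m : 0 <= t m by apply: acos_ge0; rewrite um_le ltW.
have tpi m : t m < pi by apply: acos_ltpi; rewrite um_le um_gt.
have cost m : cos (t m) = qim (u (ix m)).
  by rewrite /t acosK // in_itv /= um_le ltW.
have sint m : sin (t m) ^+ 2 = qjm (u (ix m)) ^+ 2 + qkm (u (ix m)) ^+ 2.
  rewrite sin2cos2 cost; have := uS (ix m); rewrite /SU2 /qnormsq /= u0 => <-; ring.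
pose z : C4 R := mkC4 (\row_m (- (qkm (u (ix m)) * (t m / sin (t m)))))
                      (\row_m (qjm (u (ix m)) * (t m / sin (t m)))).
have zt m : z.1 0 m ^+ 2 + z.2 0 m ^+ 2 = t m ^+ 2.
  rewrite /= !mxE; transitivity (sin (t m) ^+ 2 * (t m / sin (t m)) ^+ 2).
    by rewrite sint; ring.
  have [tm0|tm0] := eqVneq (t m) 0; first by rewrite tm0; ring.
  by rewrite -exprMn mulrC divfK // lt0r_neq0 // sin_gt0_pi // tpi lt_neqAle eq_sym tm0 t0.
have smz : small z.
  by move=> m; rewrite zt ltrXn2r // ?nnegrE ?pi_ge0.
have genE (m : 'I_4) : local_gen z m.+1 = u (ix m).
  rewrite local_genE /sc zt sqrtr_sqr ger0_norm // cost /= !mxE.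
  have [tm0|tm0] := eqVneq (t m) 0.
    have := sint m; rewrite tm0 sin0 expr0n /= => N.
    have [e2 e3] : qjm (u (ix m)) = 0 /\ qkm (u (ix m)) = 0 by split; nra.
    by apply: quat_eqP; rewrite /= ?u0 ?e2 ?e3; ring.
  have s0 : sin (t m) != 0.
    by rewrite lt0r_neq0 // sin_gt0_pi // tpi lt_neqAle eq_sym tm0 t0.
  apply: quat_eqP => /=; first by rewrite u0.
  - by [].
  - by field; rewrite s0 tm0.
  - by field; rewrite s0 tm0.
have genE' (l : 'I_6) : (l < 5)%N -> local_gen z l = u l.
  move=> l5; case: (ord5 l5) => [l0|[m lm]].
    by rewrite l0 /= (_ : l = ord0) ?/u ?gi //; exact/val_inj.
  rewrite lm genE; congr (u _); apply/val_inj; rewrite /= lm; exact: ixE.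
have uP : \prod_(l < 6) u l = 1.
  transitivity (g * (\prod_(l < 6) rho l) * qconj g); last first.
    by rewrite rhoP mulr1 SU2_mulV.
  elim/big_rec2: _ => [|l a b _ ->]; first by rewrite mulr1 SU2_mulV.
  by rewrite /u !mulrA -(mulrA _ (qconj g) g) SU2_Vmul // mulr1.
have lrE l : local_rep z l = u l.
  rewrite /local_rep; case: ifPn => [|l5]; first exact: genE'.
  have -> : l = ord_max.
    by apply/val_inj => /=; have := ltn_ord l; lia.
  have PE : \prod_(m < 5) local_gen z m = \prod_(m < 5) u (widen_ord (leqnSn 5) m).
    by apply: eq_bigr => m _; rewrite -genE' /=.
  rewrite PE; set P := \prod_(m < 5) _; move: uP; rewrite big_ord_recr /= -/P => uP.
  have PS : SU2 P by apply: big_ind => //; [exact: SU2_1 | exact: SU2M].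
  by rewrite -[LHS]mulr1 -uP mulrA SU2_Vmul // mul1r.
exists z; split => //; last first.
  by apply/esym/conj_class_eq; exists g.
by apply/local_rep_traceless; split=> [|l]; [exact: local_rep_is_rep | rewrite lrE].
Qed.

End LocalModel.

(* Main.v *)
(** The function h is an S^1-invariant perturbation, of fourth order, of a
hermitian form Q of signature (2, 2). Write the points of C^4 as z = (u, v) in an
orthonormal basis adapted to the positive and negative eigenspaces of Q. For unit
vectors u and v in C^2 consider the quarter circle
z(t) = eps (cos t u + sin t v), 0 <= t <= pi/2, of the sphere S^7 of radius eps.
When eps is small, h(z(t)) / eps^2 is C^1-close to a cos^2 t - b sin^2 t with a, b
bounded above and below by positive constants, so it vanishes at exactly one t, and
transversally; by the implicit function theorem this t depends smoothly on (u, v).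
Hence h^{-1}(0) meets S^7 in a copy of S^3 x S^3, on which the circle acts
diagonally. The quotient is S^2 x S^3: the invariants of (u, v) are the Hopf image
of u and the point conj(v_1) u + v_2 u' of S^3, where u' = (- conj u_2, conj u_1)
completes u to an element of SU(2).

Complex conjugation changes the sign of h, hence preserves its zero set, and an
orbit which it fixes contains a real point: if conj z = d^2 z with |d| = 1 then d z
is real. *)

Require Import Defs.
From HB Require Import structures.
From mathcomp Require Import all_boot all_order all_algebra.
From mathcomp Require Import all_classical all_reals all_analysis.
From mathcomp Require Import complex ring lra.

Set Implicit Arguments.
Unset Strict Implicit.
Unset Printing Implicit Defensive.
Import Order.TTheory GRing.Theory Num.Theory.
Import numFieldNormedType.Exports.
Local Open Scope classical_set_scope.
Local Open Scope ring_scope.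

(** * Functions of class C^k *)

(** The modulus |z_l| is not smooth at 0, but cos |z_l| and sin |z_l| / |z_l| are power series in
    |z_l|^2. Written with these, h (e z) / e^2 becomes a function of d = e^2 and z that is smooth at
    d = 0, where it is the form Q. One bound on the radius must serve all pairs (u, v) and all t.
    Instead of compactness, explicit O(d) estimates in C^1 are carried through sums and products
    with a single constant. On unit vectors the two definite halves of Q lie between 1/sqrt 2 - 1/2
    and 1/sqrt 2 + 1/2, and all numerical constants come from there. Smoothness on a quotient asks
    for lifts that are smooth on open sets of the ambient space. Hence u and v are first normalized,
    which extends the constructions off S^3 x S^3. The Hopf map has no global section, so two
    sections are used; they differ by a phase, and the construction of z(t) commutes with phases.
    For the real link, a lift has to find the real vector in an orbit smoothly: the entries Re (w_m
    conj w_l) / |w_l| do this wherever w_l is nonzero. *)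

Section Differentiability.
Variables (R : realType) (V W : normedModType R).
Implicit Types (f g : V -> W) (x : V).

Lemma diff_approx f x : differentiable f x -> forall e : R, 0 < e ->
  \forall y \near x, `|f y - f x - 'd f x (y - x)| <= e * `|y - x|.
Proof.
move=> /diff_locally /eqaddoP df e e0; rewrite (near_shift 0) subr0.
apply: filterS (df e e0) => h /=.
by rewrite addrK -[(_ - _ : V -> W) h]/(_ - (_ + _)) opprD addrA.
Qed.

Lemma approx_diff f x (L : {linear V -> W}) : continuous L ->
  (forall e : R, 0 < e ->
    \forall y \near x, `|f y - f x - L (y - x)| <= e * `|y - x|) ->
  is_diff x f L.
Proof.
move=> Lc fL.
have E : f \o shift x = cst (f x) + L +o_ 0 id.
  apply/eqaddoP => e e0; have := fL e e0; rewrite (near_shift 0) subr0.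
  apply: filterS => h /=.
  by rewrite addrK -[(_ - _ : V -> W) h]/(_ - (_ + _)) opprD addrA.
have dL := diff_unique Lc E.
by split; [apply/diff_locallyP; rewrite dL|].
Qed.

Lemma near_eq_differentiable f g x :
  {near x, f =1 g} -> differentiable f x -> differentiable g x.
Proof.
move=> fg df; suff : is_diff x g ('d f x) by case.
apply: approx_diff => [|e e0]; first exact: diff_continuous.
have fgx := nbhs_singleton fg.
by apply: filterS2 fg (diff_approx df e0) => y /= <-; rewrite -fgx.
Qed.

End Differentiability.

Section ClassC.
Variables (R : realType) (V : normedModType R).
Implicit Types (W : normedModType R) (O U : set V) (k : nat).

Lemma class_C_pred W k O (f : V -> W) : class_C k.+1 O f -> class_C k O f.
Proof.
elim: k f => [|k IH] f [df Cf].
  by move=> x Ox; exact/differentiable_continuous/df.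
by split => // v; exact: IH.
Qed.

Lemma class_C_continuous W k O (f : V -> W) x : class_C k O f -> O x ->
  {for x, continuous f}.
Proof. by elim: k f => [|k IH] f /= Cf Ox; [exact: Cf | exact/IH/Ox/class_C_pred]. Qed.

Lemma class_C_sub W k O U (f : V -> W) : U `<=` O -> class_C k O f -> class_C k U f.
Proof.
move=> UO; elim: k f => [|k IH] f /=; first by move=> Cf x /UO; exact: Cf.
by move=> [df Cf]; split=> [x /UO|v]; [exact: df | exact/IH/Cf].
Qed.

Lemma class_C_eq W k O (f g : V -> W) : open O -> (forall x, O x -> f x = g x) ->
  class_C k O f -> class_C k O g.
Proof.
move=> oO; elim: k f g => [|k IH] f g fg /=; have fgn x : O x -> {near x, f =1 g}.
- by move=> Ox; apply: filterS (open_nbhs_nbhs (conj oO Ox)) => y; exact: fg.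
- move=> Cf x Ox; have := Cf x Ox; rewrite /prop_for /continuous_at (fg x Ox).
  by apply: cvg_trans; apply: near_eq_cvg; exact: fgn.
- by move=> Ox; apply: filterS (open_nbhs_nbhs (conj oO Ox)) => y; exact: fg.
move=> [df Cf]; split=> [x Ox|v].
  exact: near_eq_differentiable (fgn x Ox) (df x Ox).
by apply: IH (Cf v) => x Ox; exact/near_eq_derive/fgn.
Qed.

Lemma class_C_cst W k O (c : W) : class_C k O (cst c : V -> W).
Proof.
elim: k c => [|k IH] c /=; first by move=> x _; exact: cst_continuous.
split=> [x _|v]; first exact: differentiable_cst.
by have -> : 'D_v (cst c : V -> W) = cst 0 by apply/funext => x; rewrite derive_cst.
Qed.

Lemma class_C_linear W k O (L : {linear V -> W}) : continuous L ->
  class_C k O L.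
Proof.
case: k => [|k] Lc; first by move=> x _; exact: Lc.
split=> [x _|v]; first exact: linear_differentiable.
have -> : 'D_v L = cst (L v); last exact: class_C_cst.
apply/funext => x; rewrite deriveE; last exact: linear_differentiable.
by rewrite diff_lin.
Qed.

Lemma class_CD W k O (f g : V -> W) : open O -> class_C k O f -> class_C k O g ->
  class_C k O (f \+ g).
Proof.
move=> oO; elim: k f g => [|k IH] f g /=.
  by move=> Cf Cg x Ox; apply: continuousD; [exact: Cf | exact: Cg].
move=> [df Cf] [dg Cg]; split=> [x Ox|v].
  by apply: differentiableD; [exact: df | exact: dg].
apply: class_C_eq (IH _ _ (Cf v) (Cg v)) => // x Ox.
by rewrite deriveD //; apply: diff_derivable; [exact: df | exact: dg].
Qed.

Lemma class_CM k O (f g : V -> R) : open O -> class_C k O f -> class_C k O g ->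
  class_C k O (f \* g).
Proof.
move=> oO; elim: k f g => [|k IH] f g.
  by move=> Cf Cg x Ox; apply: continuousM; [exact: Cf | exact: Cg].
move=> Cf' Cg'; have [[df Cf] [dg Cg]] := (Cf', Cg').
split=> [x Ox|v].
  by apply: differentiableM; [exact: df | exact: dg].
apply: class_C_eq (class_CD oO (IH _ _ (class_C_pred Cf') (Cg v))
  (IH _ _ (class_C_pred Cg') (Cf v))) => // x Ox.
by rewrite deriveM //=; apply: diff_derivable; [exact: df | exact: dg].
Qed.

Lemma class_C_comp k O (U : set R) (phi : R -> R) (f : V -> R) : open O ->
  class_C k U phi -> class_C k O f -> (forall x, O x -> U (f x)) ->
  class_C k O (phi \o f).
Proof.
move=> oO; elim: k phi f => [|k IH] phi f.
  move=> Cp Cf fU x Ox; apply: continuous_comp; first exact: Cf.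
  exact/Cp/fU.
move=> Cp' Cf' fU; have [[dp Cp] [df Cf]] := (Cp', Cf').
have dpf x : O x -> differentiable phi (f x) by move=> Ox; exact/dp/fU.
split=> [x Ox|v].
  by apply: differentiable_comp; [exact: df | exact: dpf].
apply: class_C_eq (class_CM oO (IH _ _ (Cp 1) (class_C_pred Cf') fU) (Cf v)) => //.
move=> x Ox /=; rewrite [RHS]deriveE; last first.
  by apply: differentiable_comp; [exact: df | exact: dpf].
rewrite diff_comp; [|exact: df|exact: dpf].
rewrite deriveE /=; last exact: dpf.
rewrite deriveE; last exact: df.
rewrite -[in RHS](mulr1 ('d f x v)) -[_ * 1]/(_ *: _) linearZ /=.
by rewrite mulrC.
Qed.

(* The chain rule for x |-> (x, f x), which needs no basis of V. *)
Lemma class_C_graph k O (Q : set (V * R)) (G : V * R -> R) (f : V -> R) : open O ->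
  class_C k Q G -> class_C k O f -> (forall x, O x -> Q (x, f x)) ->
  class_C k O (fun x => G (x, f x)).
Proof.
move=> oO; elim: k G => [|k IH] G.
  move=> CG Cf fQ x Ox; apply: (@continuous_comp _ _ _ (fun x => (x, f x)) G).
    by apply: (@cvg_pair _ _ _ (nbhs x) (nbhs x) (nbhs (f x))) => [|];
      [exact: cvg_id | exact: Cf].
  exact/CG/fQ.
move=> CG' Cf' fQ; have [[dG CG] [df Cf]] := (CG', Cf').
have dp x : O x -> differentiable (fun x => (x, f x)) x.
  by move=> Ox; apply: differentiable_pair => //; exact: df.
have dGf x : O x -> differentiable G (x, f x) by move=> Ox; exact/dG/fQ.
have dc x : O x -> differentiable (fun x => G (x, f x)) x.
  move=> Ox; apply: (@differentiable_comp _ _ _ _ (fun x => (x, f x)) G);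
    [exact: dp | exact: dGf].
split=> // v.
apply: class_C_eq (class_CD oO (IH _ (CG (v, 0)) (class_C_pred Cf') fQ)
  (class_CM oO (Cf v) (IH _ (CG (0, 1)) (class_C_pred Cf') fQ))) => //.
move=> x Ox /=; rewrite [RHS]deriveE; last exact: dc.
rewrite (@diff_comp _ _ _ _ (fun x => (x, f x)) G); [|exact: dp|exact: dGf].
rewrite /= diff_pair //; last exact: df.
rewrite !(deriveE _ (dGf x Ox)) (deriveE _ (df x Ox)).
rewrite (_ : ('d id x v, 'd f x v) = (v, 0) + ('d f x v) *: (0, 1)); last first.
  rewrite diff_val /=; congr pair; first by rewrite /= scaler0 addr0.
  by rewrite /= add0r -[LHS]mulr1.
by rewrite linearD linearZ.
Qed.

End ClassC.

(** * Elementary functions and power series of one real variable *)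

Section ClassCOne.
Variable R : realType.
Implicit Types (O : set R) (k : nat).

(** On the line every directional derivative is a constant multiple of ['D_1], so the condition over
    all directions reduces to one function. *)
Lemma class_C_derive1 k O (f f' : R -> R) : open O ->
  (forall x, O x -> is_derive x 1 f (f' x)) -> class_C k O f' ->
  class_C k.+1 O f.
Proof.
move=> oO df Cf.
have fd x : O x -> differentiable f x.
  by move=> /df[d _]; exact/derivable1_diffP.
split=> // v.
apply: class_C_eq (class_CM oO (class_C_cst k O v) Cf) => // x Ox /=.
rewrite deriveE; last exact: fd.
rewrite -[in RHS](mulr1 v) -[v * 1]/(v *: 1) linearZ /= -deriveE; last exact: fd.
by have [_ ->] := df x Ox.
Qed.

Lemma class_C_sin_cos k : class_C k setT (@sin R) /\ class_C k setT (@cos R).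
Proof.
elim: k => [|k [Cs Cc]].
  by split=> x _; [exact: continuous_sin | exact: continuous_cos].
split.
  by apply: (@class_C_derive1 _ _ _ cos) => //; exact: openT.
apply: (@class_C_derive1 _ _ _ (cst (-1) \* sin)); first exact: openT.
  by move=> x _; rewrite /= mulN1r; exact: is_derive_cos.
by apply: class_CM => //; [exact: openT | exact: class_C_cst].
Qed.

Lemma class_C_inv k : class_C k [set x : R | x != 0] GRing.inv.
Proof.
have oO : open [set x : R | x != 0] by exact: open_neq.
elim: k => [|k IH]; first by move=> x x0; exact: inv_continuous.
apply: (@class_C_derive1 _ _ _ (cst (-1) \* (GRing.inv \* GRing.inv))) => //.
  move=> x /= x0; have := @is_deriveV _ id x 1 1 x0 _.
  rewrite /= expr2 invfM mulN1r /GRing.scale /= mulr1.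
  by apply; exact: is_derive_id.
by apply: class_CM => //; [exact: class_C_cst | exact: class_CM].
Qed.

Lemma class_C_sqrt k : class_C k [set x : R | 0 < x] Num.sqrt.
Proof.
have oO : open [set x : R | 0 < x] by exact: open_gt.
elim: k => [|k IH]; first by move=> x x0; exact: sqrt_continuous.
apply: (@class_C_derive1 _ _ _
  (GRing.inv \o (cst 2 \* Num.sqrt))) => //.
apply: (class_C_comp (U := [set x : R | x != 0])) => //; first exact: class_C_inv.
  by apply: class_CM => //; exact: class_C_cst.
by move=> x /= x0; rewrite mulf_neq0 // gt_eqF // sqrtr_gt0.
Qed.

(* This class of power series is stable under termwise differentiation. *)
Definition small_coef (a : nat -> R) := forall n, `|a n| <= n`!%:R^-1.

Lemma small_coef_diffs a : small_coef a -> small_coef (pseries_diffs a).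
Proof.
move=> sa n; rewrite /pseries_diffs normrM ger0_norm // mulrC.
apply: (le_trans (ler_wpM2r _ (sa n.+1))) => //.
by rewrite factS natrM invfM mulrC mulrA divff ?mul1r // pnatr_eq0.
Qed.

Lemma is_cvg_small_coef a (x : R) : small_coef a -> cvgn (pseries a x).
Proof.
move=> sa; apply: normed_cvg.
apply: (series_le_cvg (v_ := exp_coeff `|x|)).
- by move=> n; exact: normr_ge0.
- by move=> n; rewrite /exp_coeff divr_ge0 // exprn_ge0.
- move=> n /=; rewrite normrM normrX /exp_coeff /= mulrC ler_wpM2l ?exprn_ge0 //.
- exact: is_cvg_series_exp_coeff.
Qed.

Lemma is_derive_pseries a (x : R) : small_coef a ->
  is_derive x 1 (fun y => limn (pseries a y)) (limn (pseries (pseries_diffs a) x)).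
Proof.
(* Termwise differentiation asks for convergence, at some radius beyond |x|, of the series and of
   its first two formal derivatives. *)
move=> sa; apply: (@pseries_snd_diffs _ _ (`|x| + 1)).
- exact: is_cvg_small_coef.
- exact/is_cvg_small_coef/small_coef_diffs.
- exact/is_cvg_small_coef/small_coef_diffs/small_coef_diffs.
by rewrite [ltRHS]ger0_norm ?addr_ge0 // ltrDl.
Qed.

Lemma class_C_pseries k a : small_coef a ->
  class_C k setT (fun x => limn (pseries a x)).
Proof.
elim: k a => [|k IH] a sa.
  move=> x _; have [d _] := is_derive_pseries x sa.
  exact/differentiable_continuous/derivable1_diffP.
apply: (class_C_derive1 (f' := fun x => limn (pseries (pseries_diffs a) x))).
- exact: openT.
- by move=> x _; exact: is_derive_pseries.
- exact/IH/small_coef_diffs.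
Qed.

(** For s >= 0 these are cos (sqrt s) and sin (sqrt s) / sqrt s. As power series in s they are
    smooth at 0, where the square root is not. *)
Definition cos_root (s : R) := limn (pseries (fun n => (-1) ^+ n / (n.*2)`!%:R) s).
Definition sinc_root (s : R) := limn (pseries (fun n => (-1) ^+ n / (n.*2.+1)`!%:R) s).

Lemma small_coef_fact (d : nat -> nat) : (forall n, (n <= d n)%N) ->
  small_coef (fun n => (-1) ^+ n / (d n)`!%:R).
Proof.
move=> nd n; rewrite normrM normrX normrN1 expr1n mul1r normfV ger0_norm //.
by rewrite lef_pV2 ?posrE ?ltr0n ?fact_gt0 // ler_nat leq_fact.
Qed.

Lemma smooth_cos_root : smooth_on setT cos_root.
Proof.
move=> k; apply/class_C_pseries/small_coef_fact => n; rewrite -addnn; exact: leq_addr.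
Qed.

Lemma smooth_sinc_root : smooth_on setT sinc_root.
Proof.
move=> k; apply/class_C_pseries/small_coef_fact => n; rewrite -addnn -addnS; exact: leq_addr.
Qed.

Lemma cos_rootE (t : R) : cos_root (t ^+ 2) = cos t.
Proof.
rewrite -(cvg_lim _ (@cvg_cos_coeff' R t)) //; congr (limn (series _)); apply/funext => n.
by rewrite /cos_coeff' /= -exprM mul2n -exprnP; ring.
Qed.

Lemma sinc_rootE (t : R) : sinc_root (t ^+ 2) * t = sin t.
Proof.
rewrite -(cvg_lim _ (@cvg_sin_coeff' R t)) // mulrC -[LHS]/(t *: _).
rewrite -lim_seriesZ; last first.
  by apply/is_cvg_small_coef/small_coef_fact => n; rewrite -addnn -addnS; exact: leq_addr.
congr (limn (series _)); apply/funext => n.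
rewrite /sin_coeff' fctE /GRing.scale /= -exprM mul2n exprS -exprnP; ring.
Qed.

Lemma pseries0 (a : nat -> R) : limn (pseries a 0) = a 0%N.
Proof.
apply: cvg_lim => //; apply: (@cvg_trans _ (cst (a 0%N) @ \oo)); last exact: cvg_cst.
apply: near_eq_cvg; exists 1%N => // -[//|n] _.
rewrite /pseries /series /= big_nat_recl // big1 ?expr0 ?mulr1 ?addr0 // => i _.
by rewrite expr0n mulr0.
Qed.

Lemma cos_root0 : cos_root 0 = 1.
Proof. by rewrite /cos_root pseries0 /= expr0 fact0 divr1. Qed.

Lemma sinc_root0 : sinc_root 0 = 1.
Proof. by rewrite /sinc_root pseries0 /= expr0 divr1. Qed.

End ClassCOne.

(** * An implicit function theorem *)

Section ImplicitFunction.
Variables (R : realType) (V : normedModType R) (O : set V) (G : V * R -> R).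
Variables (a b : R) (f : V -> R).
Hypotheses (oO : open O) (GC : smooth_on (O `*` setT) G).
Hypothesis fab : forall x, O x -> a < f x < b.
Hypothesis G0 : forall x, O x -> G (x, f x) = 0.
Hypothesis Gpos : forall x t, O x -> a < t < f x -> 0 < G (x, t).
Hypothesis Gneg : forall x t, O x -> f x < t < b -> G (x, t) < 0.
Hypothesis dG0 : forall x, O x -> 'D_(0, 1) G (x, f x) != 0.

Let G_cont x t : O x -> {for (x, t), continuous G}.
Proof. by move=> Ox; apply: class_C_continuous (GC 0) _. Qed.

Let G_slice_cont x t : O x -> {for x, continuous (fun y => G (y, t))}.
Proof.
move=> Ox; apply: (@continuous_comp _ _ _ (fun y => (y, t)) G).
  by apply: (@cvg_pair _ _ _ (nbhs x) (nbhs x) (nbhs t)); [exact: cvg_id|exact: cvg_cst].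
exact: G_cont.
Qed.

(** The signs of G at the heights f x - d and f x + d persist for y near x, and the sign hypotheses
    over y then trap f y between these heights. *)
Lemma implicit_continuous x : O x -> {for x, continuous f}.
Proof.
move=> Ox; apply/cvgrPdist_lt => e e0.
have /andP[ax xb] := fab Ox.
(* The last two bounds keep f x - d and f x + d inside ]a, b[, where the signs of G are known. *)
pose d := Num.min (e / 2) (Num.min ((f x - a) / 2) ((b - f x) / 2)).
have d0 : 0 < d by rewrite !lt_min; apply/and3P; split; lra.
have [de da db] : [/\ d <= e / 2, d <= (f x - a) / 2 & d <= (b - f x) / 2].
  by split; rewrite !ge_min lexx ?orbT.
have p1 : 0 < G (x, f x - d) by apply: Gpos => //; lra.
have p2 : G (x, f x + d) < 0 by apply: Gneg => //; lra.
have n1 : \forall y \near x, 0 < G (y, f x - d).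
  exact: cvgr_gt (G_slice_cont (t := f x - d) Ox) _ p1.
have n2 : \forall y \near x, G (y, f x + d) < 0.
  exact: cvgr_lt (G_slice_cont (t := f x + d) Ox) _ p2.
have nO := open_nbhs_nbhs (conj oO Ox).
near=> y.
have Oy : O y by near: y.
have q1 : 0 < G (y, f x - d) by near: y.
have q2 : G (y, f x + d) < 0 by near: y.
have /andP[ay yb] := fab Oy.
have l1 : f x - d < f y.
  rewrite ltNge le_eqVlt; apply/negP => /orP[/eqP E|l]; first by move: q1; rewrite -E G0 ?ltxx.
  have : G (y, f x - d) < 0 by apply: Gneg => //; lra.
  lra.
have l2 : f y < f x + d.
  rewrite ltNge le_eqVlt; apply/negP => /orP[/eqP E|l]; first by move: q2; rewrite E G0 ?ltxx.
  have : 0 < G (y, f x + d) by apply: Gpos => //; lra.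
  lra.
rewrite ltr_norml; lra.
Unshelve. all: by end_near. Qed.

Let dG x : O x -> differentiable G (x, f x).
Proof. by move=> Ox; have [dG _] := GC 1; apply: dG. Qed.

(** Let h = y - x and t = f y - f x. Since G vanishes on the graph of f, D (h, 0) + t beta is o(|h|
    + |t|). This first gives |t| = O(|h|), and then an error o(|h|) in the linear approximation of
    f. *)
Lemma implicit_diff x : O x -> differentiable f x /\ forall v,
  'D_v f x = - ('D_(0, 1) G (x, f x))^-1 * 'D_(v, 0) G (x, f x).
Proof.
move=> Ox; pose D := 'd G (x, f x); pose beta := D (0, 1).
have b0 : beta != 0 by rewrite /beta /D -deriveE ?dG0 //; exact: dG.
have Dc : continuous D by exact/diff_continuous/dG.
have [M M0 DM] := linear_lipschitz Dc.
pose L v := - beta^-1 * D (v, 0).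
have L_lin : linear L.
  move=> c u v; rewrite /L (_ : (c *: u + v, 0) = c *: (u, 0) + (v, 0)).
    by rewrite linearP /= mulrDr /GRing.scale /=; ring.
  by congr pair; rewrite /= scaler0 addr0.
pose LL : {linear V -> R} := HB.pack L (GRing.isLinear.Build _ _ _ _ L L_lin).
have Lc : continuous L.
  move=> v; apply: (cvgM (f := cst (- beta^-1)) (g := fun v => D (v, 0))); first exact: cvg_cst.
  apply: (@continuous_comp _ _ _ (fun v : V => (v, 0)) D); last exact: Dc.
  by apply: (@cvg_pair _ _ _ (nbhs v) (nbhs v) (nbhs 0)); [exact: cvg_id|exact: cvg_cst].
have : is_diff x f L.
  apply: (@approx_diff _ _ _ f x LL) => // e e0.
  have nb0 : 0 < `|beta| by rewrite normr_gt0.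
  pose K := 1 + 2 * (M + 1) / `|beta|.
  have K0 : 0 < K.
    by rewrite /K ltr_wpDr // divr_ge0 // mulr_ge0 // addr_ge0 // ltW.
  (* The bound |beta| / 2 absorbs eta |t| into |t beta|, so that |t| |beta| <= 2 (M + 1) |h| and |h|
     + |t| <= K |h|; the bound e |beta| / K then makes the final error at most e |h|. *)
  pose eta := Num.min 1 (Num.min (`|beta| / 2) (e * `|beta| / K)).
  have eta0 : 0 < eta.
    rewrite !lt_min; apply/and3P; split; [lra|lra|].
    by rewrite divr_gt0 // mulr_gt0.
  have [eta1 eta2 eta3] : [/\ eta <= 1, eta <= `|beta| / 2 & eta * K <= e * `|beta|].
    by split; rewrite -?ler_pdivlMr // !ge_min lexx ?orbT.
  have gr : {for x, continuous (fun y => (y, f y))}.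
    apply: (@cvg_pair _ _ _ (nbhs x) (nbhs x) (nbhs (f x))); first exact: cvg_id.
    exact: implicit_continuous.
  have := gr _ (diff_approx (dG Ox) eta0).
  rewrite !near_simpl /= => H; near=> y.
  have Oy : O y by near: y; apply: open_nbhs_nbhs.
  have : `|G (y, f y) - G (x, f x) - D ((y, f y) - (x, f x))| <=
      eta * `|(y, f y) - (x, f x)| by near: y.
  rewrite !G0 // subr0 sub0r normrN.
  set h := y - x; set t := f y - f x.
  rewrite (_ : (y, f y) - (x, f x) = (h, 0) + t *: (0, 1)); last first.
    by rewrite /h /t; congr pair; rewrite /= ?scaler0 ?addr0 // add0r -[LHS]mulr1.
  rewrite linearD linearZ /= -/beta -[t *: beta]/(t * beta).
  have -> : (h, 0) + t *: (0, 1) = (h, t) :> V * R.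
    by congr pair; rewrite /= ?scaler0 ?addr0 // add0r -[RHS]mulr1.
  have nle : `|(h, t)| <= `|h| + `|t|.
    by rewrite /Num.norm /= ge_max lerDl lerDr !normr_ge0.
  move=> /le_trans /(_ (ler_wpM2l (ltW eta0) nle)) Hle.
  have DMh : `|D (h, 0)| <= M * `|h|.
    apply: le_trans (DM _) _; rewrite ler_wpM2l ?(ltW M0) //.
    by rewrite prod_normE /= normr0 max_l.
  have tle : `|t| * `|beta| <= 2 * (M + 1) * `|h|.
    have : `|t * beta| <= `|D (h, 0) + t * beta| + `|D (h, 0)|.
      by rewrite -[t * beta in leLHS](addKr (D (h, 0))) addrC (le_trans (ler_normB _ _)).
    have : eta * `|t| <= `|beta| / 2 * `|t| by rewrite ler_wpM2r.
    have : eta * `|h| <= 1 * `|h| by rewrite ler_wpM2r.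
    rewrite normrM => *; nra.
  have -> : f y - f x - LL (y - x) = beta^-1 * (D (h, 0) + t * beta).
    by rewrite -/h -/t /= /L; field.
  rewrite normrM normfV mulrC ler_pdivrMr //.
  apply: le_trans Hle _; rewrite mulrAC; apply: le_trans (ler_wpM2r (normr_ge0 h) eta3).
  rewrite -mulrA ler_wpM2l ?(ltW eta0) // /K mulrDl mul1r lerD2l.
  by rewrite mulrAC ler_pdivlMr.
case=> df dfE; split=> // v.
by rewrite (deriveE _ df) dfE /L !(deriveE _ (dG Ox)).
Unshelve. all: by end_near. Qed.

(** Bootstrap: the formula for ['D_v f] involves only derivatives of G along the graph of f. These
    are of class C^k when f is, so f is of class C^(k+1). *)
Lemma implicit_smooth : smooth_on O f.
Proof.
elim=> [|k IH]; first by move=> x; exact: implicit_continuous.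
split=> [x Ox|v]; first by have [] := implicit_diff Ox.
apply: (class_C_eq (f := cst (-1) \* (GRing.inv \o (fun x => 'D_(0, 1) G (x, f x)))
    \* (fun x => 'D_(v, 0) G (x, f x)))) => //.
  by move=> x Ox /=; rewrite (implicit_diff Ox).2 mulN1r.
have [_ CG] := GC k.+1.
have CDG w : class_C k O (fun x => 'D_w G (x, f x)).
  by apply: class_C_graph (CG w) IH _ => // x Ox; split.
do 2?[apply: class_CM => //]; first exact: class_C_cst.
exact: class_C_comp (@class_C_inv R k) _ _.
Qed.

End ImplicitFunction.

(** * Maps of class C^k between products and spaces of row vectors *)

Section VectorValued.
Variable R : realType.

Lemma class_C_precomp (V W Z : normedModType R) k (O : set W) (L : {linear V -> W})
    (f : W -> Z) : continuous L -> open O -> class_C k O f ->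
  class_C k (L @^-1` O) (f \o L).
Proof.
move=> Lc oO; have oL : open (L @^-1` O) by apply: open_comp => // x _; exact: Lc.
elim: k f => [|k IH] f.
  by move=> Cf x Ox; apply: continuous_comp; [exact: Lc | exact: Cf].
move=> [df Cf]; have dL x : differentiable L x by exact: linear_differentiable.
split=> [x Ox|v]; first by apply: differentiable_comp => //; exact: df.
apply: class_C_eq (IH _ (Cf (L v))) => // x Ox /=.
rewrite deriveE; last exact: df.
rewrite [RHS]deriveE; last by apply: differentiable_comp => //; exact: df.
rewrite [in RHS]diff_comp //=; last exact: df.
by rewrite (diff_lin _ Lc).
Qed.

Lemma class_C_fst (V W Z : normedModType R) k (f : V -> Z) (O : set V) : open O ->
  class_C k O f -> class_C k (O `*` [set: W]) (f \o fst).
Proof.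
move=> oO Cf.
rewrite (_ : O `*` setT = fst @^-1` O).
  apply: (@class_C_precomp (V * W)%type _ _ _ _ fst) => //.
  by move=> p; exact: cvg_fst.
by apply/seteqP; split=> [p []|p].
Qed.

Lemma class_C_snd (V W Z : normedModType R) k (f : W -> Z) :
  class_C k setT f -> class_C k [set: V * W] (f \o snd).
Proof.
move=> Cf; rewrite -(preimage_setT (@snd V W)).
apply: (@class_C_precomp (V * W)%type _ _ _ _ snd) => //; last exact: openT.
by move=> p; exact: cvg_snd.
Qed.

Lemma class_C_pair (V W Z : normedModType R) k (O : set V) (f : V -> W) (g : V -> Z) :
  open O -> class_C k O f -> class_C k O g -> class_C k O (fun x => (f x, g x)).
Proof.
move=> oO; elim: k f g => [|k IH] f g.
  move=> Cf Cg x Ox.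
  by apply: (@cvg_pair _ _ _ (nbhs x) (nbhs (f x)) (nbhs (g x))); [exact: Cf|exact: Cg].
move=> [df Cf] [dg Cg].
have dp x : O x -> differentiable (fun x => (f x, g x)) x.
  by move=> Ox; apply: differentiable_pair; [exact: df | exact: dg].
split=> // v; apply: class_C_eq (IH _ _ (Cf v) (Cg v)) => // x Ox.
rewrite [RHS]deriveE; last exact: dp.
by have dfx := df x Ox; have dgx := dg x Ox; rewrite diff_pair ?deriveE.
Qed.

Lemma class_C_postcomp (V W Z : normedModType R) k (O : set V) (L : {linear W -> Z})
    (f : V -> W) : continuous L -> open O -> class_C k O f -> class_C k O (L \o f).
Proof.
move=> Lc oO; elim: k f => [|k IH] f.
  by move=> Cf x Ox; apply: continuous_comp; [exact: Cf | exact: Lc].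
move=> [df Cf]; have dL x : differentiable L x by exact: linear_differentiable.
split=> [x Ox|v]; first by apply: differentiable_comp => //; exact: df.
apply: class_C_eq (IH _ (Cf v)) => // x Ox /=.
rewrite [in LHS]deriveE; last exact: df.
rewrite [RHS]deriveE; last by apply: differentiable_comp => //; exact: df.
rewrite [in RHS]diff_comp //=; last exact: df.
by rewrite diff_lin.
Qed.

(** A map into row vectors is a finite sum of scalar functions times constant basis vectors. *)
Lemma class_C_rV (V : normedModType R) n k (O : set V) (f : V -> 'rV[R]_n) :
  open O -> (forall i, class_C k O (fun x => f x 0 i)) -> class_C k O f.
Proof.
move=> oO Cf.
have -> : f = fun x => \sum_(i <- index_enum 'I_n) f x 0 i *: delta_mx 0 i.
  apply/funext => x; apply/rowP => j; rewrite summxE (bigD1 j) //= !mxE !eqxx mulr1.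
  by rewrite big1 ?addr0 // => i ij; rewrite !mxE eqxx eq_sym (negbTE ij) mulr0.
elim: (index_enum _) => [|i s IH].
  have -> : (fun x => \sum_(i <- [::]) f x 0 i *: delta_mx 0 i) = cst (0 : 'rV[R]_n).
    by apply/funext => x; rewrite big_nil.
  exact: class_C_cst.
have -> : (fun x => \sum_(j <- i :: s) f x 0 j *: delta_mx 0 j) =
    ( *:%R^~ (delta_mx 0 i)) \o (fun x => f x 0 i) \+
    (fun x => \sum_(j <- s) f x 0 j *: (delta_mx 0 j : 'rV[R]_n)).
  by apply/funext => x; rewrite big_cons.
apply: class_CD => //.
have sx_lin : linear ( *:%R^~ (delta_mx 0 i : 'rV[R]_n)).
  by move=> c u v; rewrite scalerDl scalerA.
pose L : {linear R -> 'rV[R]_n} := HB.pack ( *:%R^~ (delta_mx 0 i : 'rV[R]_n))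
  (GRing.isLinear.Build _ _ _ _ _ sx_lin).
apply: (@class_C_postcomp _ _ _ k O L) => //.
exact: scalel_continuous.
Qed.

Lemma class_C_coord n k (O : set 'rV[R]_n) i : class_C k O (fun x => x 0 i).
Proof.
have lin : linear (fun x : 'rV[R]_n => x 0 i : R) by move=> c u v; rewrite !mxE.
pose L : {linear 'rV[R]_n -> R} := HB.pack (fun x : 'rV[R]_n => x 0 i : R)
  (GRing.isLinear.Build _ _ _ _ _ lin).
by apply: (@class_C_linear _ _ _ k O L); exact: coord_continuous.
Qed.

Lemma class_C_fst_coord n m k (O : set ('rV[R]_n * 'rV[R]_m)) i :
  class_C k O (fun x => x.1 0 i).
Proof.
apply: (class_C_sub (O := setT)) => //; rewrite -setXTT.
apply: (@class_C_fst _ _ _ _ (fun x : 'rV[R]_n => x 0 i));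
  [exact: openT | exact: class_C_coord].
Qed.

Lemma class_C_snd_coord n m k (O : set ('rV[R]_n * 'rV[R]_m)) i :
  class_C k O (fun x => x.2 0 i).
Proof.
apply: (class_C_sub (O := setT)) => //.
by apply: (@class_C_snd _ _ _ _ (fun x : 'rV[R]_m => x 0 i)); exact: class_C_coord.
Qed.

End VectorValued.

(** * Uniform C^1 estimates *)

Section UniformBounds.
Variables (R : realType) (I : Type) (D : set I) (d : I -> R).
Hypothesis d01 : forall i, D i -> 0 <= d i <= 1.
Implicit Types (w : I -> R) (f g : I -> R -> R).

(** An estimate f = O(w) in C^1 with respect to t, with one constant for all parameters i. Weight 1
    expresses boundedness and weight d smallness; weights multiply under products of functions. *)
Definition C1_bigO w f := exists2 K : R, 0 <= K & forall i, D i -> forall t : R,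
  exists2 f' : R, is_derive t 1 (f i) f' & `|f i t| <= K * w i /\ `|f'| <= K * w i.

Definition C1_bounded := C1_bigO (fun=> 1).
Definition C1_small := C1_bigO d.

Lemma C1_bigO_ext w f g : (forall i t, f i t = g i t) -> C1_bigO w f -> C1_bigO w g.
Proof.
by move=> fg; have -> : g = f by apply/funext => i; apply/funext => t; rewrite fg.
Qed.

Lemma C1_bigOD w f g : C1_bigO w f -> C1_bigO w g ->
  C1_bigO w (fun i t => f i t + g i t).
Proof.
move=> [K K0 fK] [L L0 gL]; exists (K + L); first exact: addr_ge0.
move=> i Di t; have [f' df [fb f'b]] := fK i Di t.
have [g' dg [gb g'b]] := gL i Di t.
exists (f' + g'); first exact: is_deriveD.
by split; rewrite mulrDl (le_trans (ler_normD _ _)) // lerD.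
Qed.

Lemma C1_bigOM v w f g : C1_bigO v f -> C1_bigO w g ->
  C1_bigO (v \* w) (fun i t => f i t * g i t).
Proof.
(* The factor 2 pays for the two terms of the product rule. *)
move=> [K K0 fK] [L L0 gL]; exists (2 * (K * L)); first by rewrite !mulr_ge0.
move=> i Di t; have [f' df [fb f'b]] := fK i Di t.
have [g' dg [gb g'b]] := gL i Di t.
have mul_le (a b a' b' : R) : `|a| <= a' -> `|b| <= b' -> `|a * b| <= a' * b'.
  by move=> ? ?; rewrite normrM ler_pM.
have fg := mul_le _ _ _ _ fb gb; have := mul_le _ _ _ _ fb g'b.
have := mul_le _ _ _ _ gb f'b => gf' fg'.
exists (f i t * g' + g i t * f').
  by apply: is_derive_eq.
have E : K * v i * (L * w i) = K * L * (v i * w i) by ring.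
have E' : L * w i * (K * v i) = K * L * (v i * w i) by ring.
have := le_trans (normr_ge0 _) fg.
rewrite E /= in fg fg' *; rewrite E' in gf' => p.
split; first by rewrite -mulrA; lra.
apply: (le_trans (ler_normD _ _)); rewrite -mulrA; lra.
Qed.

Lemma C1_bigO_weight v w f : (forall i, D i -> v i <= w i) -> C1_bigO v f ->
  C1_bigO w f.
Proof.
move=> vw [K K0 fK]; exists K => // i Di t; have [f' df [fb f'b]] := fK i Di t.
by exists f' => //; split; apply: (le_trans _ (ler_wpM2l K0 (vw _ Di))).
Qed.

Lemma C1_bounded_cst (c : I -> R) (K : R) : (forall i, D i -> `|c i| <= K) ->
  C1_bounded (fun i => cst (c i)).
Proof.
move=> cK; exists (Num.max 0 K) => [|i Di t]; first by rewrite le_max lexx.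
exists 0; first exact: is_derive_cst.
by rewrite normr0 mulr1 !le_max lexx cK ?orbT.
Qed.

Lemma C1_small_bounded f : C1_small f -> C1_bounded f.
Proof. by apply: C1_bigO_weight => i /d01/andP[]. Qed.

Lemma C1_boundedM f g : C1_bounded f -> C1_bounded g ->
  C1_bounded (fun i t => f i t * g i t).
Proof.
by move=> fb gb; apply: C1_bigO_weight (C1_bigOM fb gb) => i _ /=; rewrite mulr1.
Qed.

Lemma C1_smallM f g : C1_small f -> C1_bounded g -> C1_small (fun i t => f i t * g i t).
Proof.
by move=> fb gb; apply: C1_bigO_weight (C1_bigOM fb gb) => i _ /=; rewrite mulr1.
Qed.

Lemma C1_small_d : C1_small (fun i => cst (d i)).
Proof.
exists 1 => // i Di t; have /andP[d0 _] := d01 Di.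
exists 0; first exact: is_derive_cst.
by rewrite normr0 mul1r ger0_norm.
Qed.

(** f g - 1 = (f - 1) (g - 1) + (f - 1) + (g - 1), and a product of two small functions is small
    because d <= 1. *)
Lemma C1_small1M f g : C1_small (fun i t => f i t - 1) -> C1_small (fun i t => g i t - 1) ->
  C1_small (fun i t => f i t * g i t - 1).
Proof.
move=> fs gs.
apply: C1_bigO_ext (C1_bigOD (C1_smallM fs (C1_small_bounded gs)) (C1_bigOD fs gs)).
by move=> i t; ring.
Qed.

Lemma C1_bounded_small1 f : C1_small (fun i t => f i t - 1) -> C1_bounded f.
Proof.
move=> /C1_small_bounded fs.
have /(C1_bigOD fs) : C1_bounded (fun i => cst 1).
  by apply: (@C1_bounded_cst _ 1) => i _; rewrite normr1.
by apply: C1_bigO_ext => i t /=; rewrite subrK.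
Qed.

(** By the mean value theorem |phi x - 1| <= M |x| on [-K, K], where M is the maximum of |phi'|. At
    x = d f this is O(d), and the derivative phi' (d f) d f' has an explicit factor d. *)
Lemma C1_small1_comp (phi : R -> R) f : smooth_on setT phi -> phi 0 = 1 ->
  C1_bounded f -> C1_small (fun i t => phi (d i * f i t) - 1).
Proof.
move=> Cphi phi0 [K K0 fK].
have dphi (x : R) : is_derive x 1 phi ('D_1 phi x).
  by apply/derivableP/diff_derivable; have [dp _] := Cphi 1; apply: dp.
have phi'_cont : continuous ('D_1 phi).
  by move=> x; have [_ dp] := Cphi 1; apply: dp.
have [M M0 phiM] : exists2 M : R, 0 <= M & forall x, `|x| <= K -> `|'D_1 phi x| <= M.
  have KK : - K <= K by lra.
  have cn : {within `[- K, K], continuous (fun x => `|'D_1 phi x|)}.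
    apply: continuous_subspaceT => x.
    apply: (@continuous_comp _ _ _ ('D_1 phi) Num.norm);
      [exact: phi'_cont | exact: norm_continuous].
  have [c _ cmax] := EVT_max KK cn.
  exists (`|'D_1 phi c|) => // x; rewrite ler_norml => xK.
  by apply: cmax; rewrite in_itv.
have phi1 x : `|x| <= K -> `|phi x - 1| <= M * `|x|.
  (* The mean value theorem is applied on [0, x]; a negative x is reduced to this case by the
     reflection psi y = phi (- y). *)
  rewrite -phi0; wlog : phi dphi phi'_cont phiM {Cphi phi0} x / 0 <= x.
    move=> H; have [x0|x0] := leP 0 x; first exact: H.
    move=> xK; pose psi y := phi (- y).
    have dpsi (y : R) : is_derive y 1 psi (- 'D_1 phi (- y)).
      have := is_derive1_comp (dphi (- y)) (is_deriveNid y 1).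
      by rewrite mulrN1.
    have D1psi y : 'D_1 psi y = - 'D_1 phi (- y) by have [_ ->] := dpsi y.
    have h1 (y : R) : is_derive y 1 psi ('D_1 psi y) by rewrite D1psi; exact: dpsi.
    have h2 : continuous ('D_1 psi).
      rewrite (funext D1psi) => y.
      apply: (@continuous_comp _ _ _ (fun y => 'D_1 phi (- y)) -%R); last exact: opp_continuous.
      apply: (@continuous_comp _ _ _ -%R ('D_1 phi)); last exact: phi'_cont.
      exact: opp_continuous.
    have h3 y : `|y| <= K -> `|'D_1 psi y| <= M.
      by move=> yK; rewrite D1psi normrN phiM // normrN.
    have := H psi h1 h2 h3 (- x); rewrite /psi opprK oppr0 normrN; apply => //; lra.
  rewrite le_eqVlt => /predU1P[<-|x0] xK; first by rewrite subrr normr0 mulr0.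
  have [|c /[!in_itv]/= /andP[c0 cx] ->] := MVT x0 (fun y _ => dphi y).
    apply: continuous_subspaceT => y; apply: differentiable_continuous.
    by apply/derivable1_diffP; have [] := dphi y.
  rewrite normrM subr0 ler_wpM2r // phiM //.
  by rewrite ger0_norm ?(ltW c0) //; move: xK; rewrite ger0_norm ?(ltW x0) //; lra.
exists (M * K) => [|i Di t]; first exact: mulr_ge0.
have [f' df [fb f'b]] := fK i Di t; rewrite mulr1 in fb f'b.
have /andP[d0 d1] := d01 Di.
have dfK : `|d i * f i t| <= d i * K by rewrite normrM ger0_norm // ler_wpM2l.
have dfK' : `|d i * f i t| <= K by rewrite (le_trans dfK) // ler_piMl.
exists ('D_1 phi (d i * f i t) * (d i * f')).
  have dN : is_derive t 1 (fun t => d i * f i t) (d i * f') by exact: is_deriveZ.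
  have dc := @is_derive1_comp _ phi (fun t => d i * f i t) _ _ _ (dphi (d i * f i t)) dN.
  have := is_deriveB dc (is_derive_cst (1 : R) t 1).
  by rewrite subr0.
split; first by rewrite (le_trans (phi1 _ dfK')) // -mulrA ler_wpM2l // [K * _]mulrC.
by rewrite normrM -mulrA ler_pM // ?phiM // normrM ger0_norm // [K * _]mulrC ler_wpM2l.
Qed.

End UniformBounds.

(** * The zero of a perturbed form on a quarter circle *)

Section TransversalZero.
Variable R : realType.

(** The constants leave room for the perturbation. Where sin^2 t <= 1/10, g is at least 9/50 - 1/8 -
    1/50 > 0, and symmetrically where sin^2 t >= 9/10. In between cos t sin t >= 3/10, so the
    derivative is at most - 2 (3/10) (2/5) + 1/50 < 0. *)
Lemma unique_transversal_zero (a b eta : R) (r r' : R -> R)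
    (g := fun t => cos t ^+ 2 * a - sin t ^+ 2 * b + r t) :
  1 / 5 <= a <= 5 / 4 -> 1 / 5 <= b <= 5 / 4 -> eta <= 1 / 50 ->
  (forall t : R, [/\ is_derive t 1 r (r' t), `|r t| <= eta & `|r' t| <= eta]) ->
  exists t0, [/\ 0 < t0 < pi / 2, g t0 = 0,
    forall t, 0 <= t < t0 -> 0 < g t,
    forall t, t0 < t <= pi / 2 -> g t < 0 & 'D_1 g t0 < 0].
Proof.
move=> /andP[a1 a2] /andP[b1 b2] e50 rP.
have pi0 := pi_gt0 R.
pose g' t := - (2 * cos t * sin t * (a + b)) + r' t.
have dg (t : R) : is_derive t 1 g (g' t).
  have [dr _ _] := rP t.
  rewrite /g; apply: is_derive_eq.
  rewrite /g' /GRing.scale /=; ring.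
have cg : continuous g.
  by move=> t; apply/differentiable_continuous/derivable1_diffP; have [] := dg t.
have cs (t : R) : cos t ^+ 2 = 1 - sin t ^+ 2 by rewrite cos2sin2.
have s2_ge0 (t : R) : 0 <= sin t ^+ 2 by exact: sqr_ge0.
have s2_le1 (t : R) : sin t ^+ 2 <= 1 by have := sqr_ge0 (cos t); rewrite cs; lra.
have rb t : - (1/50) <= r t <= 1/50.
  by have [_ + _] := rP t; rewrite ler_norml; lra.
have r'b t : r' t <= 1/50.
  by have [_ _] := rP t; rewrite ler_norml; lra.
(* g is positive where sin^2 t <= 1/10, negative where sin^2 t >= 9/10, and
   decreasing in between. *)
have gpos t : sin t ^+ 2 <= 1 / 10 -> 0 < g t.
  by move=> st; rewrite /g cs; have := rb t; have := s2_ge0 t; nra.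
have gneg t : 9 / 10 <= sin t ^+ 2 -> g t < 0.
  by move=> st; rewrite /g cs; have := rb t; have := s2_le1 t; nra.
have s_mono (t u : R) : 0 <= t -> t <= u -> u <= pi / 2 -> sin t ^+ 2 <= sin u ^+ 2.
  move=> t0 tu upi; rewrite lerXn2r ?nnegrE ?sin_ge0_pi //; try (apply/andP; split; lra).
  by rewrite leNgt ltr_sin ?in_itv /=; [rewrite -leNgt | lra..].
have g'neg (t : R) : 0 <= t <= pi / 2 -> 1 / 10 <= sin t ^+ 2 <= 9 / 10 -> g' t < 0.
  move=> tpi st; have s0 : 0 <= sin t by apply: sin_ge0_pi; lra.
  have c0 : 0 <= cos t by apply: cos_ge0_pihalf; lra.
  have cs3 : 3 / 10 <= cos t * sin t.
    rewrite -(@ler_pXn2r _ 2) // ?nnegrE; [|lra|exact: mulr_ge0].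
    rewrite [leRHS]exprMn cs; have : (3 / 10) ^+ 2 = 9 / 100 :> R by field.
    by move=> ->; nra.
  rewrite /g'; have := r'b t; nra.
have [t0 /[!in_itv]/= /andP[t00 t0pi] gt0] : exists2 t0, t0 \in `[0, pi / 2] & g t0 = 0.
  apply: IVT; [lra|exact: continuous_subspaceT|].
  have g0 : 0 < g 0 by apply: gpos; rewrite sin0; lra.
  have gp : g (pi / 2) < 0 by apply: gneg; rewrite sin_pihalf; lra.
  by rewrite ge_min le_max (ltW g0) (ltW gp) orbT.
(* The zero lies strictly inside the middle zone. Any other point is then either in an end zone,
   where the sign is known, or comparable with t0 by monotonicity. *)
have st0 : 1 / 10 < sin t0 ^+ 2 < 9 / 10.
  apply/andP; split; rewrite ltNge; apply/negP.
    by move=> /gpos; rewrite gt0 ltxx.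
  by move=> /gneg; rewrite gt0 ltxx.
have mono (t u : R) : 0 <= t -> t < u -> u <= pi / 2 -> 1 / 10 <= sin t ^+ 2 ->
    sin u ^+ 2 <= 9 / 10 -> g u < g t.
  move=> t_ge0 tu upi st su.
  have [|c /[!in_itv]/= /andP[ct cu] E] := MVT tu (fun y _ => dg y).
    exact: continuous_subspaceT.
  have : g' c < 0.
    apply: g'neg; first lra.
    have := s_mono t c; have := s_mono c u; lra.
  move: E; nra.
exists t0; split => //.
- apply/andP; split; rewrite lt_neqAle ?t00 ?t0pi andbT; apply/eqP => E.
    by move: st0; rewrite -E sin0; lra.
  by move: st0; rewrite E sin_pihalf; lra.
- move=> t /andP[t_ge0 tt0]; have [st|st] := leP (sin t ^+ 2) (1 / 10); first exact: gpos.
  by rewrite -gt0; apply: mono => //; lra.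
- move=> t /andP[t0t tpi]; have [st|st] := leP (9 / 10) (sin t ^+ 2); first exact: gneg.
  by rewrite -gt0; apply: mono => //; lra.
- have [_ ->] := dg t0; apply: g'neg; lra.
Qed.

End TransversalZero.

(** * Coordinates adapted to the quadratic part of h *)

Definition i0 : 'I_4 := @Ordinal 4 0 isT.
Definition i1 : 'I_4 := @Ordinal 4 1 isT.
Definition i2 : 'I_4 := @Ordinal 4 2 isT.
Definition i3 : 'I_4 := @Ordinal 4 3 isT.

Lemma ord4_ind (P : 'I_4 -> Prop) : P i0 -> P i1 -> P i2 -> P i3 -> forall l, P l.
Proof.
move=> P0 P1 P2 P3 -[[|[|[|[|//]]]] lt].
- by rewrite (_ : Ordinal lt = i0) //; exact: val_inj.
- by rewrite (_ : Ordinal lt = i1) //; exact: val_inj.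
- by rewrite (_ : Ordinal lt = i2) //; exact: val_inj.
- by rewrite (_ : Ordinal lt = i3) //; exact: val_inj.
Qed.

Definition j0 : 'I_3 := @Ordinal 3 0 isT.
Definition j1 : 'I_3 := @Ordinal 3 1 isT.
Definition j2 : 'I_3 := @Ordinal 3 2 isT.

Lemma ord3_ind (P : 'I_3 -> Prop) : P j0 -> P j1 -> P j2 -> forall l, P l.
Proof.
move=> P0 P1 P2 -[[|[|[|//]]] lt].
- by rewrite (_ : Ordinal lt = j0) //; exact: val_inj.
- by rewrite (_ : Ordinal lt = j1) //; exact: val_inj.
- by rewrite (_ : Ordinal lt = j2) //; exact: val_inj.
Qed.

Section Model.
Variable R : realType.
Implicit Types (z w : C4 R) (c s t d e : R).

Lemma dotsq4 (x : 'rV[R]_4) :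
  dotsq x = x 0 i0 ^+ 2 + x 0 i1 ^+ 2 + x 0 i2 ^+ 2 + x 0 i3 ^+ 2.
Proof.
rewrite /dotsq !big_ord_recl big_ord0 addr0 !addrA.
by congr (_ + _ + _ + _); congr (x 0 _ ^+ 2); exact: val_inj.
Qed.

Lemma dotsq3 (x : 'rV[R]_3) : dotsq x = x 0 j0 ^+ 2 + x 0 j1 ^+ 2 + x 0 j2 ^+ 2.
Proof.
rewrite /dotsq !big_ord_recl big_ord0 addr0 !addrA.
by congr (_ + _ + _); congr (x 0 _ ^+ 2); exact: val_inj.
Qed.

Definition row4 (a b c d : R) : 'rV[R]_4 := \row_l nth 0 [:: a; b; c; d] l.
Definition row3 (a b c : R) : 'rV[R]_3 := \row_l nth 0 [:: a; b; c] l.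

Lemma C4_eq z w : (forall l, z.1 0 l = w.1 0 l) -> (forall l, z.2 0 l = w.2 0 l) -> z = w.
Proof.
by case: z w => [x y] [x' y'] /= H1 H2; congr pair; apply/rowP => l.
Qed.

Definition modsq z (l : 'I_4) := z.1 0 l ^+ 2 + z.2 0 l ^+ 2.

(** Real and imaginary parts of z_l times the conjugate of z_m, which the diagonal circle action
    leaves fixed. *)
Definition re_mul z (l m : 'I_4) := z.1 0 l * z.1 0 m + z.2 0 l * z.2 0 m.
Definition im_mul z (l m : 'I_4) := z.2 0 l * z.1 0 m - z.1 0 l * z.2 0 m.

(* [h (e z) / e^2] in terms of [d = e^2]: it extends smoothly to [d = 0]. *)
Definition rescaled_h d z : R :=
  let c l := cos_root (d * modsq z l) in
  let s l := sinc_root (d * modsq z l) in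
  - (c i2 * c i3 * (s i0 * s i1) * im_mul z i0 i1
   + c i0 * c i1 * (s i2 * s i3) * im_mul z i2 i3
   - c i0 * c i2 * (s i1 * s i3) * im_mul z i1 i3
   + c i0 * c i3 * (s i1 * s i2) * im_mul z i1 i2
   + c i1 * c i2 * (s i0 * s i3) * im_mul z i0 i3
   - c i1 * c i3 * (s i0 * s i2) * im_mul z i0 i2
   + d * (s i0 * s i1 * (s i2 * s i3)
       * (im_mul z i0 i1 * re_mul z i2 i3 + re_mul z i0 i1 * im_mul z i2 i3))).

Lemma qexp_zj z (l : 'I_4) (sg : bool) (q := if sg then - zj z l else zj z l)
    (S := sinc_root (modsq z l)) :
  qexp q = Quat (cos_root (modsq z l)) 0
    ((-1) ^+ sg * (S * z.1 0 l)) ((-1) ^+ sg * (S * z.2 0 l)).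
Proof.
have zjE : zj z l = Quat 0 0 (z.1 0 l) (z.2 0 l).
  rewrite /zj /coordC4 inord_val /quat_of_C qmulE; apply: quat_eqP => /=; ring.
have qE : q = Quat 0 0 ((-1) ^+ sg * z.1 0 l) ((-1) ^+ sg * z.2 0 l).
  by rewrite /q zjE; case: sg {q}; rewrite ?qoppE; apply: quat_eqP => /=; ring.
have N : qnormsq q = modsq z l.
  by rewrite qE /qnormsq /modsq /= !exprMn sqrr_sign; ring.
rewrite qexp_pure; last by rewrite qE.
have N0 : 0 <= modsq z l by rewrite addr_ge0 // sqr_ge0.
set t := Num.sqrt _; have t2 : modsq z l = t ^+ 2 by rewrite /t N sqr_sqrtr.
rewrite /S t2 cos_rootE -sinc_rootE qE /=.
(* [qexp_pure] divides by t. At t = 0 both coordinates of z_l vanish, so the value of the quotient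
   is irrelevant. *)
have [t0|t0] := eqVneq t 0; last by apply: quat_eqP => /=; field.
have : modsq z l = 0 by rewrite t2 t0 expr0n.
move/eqP; rewrite paddr_eq0 ?sqr_ge0 // !sqrf_eq0 => /andP[/eqP -> /eqP ->].
by apply: quat_eqP => /=; ring.
Qed.

Let re_prod (c0 x0 y0 c1 x1 y1 c2 x2 y2 c3 x3 y3 : R) :
  qre (qi * Quat c0 0 (- x0) (- y0) * Quat c1 0 x1 y1
      * Quat c2 0 (- x2) (- y2) * Quat c3 0 x3 y3) =
  - (c2 * c3 * (y0 * x1 - x0 * y1) + c0 * c1 * (y2 * x3 - x2 * y3)
   - c0 * c2 * (y1 * x3 - x1 * y3) + c0 * c3 * (y1 * x2 - x1 * y2)
   + c1 * c2 * (y0 * x3 - x0 * y3) - c1 * c3 * (y0 * x2 - x0 * y2)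
   + ((y0 * x1 - x0 * y1) * (x2 * x3 + y2 * y3)
      + (x0 * x1 + y0 * y1) * (y2 * x3 - x2 * y3))).
Proof.
have AE : qi * Quat c0 0 (- x0) (- y0) * Quat c1 0 x1 y1 = Quat (x0 * y1 - y0 * x1)
    (c0 * c1 + x0 * x1 + y0 * y1) (c1 * y0 - c0 * y1) (c0 * x1 - c1 * x0).
  by rewrite !qmulE; apply: quat_eqP => /=; ring.
have BE : Quat c2 0 (- x2) (- y2) * Quat c3 0 x3 y3 = Quat (c2 * c3 + x2 * x3 + y2 * y3)
    (y2 * x3 - x2 * y3) (c2 * x3 - c3 * x2) (c2 * y3 - c3 * y2).
  by rewrite !qmulE; apply: quat_eqP => /=; ring.
by rewrite AE -mulrA BE qmulE /=; ring.
Qed.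

Lemma h_rescaled e z : h (e *: z) = e ^+ 2 * rescaled_h (e ^+ 2) z.
Proof.
have M l : modsq (e *: z) l = e ^+ 2 * modsq z l by rewrite /modsq !mxE; ring.
have E1 (l : 'I_4) := qexp_zj (e *: z) l true.
have E2 (l : 'I_4) := qexp_zj (e *: z) l false.
rewrite /h (E1 i0) (E2 i1) (E1 i2) (E2 i3) !M /rescaled_h.
rewrite expr1 expr0 !mulN1r !mul1r re_prod /im_mul /re_mul !mxE; ring.
Qed.

Definition r2 : R := Num.sqrt 2.
Lemma r2_sqr : r2 ^+ 2 = 2. Proof. by rewrite sqr_sqrtr. Qed.
Lemma r2_gt0 : 0 < r2. Proof. by rewrite sqrtr_gt0. Qed.

(* The quadratic part of [h] is a hermitian form of signature (2, 2) whose
   positive and negative eigenspaces are orthogonal and exchanged by complex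
   conjugation. In the coordinates [w = (u, v)] with [u, v] in C^2 adapted to
   them it is [|u|^2 / r2 + Im (u_1 conj u_2) - (|v|^2 / r2 - Im (v_1 conj v_2))]. *)
Definition from_eig w : C4 R := mkC4
  (row4 ((w.1 0 i0 + w.1 0 i2) / r2)
        (- (w.2 0 i0 - w.2 0 i2 - w.2 0 i1 + w.2 0 i3) / 2)
        ((w.1 0 i1 + w.1 0 i3) / r2)
        (- (w.2 0 i0 - w.2 0 i2 + w.2 0 i1 - w.2 0 i3) / 2))
  (row4 ((w.2 0 i0 + w.2 0 i2) / r2)
        ((w.1 0 i0 - w.1 0 i2 - w.1 0 i1 + w.1 0 i3) / 2)
        ((w.2 0 i1 + w.2 0 i3) / r2)
        ((w.1 0 i0 - w.1 0 i2 + w.1 0 i1 - w.1 0 i3) / 2)).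

Definition to_eig z : C4 R := mkC4
  (row4 (z.1 0 i0 / r2 + (z.2 0 i1 + z.2 0 i3) / 2)
        (z.1 0 i2 / r2 - (z.2 0 i1 - z.2 0 i3) / 2)
        (z.1 0 i0 / r2 - (z.2 0 i1 + z.2 0 i3) / 2)
        (z.1 0 i2 / r2 + (z.2 0 i1 - z.2 0 i3) / 2))
  (row4 (z.2 0 i0 / r2 - (z.1 0 i1 + z.1 0 i3) / 2)
        (z.2 0 i2 / r2 + (z.1 0 i1 - z.1 0 i3) / 2)
        (z.2 0 i0 / r2 + (z.1 0 i1 + z.1 0 i3) / 2)
        (z.2 0 i2 / r2 - (z.1 0 i1 - z.1 0 i3) / 2)).

Lemma from_eigK w : to_eig (from_eig w) = w.
Proof.
have r0 : r2 != 0 by rewrite gt_eqF // r2_gt0.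
have E a : a / r2 / r2 = a / 2 by rewrite -r2_sqr; field.
by apply: C4_eq; apply: ord4_ind; rewrite !mxE /= E; field.
Qed.

Lemma to_eigK z : from_eig (to_eig z) = z.
Proof.
have r0 : r2 != 0 by rewrite gt_eqF // r2_gt0.
by apply: C4_eq; apply: ord4_ind; rewrite !mxE /=; field: r2_sqr.
Qed.

Definition plus_sq w := modsq w i0 + modsq w i1.
Definition minus_sq w := modsq w i2 + modsq w i3.

Lemma plus_sq_ge0 w : 0 <= plus_sq w.
Proof. by rewrite !addr_ge0 // sqr_ge0. Qed.

Lemma minus_sq_ge0 w : 0 <= minus_sq w.
Proof. by rewrite !addr_ge0 // sqr_ge0. Qed.

(** The change of coordinates is unitary, so membership of the sphere of radius e reads |u|^2 +
    |v|^2 = e^2 in the new coordinates. *)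
Lemma from_eig_norm w :
  dotsq (from_eig w).1 + dotsq (from_eig w).2 = plus_sq w + minus_sq w.
Proof.
by rewrite !dotsq4 /plus_sq /minus_sq /modsq !mxE /= !exprMn !exprVn r2_sqr; field.
Qed.

Definition combine c s w : C4 R := mkC4
  (row4 (c * w.1 0 i0) (c * w.1 0 i1) (s * w.1 0 i2) (s * w.1 0 i3))
  (row4 (c * w.2 0 i0) (c * w.2 0 i1) (s * w.2 0 i2) (s * w.2 0 i3)).

Lemma plus_sq_combine c s w : plus_sq (combine c s w) = c ^+ 2 * plus_sq w.
Proof. by rewrite /plus_sq /modsq !mxE /=; ring. Qed.

Lemma minus_sq_combine c s w : minus_sq (combine c s w) = s ^+ 2 * minus_sq w.
Proof. by rewrite /minus_sq /modsq !mxE /=; ring. Qed.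

Lemma combineA c s c' s' w :
  combine c s (combine c' s' w) = combine (c * c') (s * s') w.
Proof. by apply: C4_eq; apply: ord4_ind; rewrite !mxE /= mulrA. Qed.

Lemma combine1 w : combine 1 1 w = w.
Proof. by apply: C4_eq; apply: ord4_ind; rewrite !mxE /= mul1r. Qed.

Lemma from_eig_scaler e w : e *: from_eig w = from_eig (combine e e w).
Proof. by apply: C4_eq; apply: ord4_ind; rewrite !mxE /=; ring. Qed.

Lemma from_eig_scale (k : R[i]) w : scaleC4 k (from_eig w) = from_eig (scaleC4 k w).
Proof. by apply: C4_eq; apply: ord4_ind; rewrite !mxE /=; ring. Qed.

Lemma to_eig_scale (k : R[i]) w : scaleC4 k (to_eig w) = to_eig (scaleC4 k w).
Proof. by apply: C4_eq; apply: ord4_ind; rewrite !mxE /=; ring. Qed.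

Lemma combine_scale (k : R[i]) c s w :
  combine c s (scaleC4 k w) = scaleC4 k (combine c s w).
Proof. by apply: C4_eq; apply: ord4_ind; rewrite !mxE /=; ring. Qed.

Lemma scaler_scale (k : R[i]) e w : e *: scaleC4 k w = scaleC4 k (e *: w).
Proof. by apply: C4_eq => l; rewrite !mxE; ring. Qed.

Lemma normc_sq1 (k : R[i]) : `|k| = 1 -> complex.Re k ^+ 2 + complex.Im k ^+ 2 = 1.
Proof.
rewrite normc_def => -[E].
have ge0 : 0 <= complex.Re k ^+ 2 + complex.Im k ^+ 2 by rewrite addr_ge0 // sqr_ge0.
by rewrite -(sqr_sqrtr ge0) E expr1n.
Qed.

Lemma sq1_normc (k : R[i]) : complex.Re k ^+ 2 + complex.Im k ^+ 2 = 1 -> `|k| = 1.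
Proof. by rewrite normc_def => ->; rewrite sqrtr1. Qed.

Lemma modsq_scale (k : R[i]) w l : `|k| = 1 -> modsq (scaleC4 k w) l = modsq w l.
Proof.
by move=> /normc_sq1 k1; rewrite /modsq !mxE -[RHS]mul1r -k1; ring.
Qed.

Definition plus_form w := plus_sq w / r2 + im_mul w i0 i1.
Definition minus_form w := minus_sq w / r2 - im_mul w i2 i3.

Definition quadratic_part z :=
  - (im_mul z i0 i1 + im_mul z i2 i3 - im_mul z i1 i3 + im_mul z i1 i2
     + im_mul z i0 i3 - im_mul z i0 i2).

Lemma quadratic_part_eig w :
  quadratic_part (from_eig w) = plus_form w - minus_form w.
Proof.
have r0 : r2 != 0 by rewrite gt_eqF // r2_gt0.
rewrite /plus_form /minus_form /plus_sq /minus_sq /quadratic_part /im_mul /modsq !mxE /=.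
by field: r2_sqr.
Qed.

Lemma plus_form_combine c s w : plus_form (combine c s w) = c ^+ 2 * plus_form w.
Proof.
by rewrite /plus_form plus_sq_combine /im_mul !mxE /=; ring.
Qed.

Lemma minus_form_combine c s w : minus_form (combine c s w) = s ^+ 2 * minus_form w.
Proof.
by rewrite /minus_form minus_sq_combine /im_mul !mxE /=; ring.
Qed.

Lemma r2V_bounds : 7 / 10 <= r2^-1 <= 3 / 4.
Proof.
have r0 := r2_gt0; have := r2_sqr => rr.
rewrite -(mul1r r2^-1) ler_pdivlMr // ler_pdivrMr //.
by apply/andP; split; nra.
Qed.

(** On unit vectors |Im (u_1 conj u_2)| <= 1/2, and 7/10 <= 1/sqrt 2 <= 3/4. Subtracting and adding
    1/2 produces the bounds 1/5 and 5/4. *)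
Lemma plus_form_bounds w : plus_sq w = 1 -> 1 / 5 <= plus_form w <= 5 / 4.
Proof.
rewrite /plus_form => w1; have := r2V_bounds; rewrite w1 div1r => rb.
move: w1; rewrite /plus_sq /modsq /im_mul.
move: (w.1 0 i0) (w.1 0 i1) (w.2 0 i0) (w.2 0 i1) => a b a' b' H.
have := sqr_ge0 (a' - b); have := sqr_ge0 (a' + b).
have := sqr_ge0 (a - b'); have := sqr_ge0 (a + b') => *.
apply/andP; split; lra.
Qed.

Lemma minus_form_bounds w : minus_sq w = 1 -> 1 / 5 <= minus_form w <= 5 / 4.
Proof.
rewrite /minus_form => w1; have := r2V_bounds; rewrite w1 div1r => rb.
move: w1; rewrite /minus_sq /modsq /im_mul.
move: (w.1 0 i2) (w.1 0 i3) (w.2 0 i2) (w.2 0 i3) => a b a' b' H.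
have := sqr_ge0 (a' - b); have := sqr_ge0 (a' + b).
have := sqr_ge0 (a - b'); have := sqr_ge0 (a + b') => *.
apply/andP; split; lra.
Qed.

End Model.
Arguments r2 {R}.

(** * Comparison of [h] with its quadratic part along the quarter circles *)

Section Estimate.
Variable R : realType.
Implicit Types (z w : C4 R) (t : R).

Definition curve w t : C4 R := from_eig (combine (cos t) (sin t) w).

Let I : Type := (R * C4 R)%type.
Let D : set I := [set i | [/\ 0 <= i.1 <= 1, plus_sq i.2 = 1 & minus_sq i.2 = 1]].
Let d (i : I) : R := i.1.
Let d01 (i : I) : D i -> 0 <= d i <= 1. Proof. by case. Qed.

Local Notation bounded := (@C1_bounded R I D).
Local Notation small := (@C1_small R I D d).

Let bounded_cst (c : R) : bounded (fun=> cst c).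
Proof. by apply: (@C1_bounded_cst _ _ _ _ `|c|). Qed.

Let boundedN f : bounded f -> bounded (fun i t => - f i t).
Proof.
move=> bf; apply: C1_bigO_ext (C1_boundedM (bounded_cst (-1)) bf) => i t /=.
by rewrite mulN1r.
Qed.

Let smallN f : small f -> small (fun i t => - f i t).
Proof.
move=> bf; apply: C1_bigO_ext (C1_smallM bf (bounded_cst (-1))) => i t /=.
by rewrite mulrN1.
Qed.

Let bounded_cos : bounded (fun=> cos).
Proof.
exists 1 => // i _ t; exists (- sin t); first exact: is_derive_cos.
by rewrite mulr1 normrN !ler_norml cos_geN1 cos_le1 sin_geN1 sin_le1.
Qed.

Let bounded_sin : bounded (fun=> sin).
Proof.
exists 1 => // i _ t; exists (cos t); first exact: is_derive_sin.
by rewrite mulr1 !ler_norml cos_geN1 cos_le1 sin_geN1 sin_le1.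
Qed.

Let entry_le1 i l : D i -> `|i.2.1 0 l| <= 1 /\ `|i.2.2 0 l| <= 1.
Proof.
case: i => e w [/= _ p1 m1].
have H (a : R) : a ^+ 2 <= 1 -> `|a| <= 1.
  rewrite -[X in _ <= X](expr1n _ 2) -real_normK ?num_real //.
  by rewrite ler_pXn2r ?nnegrE.
have := (sqr_ge0 (w.1 0 i0), sqr_ge0 (w.1 0 i1), sqr_ge0 (w.1 0 i2), sqr_ge0 (w.1 0 i3)).
have := (sqr_ge0 (w.2 0 i0), sqr_ge0 (w.2 0 i1), sqr_ge0 (w.2 0 i2), sqr_ge0 (w.2 0 i3)).
move=> [[[a0 a1] a2] a3] [[[b0 b1] b2] b3].
move: p1 m1; rewrite /plus_sq /minus_sq /modsq => p1 m1.
by elim/ord4_ind: l; split; apply: H; lra.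
Qed.

Let bounded_entry1 l : bounded (fun i => cst (i.2.1 0 l)).
Proof. by apply: (@C1_bounded_cst _ _ _ _ 1) => i /entry_le1 - /(_ l)[]. Qed.

Let bounded_entry2 l : bounded (fun i => cst (i.2.2 0 l)).
Proof. by apply: (@C1_bounded_cst _ _ _ _ 1) => i /entry_le1 - /(_ l)[]. Qed.

Ltac bounded_tac := repeat first
  [ exact: bounded_cst | exact: bounded_cos | exact: bounded_sin
  | exact: bounded_entry1 | exact: bounded_entry2
  | apply: boundedN | apply: C1_bigOD | apply: C1_boundedM ].

Let bounded_curve l : bounded (fun i t => (curve i.2 t).1 0 l) /\
  bounded (fun i t => (curve i.2 t).2 0 l).
Proof.
by split; elim/ord4_ind: l;
  (apply: C1_bigO_ext; [by move=> i t; rewrite !mxE /=; reflexivity | bounded_tac]).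
Qed.

Let bounded_curve1 l := (bounded_curve l).1.
Let bounded_curve2 l := (bounded_curve l).2.

Ltac bounded_tac' := repeat first
  [ exact: bounded_curve1 | exact: bounded_curve2
  | apply: boundedN | apply: C1_bigOD | apply: C1_boundedM ].

Let bounded_modsq l : bounded (fun i t => modsq (curve i.2 t) l).
Proof. bounded_tac'. Qed.

Let bounded_im l m : bounded (fun i t => im_mul (curve i.2 t) l m).
Proof. bounded_tac'. Qed.

Let bounded_re l m : bounded (fun i t => re_mul (curve i.2 t) l m).
Proof. bounded_tac'. Qed.

Let c (i : I) t l := cos_root (d i * modsq (curve i.2 t) l).
Let s (i : I) t l := sinc_root (d i * modsq (curve i.2 t) l).

Let small_c l : small (fun i t => c i t l - 1).
Proof. by apply: C1_small1_comp => //; [exact: smooth_cos_root | exact: cos_root0]. Qed.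

Let small_s l : small (fun i t => s i t l - 1).
Proof. by apply: C1_small1_comp => //; [exact: smooth_sinc_root | exact: sinc_root0]. Qed.

Let small_term k l m n p q :
  small (fun i t => (c i t k * c i t l * (s i t m * s i t n) - 1) * im_mul (curve i.2 t) p q).
Proof. by apply: C1_smallM => //; do 2?[apply: C1_small1M => //]. Qed.

(** Each coefficient, a product of two cosine and two sine factors, is 1 + O(d), so the six
    quadratic terms lose their coefficients up to O(d); the quartic term carries the factor d
    itself. *)
Let small_remainder : small (fun i t => rescaled_h i.1 (curve i.2 t)
  - quadratic_part (curve i.2 t)).
Proof.
have H := C1_bigOD (C1_bigOD (small_term i2 i3 i0 i1 i0 i1) (small_term i0 i1 i2 i3 i2 i3))
 (C1_bigOD (C1_bigOD (smallN (small_term i0 i2 i1 i3 i1 i3)) (small_term i0 i3 i1 i2 i1 i2))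
 (C1_bigOD (small_term i1 i2 i0 i3 i0 i3) (smallN (small_term i1 i3 i0 i2 i0 i2)))).
have bs l := C1_bounded_small1 d01 (small_s l).
have H' : small (fun i t => d i * (s i t i0 * s i t i1 * (s i t i2 * s i t i3)
  * (im_mul (curve i.2 t) i0 i1 * re_mul (curve i.2 t) i2 i3
     + re_mul (curve i.2 t) i0 i1 * im_mul (curve i.2 t) i2 i3))).
  apply: C1_smallM; first exact: C1_small_d.
  by apply: C1_boundedM; [do !apply: C1_boundedM | apply: C1_bigOD; apply: C1_boundedM].
apply: C1_bigO_ext (smallN (C1_bigOD H H')) => i t.
by rewrite /rescaled_h /quadratic_part /c /s /d /=; ring.
Qed.

Lemma curve_zero : exists2 e0 : R, 0 < e0 <= 1 & forall e, 0 < e < e0 ->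
  forall w, plus_sq w = 1 -> minus_sq w = 1 ->
  let g t := rescaled_h (e ^+ 2) (curve w t) in
  exists t0, [/\ 0 < t0 < pi / 2, g t0 = 0,
    forall t, 0 <= t < t0 -> 0 < g t,
    forall t, t0 < t <= pi / 2 -> g t < 0 & 'D_1 g t0 < 0].
Proof.
have [K K0 HK] := small_remainder.
have K1 : 0 < 1 + 50 * K by rewrite ltr_wpDr // mulr_ge0.
(* Below this radius 50 K e < 1 and e < 1, hence K e^2 <= K e <= 1/50, the perturbation allowed by
   [unique_transversal_zero]. *)
exists (1 + 50 * K)^-1.
  by rewrite invr_gt0 K1 invf_le1 // lerDl mulr_ge0.
move=> e /andP[e0 eK] w w1 w2 g.
have e1 : e < 1 by apply: (lt_le_trans eK); rewrite invf_le1 // lerDl mulr_ge0.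
have De : D (e ^+ 2, w).
  by split => //=; rewrite sqr_ge0 expr_le1 // ltW.
pose r t := g t - quadratic_part (curve w t).
have Ke : K * e ^+ 2 <= 1 / 50.
  have eK' : e * (1 + 50 * K) < 1 by rewrite -ltr_pdivlMr // div1r.
  have : e ^+ 2 <= e by rewrite expr2 ler_piMl // ltW.
  nra.
pose P t (r' : R) := [/\ is_derive t 1 r r', `|r t| <= K * e ^+ 2 & `|r'| <= K * e ^+ 2].
have /choice[r' rP] : forall t, exists r', P t r'.
  by move=> t; have [r' dr [rb r'b]] := HK _ De t; exists r'.
have [t0 [t0b z pos neg dn]] := unique_transversal_zero (plus_form_bounds w1)
  (minus_form_bounds w2) Ke rP.
have gE : (fun t => cos t ^+ 2 * plus_form w - sin t ^+ 2 * minus_form w + r t) = g.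
  apply/funext => t; rewrite /r /curve quadratic_part_eig plus_form_combine.
  by rewrite minus_form_combine; ring.
rewrite gE in dn.
by exists t0; split => // [|t /pos|t /neg]; rewrite -?gE.
Qed.

End Estimate.

(** * The link as a circle quotient of S^3 x S^3 *)

Section SmoothReal.
Variables (R : realType) (V : normedModType R) (O : set V).
Hypothesis oO : open O.
Implicit Types f g : V -> R.

Lemma smooth_on_ext (W : normedModType R) (f g : V -> W) :
  (forall x, f x = g x) -> smooth_on O f -> smooth_on O g.
Proof. by move=> /funext ->. Qed.

Lemma smooth_cst (c : R) : smooth_on O (fun=> c).
Proof. by move=> k; exact: class_C_cst. Qed.

Lemma smoothD f g : smooth_on O f -> smooth_on O g -> smooth_on O (fun x => f x + g x).
Proof. by move=> Cf Cg k; exact: class_CD. Qed.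

Lemma smoothM f g : smooth_on O f -> smooth_on O g -> smooth_on O (fun x => f x * g x).
Proof. by move=> Cf Cg k; exact: class_CM. Qed.

Lemma smooth_comp (U : set R) (phi : R -> R) f : smooth_on U phi ->
  (forall x, O x -> U (f x)) -> smooth_on O f -> smooth_on O (fun x => phi (f x)).
Proof. by move=> Cp fU Cf k; exact: (class_C_comp oO (Cp k) (Cf k)). Qed.

Lemma smoothN f : smooth_on O f -> smooth_on O (fun x => - f x).
Proof.
move=> /(smoothM (smooth_cst (-1))); apply: smooth_on_ext => x.
by rewrite mulN1r.
Qed.

Lemma smooth_inv f : (forall x, O x -> f x != 0) -> smooth_on O f ->
  smooth_on O (fun x => (f x)^-1).
Proof. by move=> f0; apply: smooth_comp f0 => k; exact: class_C_inv. Qed.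

Lemma smooth_sqrt f : (forall x, O x -> 0 < f x) -> smooth_on O f ->
  smooth_on O (fun x => Num.sqrt (f x)).
Proof. by move=> f0; apply: smooth_comp f0 => k; exact: class_C_sqrt. Qed.

Lemma smooth_cos f : smooth_on O f -> smooth_on O (fun x => cos (f x)).
Proof. by apply: (smooth_comp (U := setT)) => // k; have [] := class_C_sin_cos R k. Qed.

Lemma smooth_sin f : smooth_on O f -> smooth_on O (fun x => sin (f x)).
Proof. by apply: (smooth_comp (U := setT)) => // k; have [] := class_C_sin_cos R k. Qed.

Definition smooth_coords (f : V -> C4 R) := forall l,
  smooth_on O (fun x => (f x).1 0 l) /\ smooth_on O (fun x => (f x).2 0 l).

Lemma smooth_coords_on (f : V -> C4 R) : smooth_coords f -> smooth_on O f.
Proof.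
move=> Cf k.
have -> : f = fun x => ((f x).1, (f x).2) :> C4 R by apply/funext => x; case: (f x).
apply: class_C_pair => //; apply: class_C_rV => // i.
  exact: (Cf i).1.
exact: (Cf i).2.
Qed.

End SmoothReal.

Ltac smooth_step := first
  [ assumption | exact: smooth_cst
  | match goal with H : smooth_coords _ _ |- _ => exact: (H _).1 end
  | match goal with H : smooth_coords _ _ |- _ => exact: (H _).2 end
  | apply: smoothN | apply: smoothD | apply: smoothM ].
Ltac smooth := repeat smooth_step.

Section SmoothModel.
Variables (R : realType) (V : normedModType R) (O : set V).
Hypothesis oO : open O.
Implicit Types (w : C4 R) (f : V -> C4 R) (c s : V -> R) (d : R).

Lemma smooth_modsq f l : smooth_coords O f -> smooth_on O (fun x => modsq (f x) l).
Proof. by move=> Cf; smooth. Qed.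

Lemma smooth_plus_sq f : smooth_coords O f -> smooth_on O (fun x => plus_sq (f x)).
Proof. by move=> Cf; smooth. Qed.

Lemma smooth_minus_sq f : smooth_coords O f -> smooth_on O (fun x => minus_sq (f x)).
Proof. by move=> Cf; smooth. Qed.

Ltac smooth_entry := split;
  (apply: smooth_on_ext; [by move=> x; rewrite !mxE /=; reflexivity | smooth]).

Lemma smooth_combine c s f : smooth_on O c -> smooth_on O s -> smooth_coords O f ->
  smooth_coords O (fun x => combine (c x) (s x) (f x)).
Proof. by move=> Cc Cs Cf; elim/ord4_ind; smooth_entry. Qed.

Lemma smooth_from_eig f : smooth_coords O f -> smooth_coords O (fun x => from_eig (f x)).
Proof. by move=> Cf; elim/ord4_ind; smooth_entry. Qed.

Lemma smooth_to_eig f : smooth_coords O f -> smooth_coords O (fun x => to_eig (f x)).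
Proof. by move=> Cf; elim/ord4_ind; smooth_entry. Qed.

Lemma smooth_rescaled_h d f : smooth_coords O f ->
  smooth_on O (fun x => rescaled_h d (f x)).
Proof.
move=> Cf.
have Cc l : smooth_on O (fun x => cos_root (d * modsq (f x) l)).
  apply: (smooth_comp oO (U := setT)) => //; first exact: smooth_cos_root.
  by apply: smoothM => //; [exact: smooth_cst | exact: smooth_modsq].
have Cs l : smooth_on O (fun x => sinc_root (d * modsq (f x) l)).
  apply: (smooth_comp oO (U := setT)) => //; first exact: smooth_sinc_root.
  by apply: smoothM => //; [exact: smooth_cst | exact: smooth_modsq].
have Ci l m : smooth_on O (fun x => im_mul (f x) l m) by smooth.
have Cr l m : smooth_on O (fun x => re_mul (f x) l m) by smooth.
rewrite /rescaled_h; move: Cc Cs Ci Cr {Cf} => *.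
repeat first [match goal with H : _ |- _ => exact: H end | exact: smooth_cst
  | apply: smoothN => // | apply: smoothD => // | apply: smoothM => //].
Qed.

(** Rescaling both halves of w to length 1 extends maps defined on S^3 x S^3 to the open set where
    neither half vanishes, as smoothness in the ambient space demands. *)
Definition normalize w : C4 R :=
  combine (Num.sqrt (plus_sq w))^-1 (Num.sqrt (minus_sq w))^-1 w.

Lemma smooth_normalize f : smooth_coords O f ->
  (forall x, O x -> 0 < plus_sq (f x)) -> (forall x, O x -> 0 < minus_sq (f x)) ->
  smooth_coords O (fun x => normalize (f x)).
Proof.
move=> Cf p0 m0; apply: smooth_combine => //.
  apply: smooth_inv => // [x /p0|]; first by rewrite -sqrtr_gt0 => /lt0r_neq0.
  by apply: smooth_sqrt => //; exact: smooth_plus_sq.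
apply: smooth_inv => // [x /m0|]; first by rewrite -sqrtr_gt0 => /lt0r_neq0.
by apply: smooth_sqrt => //; exact: smooth_minus_sq.
Qed.

End SmoothModel.

(** * The zero on each quarter circle and its smooth dependence on (u, v) *)

Section Angle.
Variables (R : realType) (e : R).
Implicit Types w : C4 R.

Lemma plus_sq_normalize w : 0 < plus_sq w -> plus_sq (normalize w) = 1.
Proof.
move=> w0; rewrite plus_sq_combine exprVn sqr_sqrtr ?ltW // mulVf //.
exact: lt0r_neq0.
Qed.

Lemma minus_sq_normalize w : 0 < minus_sq w -> minus_sq (normalize w) = 1.
Proof.
move=> w0; rewrite minus_sq_combine exprVn sqr_sqrtr ?ltW // mulVf //.
exact: lt0r_neq0.
Qed.

Lemma normalize_combine a b w : 0 < a -> 0 < b -> plus_sq w = 1 -> minus_sq w = 1 ->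
  normalize (combine a b w) = w.
Proof.
move=> a0 b0 p1 m1; rewrite /normalize plus_sq_combine minus_sq_combine p1 m1 !mulr1.
by rewrite !sqrtr_sqr !gtr0_norm // combineA !mulVf ?combine1 // gt_eqF.
Qed.

Lemma normalize_id w : plus_sq w = 1 -> minus_sq w = 1 -> normalize w = w.
Proof. by move=> p1 m1; rewrite -{1}(combine1 w) normalize_combine. Qed.

Lemma normalize_scale (k : R[i]) w : `|k| = 1 ->
  normalize (scaleC4 k w) = scaleC4 k (normalize w).
Proof.
move=> k1; rewrite /normalize combine_scale /plus_sq /minus_sq.
by rewrite !modsq_scale.
Qed.

Definition link_fun w t := rescaled_h (e ^+ 2) (curve (normalize w) t).

(** A choice among zeros, with default value 0; when both halves of w are nonzero, [angleP] shows
    that there is exactly one zero to choose. *)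
Definition angle w := xget 0 [set t : R | 0 < t < pi / 2 /\ link_fun w t = 0].

Definition link_point w : C4 R := e *: curve (normalize w) (angle w).

Hypothesis zeroP : forall w, plus_sq w = 1 -> minus_sq w = 1 ->
  let g t := rescaled_h (e ^+ 2) (curve w t) in
  exists t0, [/\ 0 < t0 < pi / 2, g t0 = 0,
    forall t, 0 <= t < t0 -> 0 < g t,
    forall t, t0 < t <= pi / 2 -> g t < 0 & 'D_1 g t0 < 0].

Lemma angleP w : 0 < plus_sq w -> 0 < minus_sq w ->
  [/\ 0 < angle w < pi / 2, link_fun w (angle w) = 0,
    forall t, 0 <= t < angle w -> 0 < link_fun w t,
    forall t, angle w < t <= pi / 2 -> link_fun w t < 0
    & 'D_1 (link_fun w) (angle w) < 0].
Proof.
move=> p0 m0.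
have [t0 [t0b z pos neg dn]] := zeroP (plus_sq_normalize p0) (minus_sq_normalize m0).
suff -> : angle w = t0 by [].
rewrite /angle; case: xgetP => [t _ [/andP[tp tpi] tz]|/(_ t0)]; last by case.
case: (ltgtP t t0) => // tt0.
  by have := pos t; rewrite tt0 ltW // => /(_ isT); rewrite -/(link_fun w t) tz ltxx.
by have := neg t; rewrite tt0 ltW // => /(_ isT); rewrite -/(link_fun w t) tz ltxx.
Qed.

(** The interval is closed on purpose: points of the sphere with u = 0 or v = 0 correspond to its
    ends, and [linkP] relies on this lemma to exclude them from the link. *)
Lemma angle_uniq w t : 0 < plus_sq w -> 0 < minus_sq w -> 0 <= t <= pi / 2 ->
  link_fun w t = 0 -> t = angle w.
Proof.
move=> p0 m0 /andP[t0 tpi] tz; have [_ _ pos neg _] := angleP p0 m0.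
case: (ltgtP t (angle w)) => // tt0.
  by have := pos t; rewrite tt0 t0 => /(_ isT); rewrite tz ltxx.
by have := neg t; rewrite tt0 tpi => /(_ isT); rewrite tz ltxx.
Qed.

Variables (V : normedModType R) (O : set V) (f : V -> C4 R).
Hypotheses (oO : open O) (Cf : smooth_coords O f).
Hypotheses (p0 : forall x, O x -> 0 < plus_sq (f x))
  (m0 : forall x, O x -> 0 < minus_sq (f x)).

Lemma smooth_angle : smooth_on O (fun x => angle (f x)).
Proof.
pose G (p : V * R) := link_fun (f p.1) p.2.
apply: (implicit_smooth (G := G) (a := 0) (b := pi / 2)) => //.
- have oOT : open (O `*` [set: R]).
    rewrite (_ : O `*` setT = fst @^-1` O).
      by apply: open_comp => // p _; exact: cvg_fst.
    by apply/seteqP; split=> [p []|p].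
  have Csnd : smooth_on (O `*` [set: R]) (fun p : V * R => p.2).
    move=> k; apply: (class_C_sub (O := setT)) => //.
    exact: (@class_C_snd _ V _ _ k id (@class_C_linear _ _ _ k setT idfun (fun=> cvg_id))).
  apply: smooth_rescaled_h => //; apply: smooth_from_eig => //.
  apply: smooth_combine => //; [exact: smooth_cos|exact: smooth_sin|].
  apply: smooth_normalize => //.
  + move=> l; split=> k.
      exact: (@class_C_fst _ V R R k (fun x => (f x).1 0 l) O oO ((Cf l).1 k)).
    exact: (@class_C_fst _ V R R k (fun x => (f x).2 0 l) O oO ((Cf l).2 k)).
  + by move=> p [/p0].
  + by move=> p [/m0].
- by move=> x Ox; have [] := angleP (p0 Ox) (m0 Ox).
- by move=> x Ox; have [] := angleP (p0 Ox) (m0 Ox).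
- move=> x t Ox /andP[t0 tt]; have [_ _ pos _ _] := angleP (p0 Ox) (m0 Ox).
  by apply: pos; rewrite ltW.
- move=> x t Ox /andP[t0 tt]; have [_ _ _ neg _] := angleP (p0 Ox) (m0 Ox).
  by apply: neg; rewrite t0 ltW.
- move=> x Ox; have [_ _ _ _ dn] := angleP (p0 Ox) (m0 Ox).
  suff -> : 'D_(0, 1) G (x, angle (f x)) = 'D_1 (link_fun (f x)) (angle (f x)).
    by rewrite lt_eqF.
  (* In the direction (0, 1) the difference quotients of G are those of its slice in t. *)
  rewrite /derive; apply: (congr1 (fun F : R -> R => lim (F a @[a --> 0^']))).
  apply/funext => a /=.
  by rewrite /G /= scaler0 add0r.
Qed.

Lemma smooth_link_point : smooth_on O (fun x => link_point (f x)).
Proof.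
have Ca := smooth_angle.
apply: smooth_coords_on => //.
have -> : (fun x => link_point (f x)) = fun x => from_eig (combine e e
    (combine (cos (angle (f x))) (sin (angle (f x))) (normalize (f x)))).
  by apply/funext => x; rewrite -from_eig_scaler.
apply: smooth_from_eig => //; apply: smooth_combine => //; [exact: smooth_cst..|].
apply: smooth_combine => //; [exact: smooth_cos|exact: smooth_sin|].
exact: smooth_normalize.
Qed.

End Angle.

(** * Circle invariants of S^3 x S^3 and their local sections *)

Section Hopf.
Variable R : realType.
Local Notation R3R4 := ('rV[R]_3 * 'rV[R]_4)%type.
Implicit Types (w z : C4 R) (x : 'rV[R]_4) (n : 'rV[R]_3).

(* For [w = (u, v)] with [u, v] in C^2: the Hopf fibration at [u], and
   [conj v_1 (u_1, u_2) + v_2 (- conj u_2, conj u_1)]. Both are invariant under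
   the circle, and the latter determines [v] from [u]. *)
Definition hopf_map w : R3R4 :=
  (row3 (modsq w i0 - modsq w i1) (2 * re_mul w i0 i1) (2 * im_mul w i0 i1),
   row4 (re_mul w i2 i0 - re_mul w i3 i1) (- im_mul w i2 i0 - im_mul w i3 i1)
        (re_mul w i2 i1 + re_mul w i3 i0) (- im_mul w i2 i1 + im_mul w i3 i0)).

(** Here u = (a + b i, c + d i). The second invariant is the matrix with columns u and (- conj u_2,
    conj u_1) applied to (conj v_1, v_2). For |u| = 1 this matrix is unitary, so its adjoint
    recovers v from x. *)
Definition lift_hopf (a b c d : R) x : C4 R := mkC4
  (row4 a c (x 0 i0 * a + x 0 i1 * b + x 0 i2 * c + x 0 i3 * d)
            (x 0 i2 * a - x 0 i3 * b - x 0 i0 * c + x 0 i1 * d))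
  (row4 b d (- (x 0 i1 * a - x 0 i0 * b + x 0 i3 * c - x 0 i2 * d))
            (x 0 i3 * a + x 0 i2 * b - x 0 i1 * c - x 0 i0 * d)).

Lemma hopf_sphere w : plus_sq w = 1 -> minus_sq w = 1 ->
  dotsq (hopf_map w).1 = 1 /\ dotsq (hopf_map w).2 = 1.
Proof.
move=> p1 m1; rewrite dotsq3 dotsq4 !mxE /=; split.
  transitivity (plus_sq w ^+ 2); last by rewrite p1 expr1n.
  by rewrite /plus_sq /modsq /re_mul /im_mul; ring.
transitivity (plus_sq w * minus_sq w); last by rewrite p1 m1 mulr1.
by rewrite /plus_sq /minus_sq /modsq /re_mul /im_mul; ring.
Qed.

Lemma hopf_map_scale (k : R[i]) w : `|k| = 1 -> hopf_map (scaleC4 k w) = hopf_map w.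
Proof.
move=> k1; have k2 := normc_sq1 k1.
have rk l m : re_mul (scaleC4 k w) l m = re_mul w l m.
  by rewrite /re_mul !mxE -[RHS]mul1r -k2; ring.
have ik l m : im_mul (scaleC4 k w) l m = im_mul w l m.
  by rewrite /im_mul !mxE -[RHS]mul1r -k2; ring.
by rewrite /hopf_map !rk !ik !modsq_scale.
Qed.

Lemma plus_sq_lift a b c d x :
  plus_sq (lift_hopf a b c d x) = a ^+ 2 + b ^+ 2 + (c ^+ 2 + d ^+ 2).
Proof. by rewrite /plus_sq /modsq !mxE. Qed.

Lemma minus_sq_lift a b c d x :
  minus_sq (lift_hopf a b c d x) = dotsq x * (a ^+ 2 + b ^+ 2 + (c ^+ 2 + d ^+ 2)).
Proof. by rewrite dotsq4 /minus_sq /modsq !mxE /=; ring. Qed.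

Lemma hopf_map_lift a b c d x : a ^+ 2 + b ^+ 2 + (c ^+ 2 + d ^+ 2) = 1 ->
  hopf_map (lift_hopf a b c d x) =
  (row3 (a ^+ 2 + b ^+ 2 - (c ^+ 2 + d ^+ 2)) (2 * (a * c + b * d)) (2 * (b * c - a * d)), x).
Proof.
move=> N; rewrite /hopf_map /modsq /re_mul /im_mul; congr pair.
  by apply/rowP; apply: ord3_ind; rewrite !mxE.
by apply/rowP; apply: ord4_ind; rewrite !mxE /= -[RHS]mulr1 -N; ring.
Qed.

Lemma lift_hopf_map w : plus_sq w = 1 ->
  w = lift_hopf (w.1 0 i0) (w.2 0 i0) (w.1 0 i1) (w.2 0 i1) (hopf_map w).2.
Proof.
move=> p1; apply: C4_eq; apply: ord4_ind; rewrite !mxE //= -[LHS]mulr1 -p1;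
  rewrite /re_mul /im_mul /plus_sq /modsq; ring.
Qed.

(** Let u and U be the first halves of [w] and [w']. For unit vectors, equal Hopf images mean u_l
    conj u_m = U_l conj U_m for all l and m. Hence k = sum_m U_m conj u_m satisfies k u = U, and the
    second invariant then determines the other half. *)
Lemma hopf_fiber w w' : plus_sq w = 1 -> plus_sq w' = 1 -> hopf_map w = hopf_map w' ->
  exists2 k : R[i], `|k| = 1 & w' = scaleC4 k w.
Proof.
move=> p1 p1' E.
have E1 := congr1 (fun p : R3R4 => p.1 0 j0) E.
have E2 := congr1 (fun p : R3R4 => p.1 0 j1) E.
have E3 := congr1 (fun p : R3R4 => p.1 0 j2) E.
have E4 := congr1 (fun p : R3R4 => p.2) E.
rewrite /= !mxE /= in E1 E2 E3.
have [M0 M1] : modsq w i0 = modsq w' i0 /\ modsq w i1 = modsq w' i1.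
  by move: p1 p1' E1; rewrite /plus_sq; lra.
have re : re_mul w i0 i1 = re_mul w' i0 i1 by lra.
have im : im_mul w i0 i1 = im_mul w' i0 i1 by lra.
pose k : R[i] := ((w'.1 0 i0 * w.1 0 i0 + w'.2 0 i0 * w.2 0 i0
   + (w'.1 0 i1 * w.1 0 i1 + w'.2 0 i1 * w.2 0 i1))
  +i* (w'.2 0 i0 * w.1 0 i0 - w'.1 0 i0 * w.2 0 i0
   + (w'.2 0 i1 * w.1 0 i1 - w'.1 0 i1 * w.2 0 i1)))%C.
have U1 : (scaleC4 k w).1 0 i0 = w'.1 0 i0.
  rewrite !mxE; transitivity (w'.1 0 i0 * modsq w i0
     + (w'.1 0 i1 * re_mul w i0 i1 - w'.2 0 i1 * im_mul w i0 i1)).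
    by rewrite /k /modsq /re_mul /im_mul /=; ring.
  rewrite M0 re im -[RHS]mulr1 -p1' /plus_sq /modsq /re_mul /im_mul; ring.
have U2 : (scaleC4 k w).2 0 i0 = w'.2 0 i0.
  rewrite !mxE; transitivity (w'.2 0 i0 * modsq w i0
     + (w'.1 0 i1 * im_mul w i0 i1 + w'.2 0 i1 * re_mul w i0 i1)).
    by rewrite /k /modsq /re_mul /im_mul /=; ring.
  rewrite M0 re im -[RHS]mulr1 -p1' /plus_sq /modsq /re_mul /im_mul; ring.
have U3 : (scaleC4 k w).1 0 i1 = w'.1 0 i1.
  rewrite !mxE; transitivity (w'.1 0 i1 * modsq w i1
     + (w'.1 0 i0 * re_mul w i0 i1 + w'.2 0 i0 * im_mul w i0 i1)).
    by rewrite /k /modsq /re_mul /im_mul /=; ring.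
  rewrite M1 re im -[RHS]mulr1 -p1' /plus_sq /modsq /re_mul /im_mul; ring.
have U4 : (scaleC4 k w).2 0 i1 = w'.2 0 i1.
  rewrite !mxE; transitivity (w'.2 0 i1 * modsq w i1
     + (w'.2 0 i0 * re_mul w i0 i1 - w'.1 0 i0 * im_mul w i0 i1)).
    by rewrite /k /modsq /re_mul /im_mul /=; ring.
  rewrite M1 re im -[RHS]mulr1 -p1' /plus_sq /modsq /re_mul /im_mul; ring.
have k1 : `|k| = 1.
  apply: sq1_normc; transitivity (plus_sq (scaleC4 k w)).
    rewrite -[LHS]mulr1 -p1 /plus_sq /modsq !mxE; ring.
  by rewrite /plus_sq /modsq U1 U2 U3 U4.
have pk : plus_sq (scaleC4 k w) = 1 by rewrite /plus_sq !modsq_scale.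
exists k => //.
rewrite (lift_hopf_map p1') (lift_hopf_map pk) U1 U2 U3 U4.
by rewrite hopf_map_scale // E4.
Qed.

(* Local sections, each defined away from one pole of S^2. *)
Definition hopf_section (b : bool) (p : R3R4) : C4 R :=
  let n := p.1 in
  let r := Num.sqrt ((1 + (-1) ^+ b * n 0 j0) / 2) in
  if b then lift_hopf (n 0 j1 / (2 * r)) (n 0 j2 / (2 * r)) r 0 p.2
  else lift_hopf r 0 (n 0 j1 / (2 * r)) (- (n 0 j2 / (2 * r))) p.2.

(** The first condition removes the pole at which the section breaks down. The second keeps the half
    v of the lift nonzero off the unit sphere, where [normalize] is still applied. *)
Definition chart (b : bool) : set (R3R4) :=
  [set p : R3R4 | -1 < (-1) ^+ b * p.1 0 j0 /\ 0 < dotsq p.2].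

Lemma chart_gt0 b p : chart b p -> 0 < (1 + (-1) ^+ b * p.1 0 j0) / 2.
Proof. by move=> [n1 _]; lra. Qed.

Lemma chart_open b : open (chart b).
Proof.
have -> : chart b = (fun p : R3R4 => (-1) ^+ b * p.1 0 j0) @^-1` [set x | -1 < x]
    `&` (fun p : R3R4 => dotsq p.2) @^-1` [set x | 0 < x] by [].
apply: openI; apply: open_comp; try exact: open_gt.
  move=> p _; apply: (@class_C_continuous _ _ _ 0 setT) => //.
  apply: smoothM; first exact: openT.
    exact: smooth_cst.
  by
  move=> k; exact: class_C_fst_coord.
move=> p _; apply: (@class_C_continuous _ _ _ 0 setT) => //.
have -> : (fun p : R3R4 => dotsq p.2) = fun p =>
    p.2 0 i0 * p.2 0 i0 + p.2 0 i1 * p.2 0 i1 + p.2 0 i2 * p.2 0 i2 + p.2 0 i3 * p.2 0 i3.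
  by apply/funext => q; rewrite dotsq4 !expr2.
have Ci i : smooth_on setT (fun q : R3R4 => q.2 0 i).
  by move=> k; exact: class_C_snd_coord.
do !apply: smoothD; try exact: openT.
all: by apply: smoothM => //; exact: openT.
Qed.

Lemma smooth_lift_hopf (V : normedModType R) (O : set V) (a b c d : V -> R)
    (x : V -> 'rV[R]_4) :
  open O -> smooth_on O a -> smooth_on O b -> smooth_on O c -> smooth_on O d ->
  (forall i, smooth_on O (fun p => x p 0 i)) ->
  smooth_coords O (fun p => lift_hopf (a p) (b p) (c p) (d p) (x p)).
Proof.
move=> oO Ca Cb Cc Cd Cx; elim/ord4_ind; split;
  apply: smooth_on_ext; (try by move=> p; rewrite !mxE /=; reflexivity);
  repeat first [assumption | exact: Cx | apply: smoothN | apply: smoothD | apply: smoothM].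
Qed.

Lemma smooth_hopf_section b : smooth_coords (chart b) (hopf_section b).
Proof.
have oO : open (chart b) by exact: chart_open.
have Cn i : smooth_on (chart b) (fun p : R3R4 => p.1 0 i) by
  move=> k; exact: class_C_fst_coord.
have Cx i : smooth_on (chart b) (fun p : R3R4 => p.2 0 i) by
  move=> k; exact: class_C_snd_coord.
pose r (p : R3R4) := Num.sqrt ((1 + (-1) ^+ b * p.1 0 j0) / 2).
have Cr : smooth_on (chart b) r.
  apply: smooth_sqrt => //; first by move=> p; exact: chart_gt0.
  repeat first [assumption | exact: Cn | exact: smooth_cst | apply: smoothD | apply: smoothM].
have Cv : smooth_on (chart b) (fun p => (2 * r p)^-1).
  apply: smooth_inv => // [p Op|]; last by apply: smoothM => //; exact: smooth_cst.
  by rewrite mulf_neq0 // gt_eqF // sqrtr_gt0 chart_gt0.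
have C0 : smooth_on (chart b) (fun=> 0 : R) by exact: smooth_cst.
have C1 : smooth_on (chart b) (fun p : R3R4 => p.1 0 j1 * (2 * r p)^-1) by apply: smoothM.
have C2 : smooth_on (chart b) (fun p : R3R4 => p.1 0 j2 * (2 * r p)^-1) by apply: smoothM.
have C2' : smooth_on (chart b) (fun p : R3R4 => - (p.1 0 j2 * (2 * r p)^-1)) by
  apply: smoothN.
by case: b @r oO Cn Cx Cr Cv C0 C1 C2 C2' => r *; apply: smooth_lift_hopf.
Qed.

Lemma plus_sq_section_gt0 b p : chart b p -> 0 < plus_sq (hopf_section b p).
Proof.
move=> /chart_gt0; rewrite -sqrtr_gt0 => r0.
have := exprn_gt0 2 r0 => r2.
case: b r0 r2 => r0 r2; rewrite /hopf_section plus_sq_lift.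
  by rewrite ltr_wpDl ?addr_ge0 ?sqr_ge0 // ltr_wpDr ?sqr_ge0.
by rewrite ltr_wpDr ?addr_ge0 ?sqr_ge0 // ltr_wpDr ?sqr_ge0.
Qed.

Lemma minus_sq_section_gt0 b p : chart b p -> 0 < minus_sq (hopf_section b p).
Proof.
move=> Op; have := plus_sq_section_gt0 Op; have [_ x0] := Op.
by case: b {Op} => p0; rewrite /hopf_section minus_sq_lift mulr_gt0 // -(plus_sq_lift _ _ _ _ p.2).
Qed.

(** The phase is fixed by making u_1 (for [false]) or u_2 (for [true]) equal to a real r > 0. From
    |u_1|^2 + |u_2|^2 = 1 and |u_1|^2 - |u_2|^2 = n_0 comes r^2 = (1 + n_0) / 2 or (1 - n_0) / 2,
    and u_1 conj u_2 = (n_1 + i n_2) / 2 gives the other coordinate. *)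
Lemma hopf_sectionK b p : chart b p -> dotsq p.1 = 1 ->
  plus_sq (hopf_section b p) = 1 /\ hopf_map (hopf_section b p) = p.
Proof.
move=> Op; have := chart_gt0 Op; rewrite /hopf_section dotsq3.
case: p Op => n x /= Op r0 n1.
set r := Num.sqrt _.
have rr : r ^+ 2 = (1 + (-1) ^+ b * n 0 j0) / 2 by rewrite sqr_sqrtr // ltW.
have rn0 : r != 0 by rewrite gt_eqF // sqrtr_gt0.
have N : r ^+ 2 + ((n 0 j1 / (2 * r)) ^+ 2 + (n 0 j2 / (2 * r)) ^+ 2) = 1.
  have -> : r ^+ 2 + ((n 0 j1 / (2 * r)) ^+ 2 + (n 0 j2 / (2 * r)) ^+ 2) =
     r ^+ 2 + (n 0 j1 ^+ 2 + n 0 j2 ^+ 2) / (4 * r ^+ 2) by field.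
  have -> : n 0 j1 ^+ 2 + n 0 j2 ^+ 2 = 4 * r ^+ 2 * (1 - r ^+ 2).
    rewrite rr; have := sqrr_sign R b; move: ((-1) ^+ b) => s s2.
    transitivity (1 - s ^+ 2 * n 0 j0 ^+ 2); last by field.
    by rewrite s2 mul1r; lra.
  by field.
clearbody r; case: b {Op r0} rr => rr; rewrite ?expr0 ?expr1 ?mul1r ?mulN1r in rr.
- have N' : (n 0 j1 / (2 * r)) ^+ 2 + (n 0 j2 / (2 * r)) ^+ 2 + (r ^+ 2 + 0 ^+ 2) = 1.
    by rewrite -[RHS]N; ring.
  rewrite plus_sq_lift hopf_map_lift //; split=> //; congr pair.
  apply/rowP; apply: ord3_ind; rewrite !mxE /=.
  + transitivity (1 - 2 * r ^+ 2); [move: N'; set A := _ / _; set B := _ / _; lra |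
      by rewrite rr; field].
  + by field.
  + by field.
- have N' : r ^+ 2 + 0 ^+ 2 + ((n 0 j1 / (2 * r)) ^+ 2 + (- (n 0 j2 / (2 * r))) ^+ 2) = 1.
    by rewrite -[RHS]N; ring.
  rewrite plus_sq_lift hopf_map_lift //; split=> //; congr pair.
  apply/rowP; apply: ord3_ind; rewrite !mxE /=.
  + transitivity (2 * r ^+ 2 - 1); [move: N'; set A := _ / _; set B := _ / _; lra |
      by rewrite rr; field].
  + by field.
  + by field.
Qed.

End Hopf.

(** * The diffeomorphism between the link and S^2 x S^3 *)

Section LinkDiffeo.
Variables (R : realType) (e : R).
Hypothesis e0 : 0 < e.
Hypothesis zeroP : forall w : C4 R, plus_sq w = 1 -> minus_sq w = 1 ->
  let g t := rescaled_h (e ^+ 2) (curve w t) in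
  exists t0, [/\ 0 < t0 < pi / 2, g t0 = 0,
    forall t, 0 <= t < t0 -> 0 < g t,
    forall t, t0 < t <= pi / 2 -> g t < 0 & 'D_1 g t0 < 0].
Implicit Types (w z : C4 R) (p : 'rV[R]_3 * 'rV[R]_4).

Definition link_invariant z := hopf_map (normalize (to_eig z)).

Lemma link_invariant_scale (k : R[i]) z : `|k| = 1 ->
  link_invariant (scaleC4 k z) = link_invariant z.
Proof.
by move=> k1; rewrite /link_invariant -to_eig_scale normalize_scale // hopf_map_scale.
Qed.

Lemma rescaled_h0 z : h (e *: z) = 0 <-> rescaled_h (e ^+ 2) z = 0.
Proof.
rewrite h_rescaled; split=> [/eqP|->]; last by rewrite mulr0.
by rewrite mulf_eq0 expf_eq0 /= (gt_eqF e0) => /eqP.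
Qed.

Lemma h_scale_iff (k : R[i]) z : `|k| = 1 -> h (scaleC4 k z) = 0 <-> h z = 0.
Proof.
move=> k1; split; last exact: h_scale.
have k0 : k != 0 by rewrite -normr_gt0 k1.
have kV1 : `|k^-1| = 1 by rewrite normfV k1 invr1.
move=> H; have := h_scale kV1 H.
by rewrite scaleC4A mulVf // scaleC41.
Qed.

(** The angle depends only on where [link_fun] vanishes, and the circle preserves the zero set of
    [h]. *)
Lemma angle_scale (k : R[i]) w : `|k| = 1 -> angle e (scaleC4 k w) = angle e w.
Proof.
move=> k1; rewrite /angle; congr (xget 0 _); apply/seteqP.
have E t : link_fun e (scaleC4 k w) t = 0 <-> link_fun e w t = 0.
  rewrite /link_fun normalize_scale // /curve combine_scale -from_eig_scale.
  by rewrite -!rescaled_h0 scaler_scale h_scale_iff.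
split=> t [tb H]; split; [exact: tb | exact: (E t).1 H | exact: tb | exact: (E t).2 H].
Qed.

Lemma link_point_scale (k : R[i]) w : `|k| = 1 ->
  link_point e (scaleC4 k w) = scaleC4 k (link_point e w).
Proof.
move=> k1; rewrite /link_point angle_scale // normalize_scale // /curve.
by rewrite combine_scale -from_eig_scale scaler_scale.
Qed.

Lemma curve_S7 w t : plus_sq w = 1 -> minus_sq w = 1 -> S7 e (e *: curve w t).
Proof.
move=> p1 m1; rewrite /curve from_eig_scaler.
apply: etrans (from_eig_norm _) _; rewrite !plus_sq_combine !minus_sq_combine p1 m1.
by rewrite !mulr1 -mulrDr cos2Dsin2 mulr1.
Qed.

Lemma link_point_link w : 0 < plus_sq w -> 0 < minus_sq w ->
  S7 e (link_point e w) /\ h (link_point e w) = 0.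
Proof.
move=> p0 m0; split.
  by apply: curve_S7; [exact: plus_sq_normalize | exact: minus_sq_normalize].
by apply/rescaled_h0; have [] := angleP zeroP p0 m0.
Qed.

Lemma link_invariant_point w : 0 < plus_sq w -> 0 < minus_sq w ->
  link_invariant (link_point e w) = hopf_map (normalize w).
Proof.
move=> p0 m0; have [/andP[t0 tpi] _ _ _ _] := angleP zeroP p0 m0.
rewrite /link_invariant /link_point /curve from_eig_scaler from_eigK combineA.
rewrite normalize_combine //; last 2 first.
- exact: plus_sq_normalize.
- exact: minus_sq_normalize.
- by rewrite mulr_gt0 // cos_gt0_pihalf // tpi andbT; lra.
- by rewrite mulr_gt0 // sin_gt0_pi // t0 /=; lra.
Qed.

Lemma polar w : plus_sq w + minus_sq w = e ^+ 2 ->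
  exists w' t, [/\ plus_sq w' = 1, minus_sq w' = 1, 0 <= t <= pi / 2
    & w = combine (e * cos t) (e * sin t) w'].
Proof.
move=> N.
pose r := Num.sqrt (plus_sq w); pose s := Num.sqrt (minus_sq w).
have r2 : r ^+ 2 = plus_sq w by rewrite sqr_sqrtr // plus_sq_ge0.
have s2 : s ^+ 2 = minus_sq w by rewrite sqr_sqrtr // minus_sq_ge0.
have r0 : 0 <= r by exact: sqrtr_ge0.
have s0 : 0 <= s by exact: sqrtr_ge0.
have re : r <= e by rewrite -(@ler_pXn2r _ 2) ?nnegrE // ?(ltW e0) // r2 -N lerDl minus_sq_ge0.
have re01 : 0 <= r / e <= 1 by rewrite divr_ge0 // ?(ltW e0) // ler_pdivrMr // mul1r.
pose t := acos (r / e).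
have ct : e * cos t = r.
  rewrite /t acosK; last by rewrite in_itv /=; lra.
  by rewrite mulrC divfK // gt_eqF.
have t0 : 0 <= t by apply: acos_ge0; lra.
have tpi : t <= pi / 2.
  rewrite leNgt; apply/negP => tp.
  have tp' : t <= pi by apply: acos_lepi; lra.
  have := pi_gt0 R => pi0.
  have : cos t < 0 by rewrite -cos_pihalf ltr_cos // in_itv /=; lra.
  by rewrite -(pmulr_rlt0 _ e0) ct; lra.
have st : e * sin t = s.
  apply/eqP; rewrite -(@eqrXn2 _ 2) //; last first.
    by rewrite mulr_ge0 ?(ltW e0) // sin_ge0_pi //; have := pi_gt0 R; lra.
  by apply/eqP; rewrite exprMn sin2cos2 mulrBr mulr1 -exprMn ct r2 s2 -N; ring.
(* Supplies a unit vector in place of a half of w that vanishes; the coefficient of that half is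
   then 0, so the choice is harmless. *)
pose o : C4 R := mkC4 (row4 1 0 1 0) (row4 0 0 0 0).
have [po mo] : plus_sq o = 1 /\ minus_sq o = 1.
  by rewrite /plus_sq /minus_sq /modsq !mxE /=; split; ring.
pose u := if r == 0 then combine 1 0 o else combine r^-1 0 w.
pose v := if s == 0 then combine 0 1 o else combine 0 s^-1 w.
have zero (a b : R) : a ^+ 2 + b ^+ 2 = 0 -> a = 0 /\ b = 0.
  by move/eqP; rewrite paddr_eq0 ?sqr_ge0 // !sqrf_eq0 => /andP[/eqP-> /eqP->].
have modsq_ge0 l : 0 <= modsq w l by rewrite addr_ge0 // sqr_ge0.
have pu : plus_sq u = 1 /\ combine r 0 u = combine 1 0 w.
  rewrite /u; case: eqVneq => [rE|rn0].
    rewrite plus_sq_combine po; split; first by rewrite expr1n mulr1.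
    move: r2; rewrite rE expr0n /= /plus_sq => /esym/eqP.
    rewrite paddr_eq0 // => /andP[/eqP/zero[w1 w2] /eqP/zero[w3 w4]].
    by apply: C4_eq; apply: ord4_ind; rewrite !mxE /= ?w1 ?w2 ?w3 ?w4; ring.
  by rewrite plus_sq_combine exprVn r2 mulVf ?combineA ?mulfV ?mulr0 // -r2 expf_neq0.
have pv : minus_sq v = 1 /\ combine 0 s v = combine 0 1 w.
  rewrite /v; case: eqVneq => [sE|sn0].
    rewrite minus_sq_combine mo; split; first by rewrite expr1n mulr1.
    move: s2; rewrite sE expr0n /= /minus_sq => /esym/eqP.
    rewrite paddr_eq0 // => /andP[/eqP/zero[w1 w2] /eqP/zero[w3 w4]].
    by apply: C4_eq; apply: ord4_ind; rewrite !mxE /= ?w1 ?w2 ?w3 ?w4; ring.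
  by rewrite minus_sq_combine exprVn s2 mulVf ?combineA ?mulfV ?mulr0 // -s2 expf_neq0.
pose w' := combine 1 0 u + combine 0 1 v.
have pw : plus_sq w' = plus_sq u by rewrite /plus_sq /modsq !mxE /=; ring.
have mw : minus_sq w' = minus_sq v by rewrite /minus_sq /modsq !mxE /=; ring.
exists w', t; rewrite pw mw t0 tpi ct st; split => //; [exact: pu.1|exact: pv.1|].
have -> : combine r s w' = combine r 0 u + combine 0 s v.
  by apply: C4_eq; apply: ord4_ind; rewrite !mxE /=; ring.
rewrite pu.2 pv.2.
by apply: C4_eq; apply: ord4_ind; rewrite !mxE /=; ring.
Qed.

(** Every point of the sphere lies on a quarter circle, and a zero of [h] on it must be its
    [link_point]. That zero is interior, so both halves are nonzero and the invariants are smooth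
    near z. *)
Lemma linkP z : S7 e z -> h z = 0 -> exists w,
  [/\ plus_sq w = 1, minus_sq w = 1, z = link_point e w,
      0 < plus_sq (to_eig z) & 0 < minus_sq (to_eig z)].
Proof.
move=> Sz hz.
have N : plus_sq (to_eig z) + minus_sq (to_eig z) = e ^+ 2.
  by rewrite -from_eig_norm to_eigK.
have [w [t [p1 m1 tb wE]]] := polar N.
have zE : z = e *: curve w t.
  by rewrite /curve from_eig_scaler combineA -wE to_eigK.
have p0 : 0 < plus_sq w by rewrite p1.
have m0 : 0 < minus_sq w by rewrite m1.
have tE : t = angle e w.
  apply: (angle_uniq zeroP) => //.
  by rewrite /link_fun normalize_id //; apply/rescaled_h0; rewrite -zE.
have [/andP[t0 tpi] _ _ _ _] := angleP zeroP p0 m0.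
exists w; rewrite {1}zE /link_point normalize_id // tE; split=> //.
  rewrite wE plus_sq_combine p1 mulr1 exprn_gt0 // mulr_gt0 // tE.
  by rewrite cos_gt0_pihalf // tpi andbT; lra.
rewrite wE minus_sq_combine m1 mulr1 exprn_gt0 // mulr_gt0 // tE.
by rewrite sin_gt0_pi // t0 /=; lra.
Qed.

Definition invariant_of_orbit (q : set (C4 R)) := link_invariant (xget 0 q).

Lemma invariant_of_orbitE z : invariant_of_orbit (circle_orbit z) = link_invariant z.
Proof.
rewrite /invariant_of_orbit; case: xgetP => [y _ [k /= k1 <-]|/(_ z) []].
  by rewrite link_invariant_scale.
exact: circle_orbit_refl.
Qed.

Definition orbit_of_invariant p : set (C4 R) :=
  circle_orbit (link_point e (hopf_section (p.1 0 j0 < 0) p)).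

Lemma chart_cover p : dotsq p.2 = 1 -> chart (p.1 0 j0 < 0) p.
Proof.
move=> x1; split; last by rewrite x1.
by case: (ltrP (p.1 0 j0) 0) => n0; rewrite /= ?expr0 ?expr1; lra.
Qed.

(** Over the overlap the two sections differ by a phase and [link_point] is equivariant. The jump of
    the section selected by the sign of n_0 is therefore invisible in the quotient, and each fixed
    chart yields a smooth lift. *)
Lemma orbit_of_invariant_chart b p : chart b p -> dotsq p.1 = 1 -> dotsq p.2 = 1 ->
  orbit_of_invariant p = circle_orbit (link_point e (hopf_section b p)).
Proof.
move=> Op n1 x1; rewrite /orbit_of_invariant; set b' := _ < 0.
have Op' : chart b' p by exact: chart_cover.
have [q1 q2] := hopf_sectionK Op n1; have [q1' q2'] := hopf_sectionK Op' n1.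
have [k k1 ->] := hopf_fiber q1 q1' (etrans q2 (esym q2')).
by rewrite link_point_scale //; apply: circle_orbit_eq; exists k.
Qed.

Lemma orbit_of_invariant_hopf w : plus_sq w = 1 -> minus_sq w = 1 ->
  orbit_of_invariant (hopf_map w) = circle_orbit (link_point e w).
Proof.
move=> p1 m1; have [n1 x1] := hopf_sphere p1 m1.
have Op := chart_cover x1.
have [q1 q2] := hopf_sectionK Op n1.
have [k k1 E] := hopf_fiber p1 q1 (esym q2).
by rewrite /orbit_of_invariant E link_point_scale //; apply: circle_orbit_eq; exists k.
Qed.

Lemma section_unit b p : chart b p -> dotsq p.1 = 1 -> dotsq p.2 = 1 ->
  plus_sq (hopf_section b p) = 1 /\ minus_sq (hopf_section b p) = 1.
Proof.
move=> Op n1 x1; have [q1 _] := hopf_sectionK Op n1; split => //.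
by case: b {Op} q1; rewrite /hopf_section plus_sq_lift minus_sq_lift x1 mul1r.
Qed.

Let link_orbit z : link R26 e (circle_orbit z) -> S7 e z /\ h z = 0.
Proof.
rewrite link_R26E => -[y [Sy hy] yz].
have [k /= k1 <-] : circle_orbit y z by rewrite yz; exact: circle_orbit_refl.
by split; [exact: S7_scale | exact: h_scale].
Qed.

Let invariant_sphere z : S7 e z -> h z = 0 ->
  dotsq (link_invariant z).1 = 1 /\ dotsq (link_invariant z).2 = 1.
Proof.
move=> Sz hz; have [w [p1 m1 -> _ _]] := linkP Sz hz.
by rewrite link_invariant_point ?p1 ?m1 // normalize_id //; exact: hopf_sphere.
Qed.

Let open_set : open [set z : C4 R | 0 < plus_sq (to_eig z) /\ 0 < minus_sq (to_eig z)].
Proof.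
have C : smooth_coords setT (@to_eig R).
  apply: smooth_to_eig; first exact: openT.
  by move=> l; split=> k; [exact: class_C_fst_coord | exact: class_C_snd_coord].
rewrite -[X in open X]/((fun z : C4 R => plus_sq (to_eig z)) @^-1` [set x | 0 < x] `&`
  (fun z : C4 R => minus_sq (to_eig z)) @^-1` [set x | 0 < x]).
apply: openI; apply: open_comp; try exact: open_gt.
  move=> z _; apply: (@class_C_continuous _ _ _ 0 setT) => //.
  by apply: smooth_plus_sq => //; exact: openT.
move=> z _; apply: (@class_C_continuous _ _ _ 0 setT) => //.
by apply: smooth_minus_sq => //; exact: openT.
Qed.

Let smooth_link_invariant :
  smooth_on [set z : C4 R | 0 < plus_sq (to_eig z) /\ 0 < minus_sq (to_eig z)]
    link_invariant.
Proof.
set O := (X in smooth_on X _).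
have C : smooth_coords O (fun z => normalize (to_eig z)).
  apply: smooth_normalize => //; [|by move=> z []|by move=> z []].
  apply: smooth_to_eig => // l.
  by split=> k; [exact: class_C_fst_coord | exact: class_C_snd_coord].
have C1 l : smooth_on O (fun z => (normalize (to_eig z)).1 0 l) := (C l).1.
have C2 l : smooth_on O (fun z => (normalize (to_eig z)).2 0 l) := (C l).2.
move=> k; apply: class_C_pair => //; apply: class_C_rV => //; move: k.
  move=> + i; elim/ord3_ind: i;
  (apply: smooth_on_ext; [by move=> z; rewrite !mxE /=; reflexivity|]);
  repeat first [exact: C1 | exact: C2 | exact: smooth_cst | apply: smoothN => //
    | apply: smoothD => // | apply: smoothM => //].
move=> + i; elim/ord4_ind: i;
(apply: smooth_on_ext; [by move=> z; rewrite !mxE /=; reflexivity|]);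
repeat first [exact: C1 | exact: C2 | exact: smooth_cst | apply: smoothN => //
  | apply: smoothD => // | apply: smoothM => //].
Qed.

Lemma smooth_invariant_of_orbit :
  smooth_map (M := CP3_space e) (N := S2xS3_space R) (link R26 e) (S2xS3 R)
    invariant_of_orbit.
Proof.
split=> [q|z Sz zl].
  rewrite link_R26E => -[z [Sz hz] <-]; rewrite invariant_of_orbitE.
  by exists (link_invariant z) => //; have [? ?] := invariant_sphere Sz hz.
exists [set z : C4 R | 0 < plus_sq (to_eig z) /\ 0 < minus_sq (to_eig z)], link_invariant.
have [_ hz] := link_orbit zl.
split => //; first by have [w [_ _ _ ? ?]] := linkP Sz hz.
move=> y _ Sy /link_orbit[_ hy]; rewrite /= invariant_of_orbitE; split => //.
exact: invariant_sphere.
Qed.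

Lemma smooth_orbit_of_invariant :
  smooth_map (M := S2xS3_space R) (N := CP3_space e) (S2xS3 R) (link R26 e)
    orbit_of_invariant.
Proof.
split=> [_ [p [n1 x1] <-]|p [n1 x1] _].
  have Op := chart_cover x1; rewrite link_R26E.
  exists (link_point e (hopf_section (p.1 0 j0 < 0) p)) => //.
  apply: link_point_link; [exact: plus_sq_section_gt0 | exact: minus_sq_section_gt0].
have Op := chart_cover x1; set b := _ < 0 in Op.
exists (chart b), (fun p => link_point e (hopf_section b p)); split.
- exact: chart_open.
- exact: Op.
- apply: (smooth_link_point zeroP) => //.
  + exact: chart_open.
  + exact: smooth_hopf_section.
  + by move=> y; exact: plus_sq_section_gt0.
  + by move=> y; exact: minus_sq_section_gt0.
- move=> y Oy [y1 y2] _; split; last by rewrite (orbit_of_invariant_chart Oy).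
  apply: (link_point_link _ _).1; [exact: plus_sq_section_gt0 | exact: minus_sq_section_gt0].
Qed.

Lemma orbit_of_invariantK q : link R26 e q -> orbit_of_invariant (invariant_of_orbit q) = q.
Proof.
rewrite link_R26E => -[z [Sz hz] <-]; rewrite invariant_of_orbitE.
have [w [p1 m1 -> _ _]] := linkP Sz hz.
by rewrite link_invariant_point ?p1 ?m1 // normalize_id // orbit_of_invariant_hopf.
Qed.

Lemma invariant_of_orbitK p : S2xS3 R p -> invariant_of_orbit (orbit_of_invariant p) = p.
Proof.
move=> [q [n1 x1] <-] /=; have Op := chart_cover x1.
have [p1 m1] := section_unit Op n1 x1.
rewrite /orbit_of_invariant invariant_of_orbitE link_invariant_point ?p1 ?m1 //.
by rewrite normalize_id //; have [] := hopf_sectionK Op n1.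
Qed.

End LinkDiffeo.

(** * The real link and complex conjugation *)

Section RealLink.
Variables (R : realType) (e : R).
Hypothesis e_pi : 0 < e < pi.
Implicit Types (z : C4 R) (x : 'rV[R]_4).

Let e0 : 0 < e. Proof. by case/andP: e_pi. Qed.

Lemma antipodal_pairN x : antipodal_pair (- x) = antipodal_pair x.
Proof.
by rewrite /antipodal_pair opprK setUC.
Qed.

Lemma antipodal_pair_sign (b : bool) x : antipodal_pair ((-1) ^+ b *: x) = antipodal_pair x.
Proof. by case: b; rewrite ?scaleN1r ?scale1r ?antipodal_pairN. Qed.

(** If a + i c carries a nonzero real vector x to a real vector, then c x = 0, so c = 0 and a is 1
    or -1. An orbit thus meets R^4 in at most one antipodal pair. *)
Lemma real_orbit z (k : R[i]) : realC4 z -> z <> 0 -> `|k| = 1 -> realC4 (scaleC4 k z) ->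
  exists b : bool, scaleC4 k z = (-1) ^+ b *: z.
Proof.
case: z => x y; rewrite /realC4 /= => -> z0 /normc_sq1.
case: k => a c /= k1; rewrite scaler0 add0r => /eqP; rewrite scaler_eq0.
case/orP=> [/eqP c0|/eqP x0]; last by case: z0; rewrite x0.
have : a ^+ 2 == 1 by rewrite -k1 c0 expr0n addr0.
rewrite sqrf_eq1 => /orP[]/eqP aE; [exists false|exists true];
  by apply: C4_eq => l; rewrite !mxE /= aE c0; ring.
Qed.

Lemma realS7_neq0 z : S7 e z -> z <> 0.
Proof.
move=> Sz z0; move: Sz; rewrite z0 /S7 /= !dotsq4 !mxE !expr0n /= !addr0.
by move/esym/eqP; rewrite expf_eq0 /= gt_eqF.
Qed.

Definition real_point (q : set (C4 R)) : 'rV[R]_4 :=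
  (xget 0 [set z | q z /\ realC4 z]).1.

Definition antipodal_of_orbit q := antipodal_pair (e^-1 *: real_point q).

Lemma antipodal_of_orbitE z : S7 e z -> realC4 z ->
  antipodal_of_orbit (circle_orbit z) = antipodal_pair (e^-1 *: z.1).
Proof.
move=> Sz zR; rewrite /antipodal_of_orbit /real_point.
case: xgetP => [y _ [[k /= k1 <-] yR]|/(_ z)]; last first.
  by case; split => //; exact: circle_orbit_refl.
have [b ->] := real_orbit zR (realS7_neq0 Sz) k1 yR.
by rewrite /= scalerA mulrC -scalerA antipodal_pair_sign.
Qed.

Definition orbit_of_antipodal (s : set 'rV[R]_4) : set (C4 R) :=
  circle_orbit (mkC4 (e *: xget 0 s) 0).

Lemma orbit_of_antipodalE x :
  orbit_of_antipodal (antipodal_pair x) = circle_orbit (mkC4 (e *: x) 0).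
Proof.
rewrite /orbit_of_antipodal; case: xgetP => [y _ []->|/(_ x)[]] //; last by left.
apply: circle_orbit_eq; exists (-1); first by rewrite /= normrN normr1.
rewrite /scaleC4 /mkC4 /= oppr0 !scaler0 subr0 scale0r addr0.
by rewrite scaleN1r scalerN.
Qed.

Lemma dotsqZ (a : R) x : dotsq (a *: x) = a ^+ 2 * dotsq x.
Proof. by rewrite !dotsq4 !mxE; ring. Qed.

Lemma S7_real x : dotsq x = 1 -> S7 e (mkC4 (e *: x) 0).
Proof.
move=> x1; apply: etrans (_ : dotsq (e *: x) + dotsq 0 = _) _ => //.
by rewrite dotsqZ x1 dotsq4 !mxE; ring.
Qed.

Lemma dotsq_real z : S7 e z -> realC4 z -> dotsq (e^-1 *: z.1) = 1.
Proof.
rewrite /S7 /realC4 /= => + z2; rewrite z2 dotsqZ.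
have -> : dotsq (0 : 'rV[R]_4) = 0 by rewrite dotsq4 !mxE; ring.
by rewrite addr0 => ->; rewrite exprVn mulVf // expf_eq0 /= gt_eqF.
Qed.

Let link_real z : link R26B e (circle_orbit z) ->
  exists y, exists k : R[i], [/\ S7 e y, realC4 y, `|k| = 1 & z = scaleC4 k y].
Proof.
rewrite (link_R26BE e_pi) => -[y [Sy yR] yz].
have [k /= k1 kz] : circle_orbit y z by rewrite yz; exact: circle_orbit_refl.
by exists y, k.
Qed.

Lemma link_R26B_RP3 : diffeomorphic (link R26B e) (RP3 R).
Proof.
exists antipodal_of_orbit; split; last (exists orbit_of_antipodal; split).
- split=> [q|z Sz zl].
    rewrite (link_R26BE e_pi) => -[z [Sz zR] <-].
    by rewrite antipodal_of_orbitE //; exists (e^-1 *: z.1) => //; exact: dotsq_real.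
  have [y [k [Sy yR k1 zE]]] := link_real zl.
  (* A nonzero coordinate of the real representative selects the open set on which the lift is
     written. *)
  have [l yl] : exists l, y.1 0 l != 0.
    apply: contrapT => /forallNP y0; apply: (realS7_neq0 Sy).
    by apply: C4_eq => l; rewrite ?yR !mxE //; apply/eqP/negP => /negP /y0.
  have modsq_l w (b : R[i]) : `|b| = 1 -> realC4 w ->
      modsq (scaleC4 b w) l = w.1 0 l ^+ 2.
    by move=> b1 wR; rewrite modsq_scale // /modsq wR mxE; ring.
  pose O : set (C4 R) := [set w | 0 < modsq w l].
  have C1 m : smooth_on O (fun w : C4 R => w.1 0 m) by move=> j; exact: class_C_fst_coord.
  have C2 m : smooth_on O (fun w : C4 R => w.2 0 m) by move=> j; exact: class_C_snd_coord.
  have oO : open O.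
    rewrite (_ : O = (fun w : C4 R => modsq w l) @^-1` [set t | 0 < t]) //.
    apply: open_comp; last exact: open_gt.
    move=> w _; apply: (@class_C_continuous _ _ _ 0 setT) => //.
    have sc : smooth_coords setT (@id (C4 R)).
      by move=> m; split=> j; [exact: class_C_fst_coord | exact: class_C_snd_coord].
    by have := smooth_modsq (openT) l sc; apply.
  (* For w = b v with v real and |b| = 1, the numbers Re (w_m conj w_l) / |w_l| equal v_m up to the
     common sign of v_l. This removes the phase b by a formula that is smooth where w_l is
     nonzero. *)
  exists O, (fun w => \row_m (e^-1 * (re_mul w m l * (Num.sqrt (modsq w l))^-1))).
  split => //.
  + by rewrite /O /= zE modsq_l // exprn_even_gt0.
  + move=> j; apply: class_C_rV => // m; move: j.
    apply: smooth_on_ext; first by move=> w; rewrite mxE; reflexivity.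
    have sc : smooth_coords O (@id (C4 R)) by move=> i; split.
    apply: smoothM => //; first exact: smooth_cst.
    apply: smoothM => //.
      by apply: smoothD => //; apply: smoothM.
    apply: smooth_inv => // [w Ow|]; first by rewrite gt_eqF // sqrtr_gt0.
    by apply: smooth_sqrt => //; exact: (smooth_modsq oO l sc).
  + move=> w Ow Sw wl; have [v [b [Sv vR b1 wE]]] := link_real wl.
    have vl : v.1 0 l != 0.
      move: Ow; rewrite /O /= wE modsq_l //.
      by apply: contraTneq => ->; rewrite expr0n ltxx.
    set f := \row_m _.
    have fE : f = (-1) ^+ (v.1 0 l < 0)%R *: (e^-1 *: v.1).
      apply/rowP => m; rewrite !mxE wE modsq_l // sqrtr_sqr.
      have -> : re_mul (scaleC4 b v) m l = v.1 0 m * v.1 0 l.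
        rewrite /re_mul !mxE vR !mxE -[RHS]mul1r -(normc_sq1 b1); ring.
      rewrite (_ : v.1 0 m * v.1 0 l / `|v.1 0 l| = (-1) ^+ (v.1 0 l < 0)%R * v.1 0 m).
        by ring.
      rewrite -mulrA mulrC; congr (_ * _); rewrite -{1}[v.1 0 l]mulr_sign_norm mulfK //.
      by rewrite normr_eq0.
    split; first by rewrite fE; apply: etrans (dotsqZ _ _) _; rewrite sqrr_sign mul1r dotsq_real.
    have wv : circle_orbit w = circle_orbit v by rewrite wE; apply: circle_orbit_eq; exists b.
    by rewrite /= wv antipodal_of_orbitE // fE antipodal_pair_sign.
- split=> [_ [x x1 <-]|x x1 _].
    rewrite /= orbit_of_antipodalE (link_R26BE e_pi).
    by exists (mkC4 (e *: x) 0) => //; split => //; exact: S7_real.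
  exists setT, (fun x => mkC4 (e *: x) 0); split => //; first exact: openT.
    apply: smooth_coords_on; first exact: openT.
    move=> l; split; apply: smooth_on_ext; try by move=> y; rewrite !mxE /=; reflexivity.
      apply: smoothM; [exact: openT|exact: smooth_cst|].
      by move=> j; exact: class_C_coord.
    exact: smooth_cst.
  move=> y _ y1 _; rewrite /= orbit_of_antipodalE; split => //; exact: S7_real.
- move=> q; rewrite (link_R26BE e_pi) => -[z [Sz zR] <-].
  rewrite antipodal_of_orbitE // orbit_of_antipodalE scalerA mulfV ?gt_eqF // scale1r.
  by rewrite -zR; case: z {Sz zR}.
- move=> _ [x x1 <-]; rewrite /= orbit_of_antipodalE antipodal_of_orbitE //.
    by rewrite /= scalerA mulVf ?gt_eqF // scale1r.
  exact: S7_real.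
Qed.

End RealLink.

(** * Complex conjugation on the link *)

Section Conjugation.
Variables (R : realType) (e : R).
Implicit Types z : C4 R.

Lemma conjC4K : involutive (@conjC4 R).
Proof. by case=> x y; rewrite /conjC4 /mkC4 /= opprK. Qed.

(** Conjugation fixes [modsq] and [re_mul] and changes the sign of [im_mul], and each term of
    [rescaled_h] has exactly one factor [im_mul]. The case e = 1 of [h_rescaled] transfers this to
    [h]. *)
Lemma h_conj z : h (conjC4 z) = - h z.
Proof.
have M l : modsq (conjC4 z) l = modsq z l by rewrite /modsq !mxE; ring.
have Re l m : re_mul (conjC4 z) l m = re_mul z l m by rewrite /re_mul !mxE; ring.
have Im l m : im_mul (conjC4 z) l m = - im_mul z l m by rewrite /im_mul !mxE; ring.
rewrite -[conjC4 z]scale1r -[z in RHS]scale1r !h_rescaled /rescaled_h !M !Re !Im; ring.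
Qed.

Lemma S7_conj z : S7 e z -> S7 e (conjC4 z).
Proof.
rewrite /S7 /= => <-; congr (_ + _); rewrite !dotsq4 !mxE; ring.
Qed.

Lemma scaleC4_conj (k : R[i]) z : conjC4 (scaleC4 k z) = scaleC4 (k^*)%C (conjC4 z).
Proof. by case: k => a b; apply: C4_eq => l; rewrite !mxE /=; ring. Qed.

Lemma conjCP3_orbit z : conjCP3 (circle_orbit z) = circle_orbit (conjC4 z).
Proof.
have conj1 (k : R[i]) : `|k| = 1 -> `|(k^*)%C| = 1.
  by move=> /normc_sq1 k1; apply: sq1_normc; rewrite -k1; case: k {k1} => a b /=; ring.
apply/seteqP; split=> w.
  move=> [_ [k /= k1 <-] <-]; rewrite scaleC4_conj; exists (k^*)%C => //; exact: conj1.
move=> [k /= k1 <-]; exists (conjC4 (scaleC4 k (conjC4 z))); last by rewrite conjC4K.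
by rewrite scaleC4_conj conjC4K; exists (k^*)%C => //; exact: conj1.
Qed.

Lemma conj_link : @conjCP3 R @` link R26 e = link R26 e.
Proof.
rewrite link_R26E; apply/seteqP; split=> q.
  move=> [_ [z [Sz hz] <-] <-]; rewrite conjCP3_orbit; exists (conjC4 z) => //.
  by split; [exact: S7_conj | rewrite h_conj hz oppr0].
move=> [z [Sz hz] <-]; exists (circle_orbit (conjC4 z)).
  by exists (conjC4 z) => //; split; [exact: S7_conj | rewrite h_conj hz oppr0].
by rewrite conjCP3_orbit conjC4K.
Qed.

Lemma h_real z : realC4 z -> h z = 0.
Proof.
rewrite /realC4 /= => z2; have zc : conjC4 z = z.
  by case: z z2 => x y /= ->; rewrite /conjC4 /mkC4 /= oppr0.
by have := h_conj z; rewrite zc; lra.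
Qed.

Lemma conj_fixed_link : 0 < e < pi ->
  [set q | link R26 e q /\ conjCP3 q = q] = link R26B e.
Proof.
move=> e_pi; rewrite (link_R26BE e_pi) link_R26E; apply/seteqP; split=> q /=.
  move=> [[z [Sz hz] <-]]; rewrite conjCP3_orbit => zc.
  have [k /= k1 zk] : circle_orbit z (conjC4 z) by rewrite -zc; exact: circle_orbit_refl.
  have [d d2] : exists d : R[i], d ^+ 2 = k by exists (sqrtc k); rewrite sqr_sqrtc.
  have d1 : `|d| = 1.
    have : `|d| ^+ 2 = 1 by rewrite -normrX d2.
    by move=> /eqP; rewrite sqrp_eq1 // => /eqP.
  exists (scaleC4 d z); last by apply: circle_orbit_eq; exists d.
  split; first exact: S7_scale.
  suff : conjC4 (scaleC4 d z) = scaleC4 d z.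
    move=> /(congr1 snd) /= H; rewrite /realC4 /=; apply/rowP => l.
    by have := congr1 (fun x : 'rV[R]_4 => x 0 l) H; rewrite !mxE; lra.
  rewrite scaleC4_conj -zk scaleC4A -d2; congr (scaleC4 _ z).
  case: d d1 {d2} => a b /normc_sq1 /= N.
  rewrite expr2 mulrA.
  suff -> : ((a -i* b) * (a +i* b) = 1)%C by rewrite mul1r.
  by apply/eqP; rewrite eq_complex /=; apply/andP; split; apply/eqP; rewrite -?N; ring.
move=> [z [Sz zR] <-]; split; first by exists z => //; split => //; exact: h_real.
rewrite conjCP3_orbit; congr circle_orbit.
by case: z zR {Sz} => x y; rewrite /realC4 /= => ->; rewrite /conjC4 /mkC4 /= oppr0.
Qed.

End Conjugation.

Theorem theorem4p4 (R : realType) :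
  R26ab (@rho0 R) /\
  exists2 eps0 : R, 0 < eps0 &
  forall eps : R, 0 < eps < eps0 ->
    [/\ diffeomorphic (link R26B eps) (RP3 R),
        diffeomorphic (link R26 eps) (S2xS3 R),
        exists2 F, smooth_embedding (N := CP3_space eps) (S2xS3 R) F
                 & F @` S2xS3 R = link R26 eps,
        @conjCP3 R @` link R26 eps = link R26 eps
      & [set p | link R26 eps p /\ conjCP3 p = p] = link R26B eps].
Proof.
split; first exact: rho0_in_R26ab.
have [eps0 /andP[eps0_gt0 eps0_le1] zeroP] := curve_zero R.
exists eps0 => // eps eps_itv; have {}zeroP := zeroP eps eps_itv.
have /andP[e0 e1] := eps_itv.
(* A radius below pi keeps sin |z_l| positive at nonzero coordinates, as [link_R26BE] requires; it
   follows from eps0 <= 1 and pi >= 2. *)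
have e_pi : 0 < eps < pi by have := pi_ge2 R; rewrite e0 /=; lra.
have SF := smooth_invariant_of_orbit e0 zeroP.
have SG := smooth_orbit_of_invariant e0 zeroP.
have FK := orbit_of_invariantK e0 zeroP.
have GK := invariant_of_orbitK e0 zeroP.
have imG : orbit_of_invariant eps @` S2xS3 R = link R26 eps.
  apply/seteqP; split=> q; first by move=> [p Sp <-]; exact: SG.1.
  by move=> lq; exists (invariant_of_orbit q); [exact: SF.1 | exact: FK].
split.
- exact: link_R26B_RP3.
- by exists (@invariant_of_orbit R); split=> //; exists (orbit_of_invariant eps).
(* The embedding is the inverse diffeomorphism, regarded as a map into CP^3. *)
- exists (orbit_of_invariant eps) => //; split.
    split; last exact: SG.2.
    move=> p /SG.1; rewrite link_R26E => -[z [Sz _] zE].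
    by exists z.
  by rewrite imG; split=> //; exists (@invariant_of_orbit R).
- exact: conj_link.
- exact: conj_fixed_link.
Qed.
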